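(* Let $m\ge 0$ be an integer, $\tau=\tau_m$, and let $F\in L^{1}_\tau(\mathbb{R}^3)$ be such that its classical Fourier transform $\widehat{F}$ is integrable. Then $$F(x)=\sum_{j=-m}^{m}\int_0^{\infty}\mathcal{F}(F)(\Phi_{r,j})\,\Phi_{r,j}(x)\,r^2\,dr .$$
   Context: $H_m$ is the complex space of harmonic homogeneous polynomials of degree $m$ on $\mathbb{R}^3$, of dimension $d_{\tau_m}=2m+1$. The irreducible unitary representation $\tau_m$ of $SO(3)$ acts on $V_{\tau_m}=H_m$ by $(\tau_m(k)p)(x)=p(k^{-1}\cdot x)$ for $k\in SO(3)$, and $d\tau_m$ is the derived representation of $so(3)$. Let $Y_1=\begin{pmatrix}0&0&0\\0&0&1\\0&-1&0\end{pmatrix}$, $Y_2=\begin{pmatrix}0&0&-1\\0&0&0\\1&0&0\end{pmatrix}$, $Y_3=\begin{pmatrix}0&1&0\\-1&0&0\\0&0&0\end{pmatrix}$, and for $x=(x_1,x_2,x_3)\in\mathbb{R}^3$ put $d\tau_m(x):=\sum_{i=1}^3x_i\,d\tau_m(Y_i)$. $L^1_{\tau}(\mathbb{R}^3)$ is the space of integrable $\mathrm{End}(V_{\tau_m})$-valued functions $F$ on $\mathbb{R}^3$ with $F(k\cdot x)=\tau_m(k)F(x)\tau_m(k)^{-1}$ for all $k\in SO(3)$. For $r>0$ and integers $-m\le j\le m$, the $\tau_m$-spherical function $\Phi_{r,j}$ is $\Phi_{r,j}(x)=(2m+1)\int_{S^2}e^{-ir\langle x,\xi\rangle}P_j(\xi)\,d\sigma(\xi)$,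 where $\sigma$ is the normalized $O(3)$-invariant measure on the unit sphere $S^2\subset\mathbb{R}^3$ and $P_j(\xi)$ is the orthogonal projection of $V_{\tau_m}$ onto the (one-dimensional) eigenspace of $d\tau_m(\xi)$ with eigenvalue $\sqrt{-1}\,j$. The $\tau_m$-spherical Fourier transform of $F$ is $\mathcal{F}(F)(\Phi_{r,j})=\frac{1}{d_{\tau_m}}\int_{\mathbb{R}^3}\mathrm{Tr}[F(x)\Phi_{r,j}(-x)]\,dx$. The classical Fourier transform, computed componentwise, is $\widehat F(y)=\int_{\mathbb{R}^3}F(x)e^{-i\langle x,y\rangle}\,dx$. The normalizations of the measures on $\mathbb{R}^3$ are left implicit: the classical inversion formula is written $F(x)=\int_{\mathbb{R}^3}\widehat F(y)e^{i\langle x,y\rangle}\,dy$ and polar coordinates are written $dy=r^2\,dr\,d\sigma(\xi)$ for $y=r\xi$, without constants.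
   Formalization: The implicit measures are normalized by dy = (2m+1) r² dr dσ(ξ) instead of dy = r² dr dσ(ξ), with which the right-hand side would be (2m+1)F(x); the identity is stated for almost every x, F being an L¹ class. *)

(* Defs.v *)
From HB Require Import structures.
From mathcomp Require Import all_boot all_order all_algebra.
From mathcomp Require Import sesquilinear complex.
From mathcomp Require mpoly.

Set Implicit Arguments.
Unset Strict Implicit.
Unset Printing Implicit Defensive.

Import Order.TTheory GRing.Theory Num.Theory.
Local Open Scope ring_scope.
Local Open Scope complex_scope.

(* The notations of mpoly and of MathComp-Analysis cannot be imported together,
   so everything that mentions polynomials is confined to this module. *)
Module Harmonic.
Import mpoly.

Lemma subm_self n (a : 'X_{1..n}) : (a - a)%MM = 0%MM.
Proof. by apply/mnmP => j; rewrite mnmBE mnm0E subnn. Qed.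

Section ChainRule.
Variables (C : comNzRingType) (n l : nat) (L : n.-tuple {mpoly C[l]}).

Lemma mderiv_comp i (p : {mpoly C[n]}) :
  mderiv i (p \mPo L) = \sum_(j < n) (mderiv j p \mPo L) * mderiv i (tnth L j).
Proof.
pose chain (q : {mpoly C[n]}) := mderiv i (q \mPo L) =
  \sum_(j < n) (mderiv j q \mPo L) * mderiv i (tnth L j).
have chain1 : chain 1.
  rewrite /chain comp_mpoly1 -mpolyC1 mderivC big1 // => j _.
  by rewrite mderivC comp_mpoly0 mul0r.
have chainM q1 q2 : chain q1 -> chain q2 -> chain (q1 * q2).
  rewrite /chain => e1 e2; rewrite (rmorphM (comp_mpoly L)) mderivM e1 e2.
  rewrite mulr_suml mulr_sumr -big_split; apply: eq_bigr => j _ /=.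
  rewrite mderivM comp_mpolyD !(rmorphM (comp_mpoly L)) mulrDl.
  by congr (_ + _); [rewrite mulrAC | rewrite mulrA].
have chainX j : chain 'X_j.
  rewrite /chain comp_mpolyXU -tnth_nth (bigD1 j) //= big1.
    by rewrite mderivX mnm1E eqxx scale1r subm_self mpolyX0 comp_mpoly1 mul1r addr0.
  move=> h neq; rewrite mderivX mnm1E eq_sym (negPf neq) scale0r.
  by rewrite comp_mpoly0 mul0r.
elim/mpolyind: p => [|c m p _ _ ih].
  rewrite comp_mpoly0 mderiv0 big1 // => j _.
  by rewrite mderiv0 comp_mpoly0 mul0r.
rewrite comp_mpolyD mderivD ih.
under [RHS]eq_bigr => j _ do rewrite mderivD comp_mpolyD mulrDl.
rewrite big_split; congr (_ + _); rewrite comp_mpolyZ mderivZ.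
have -> : mderiv i ('X_[m] \mPo L) =
    \sum_(j < n) (mderiv j 'X_[m] \mPo L) * mderiv i (tnth L j).
  rewrite -/(chain 'X_[m]) mpolyXE_id.
  apply: (big_ind chain) => // h _; elim: (m h) => // d IH.
  by rewrite exprS; apply: chainM.
rewrite scaler_sumr; apply: eq_bigr => j _.
by rewrite mderivZ comp_mpolyZ scalerAl.
Qed.

End ChainRule.

Section Harmonic.
Variable R : rcfType.
Implicit Types (k : 'M[R]_3) (p q : {mpoly R[i][3]}).

Definition laplacian p := \sum_(i < 3) mderiv i (mderiv i p).

(* The polynomial x |-> p (k x). *)
Definition subst_lin k p :=
  p \mPo [tuple \sum_(j < 3) (k i j)%:C *: 'X_j | i < 3].

Definition O3 k := k *m k^T = 1%:M.

Definition SO3 k := O3 k /\ \det k = 1.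

Lemma tnth_lin k (i : 'I_3) :
  tnth [tuple \sum_(j < 3) (k i j)%:C *: 'X_j : {mpoly R[i][3]} | i < 3] i =
  \sum_(j < 3) (k i j)%:C *: 'X_j.
Proof. by rewrite tnth_mktuple. Qed.

Lemma mderiv_lin k (i j : 'I_3) :
  mderiv i (\sum_(l < 3) (k j l)%:C *: 'X_l : {mpoly R[i][3]}) =
  ((k j i)%:C)%:MP.
Proof.
rewrite raddf_sum /= (bigD1 i) //= big1 ?addr0.
  by rewrite mderivZ mderivX mnm1E eqxx scale1r subm_self mpolyX0 -alg_mpolyC.
move=> l neq; rewrite mderivZ mderivX mnm1E (negPf neq).
by rewrite scale0r scaler0.
Qed.

Lemma mderiv_subst_lin k (i : 'I_3) p :
  mderiv i (subst_lin k p) =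
  \sum_(j < 3) (k j i)%:C *: subst_lin k (mderiv j p).
Proof.
rewrite mderiv_comp; apply: eq_bigr => j _.
by rewrite tnth_lin mderiv_lin mulrC mul_mpolyC.
Qed.

Lemma laplacian_subst_lin k p :
  O3 k -> laplacian (subst_lin k p) = subst_lin k (laplacian p).
Proof.
move=> kO; rewrite /laplacian.
under eq_bigr => i _.
  rewrite mderiv_subst_lin raddf_sum /=.
  under eq_bigr => j _ do
    rewrite mderivZ mderiv_subst_lin scaler_sumr.
  over.
rewrite exchange_big /=.
transitivity (\sum_(j < 3) \sum_(l < 3) ((k *m k^T) j l)%:C *:
                subst_lin k (mderiv l (mderiv j p))).
  apply: eq_bigr => j _; rewrite exchange_big /=; apply: eq_bigr => l _.
  rewrite mxE rmorph_sum scaler_suml /=; apply: eq_bigr => i _.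
  by rewrite scalerA mxE rmorphM.
rewrite [RHS]raddf_sum /=; apply: eq_bigr => j _.
rewrite (bigD1 j) //= big1 => [|l neq]; rewrite kO mxE.
  by rewrite eqxx scale1r addr0.
by rewrite eq_sym (negPf neq) scale0r.
Qed.

Lemma dhomog_mderiv d i p : p \is d.-homog -> mderiv i p \is d.-1.-homog.
Proof.
move=> /dhomogP hp; rewrite /mderiv big_seq rpred_sum // => m mp.
have [mi0|mi] := posnP (m i); first by rewrite mi0 mul0r scale0r rpred0.
apply: rpredZ; rewrite dhomogX; apply/eqP.
have le : (U_(i) <= m)%MM by rewrite lep1mP -lt0n.
have <- : mdeg m = d := hp _ mp.
by rewrite -{2}(submK le) mdegD mdeg1 addn1.
Qed.

Lemma dhomog_laplacian d p : p \is d.-homog -> laplacian p \is d.-2.-homog.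
Proof. by move=> hp; apply: rpred_sum => i _; do 2!apply: dhomog_mderiv. Qed.

Lemma dhomog_subst_lin d k p : p \is d.-homog -> subst_lin k p \is d.-homog.
Proof.
move=> /dhomogP hp; rewrite /subst_lin comp_mpolyE big_seq rpred_sum // => m mp.
apply: rpredZ; have <- : mdeg m = d := hp _ mp; rewrite mdegE.
apply: (big_ind2 (fun q (n : nat) => q \is n.-homog)) => [|q1 n1 q2 n2|i _].
- exact: dhomog1.
- exact: dhomogM.
rewrite tnth_lin -[X in X.-homog]mul1n; apply: dhomogMn.
by apply: rpred_sum => j _; rewrite rpredZ // dhomogX /= mdeg1.
Qed.

Section Degree.
Variable m : nat.

Definition laplacian_hom (p : dhomog 3 R[i] m) : dhomog 3 R[i] m.-2 :=
  DHomog (dhomog_laplacian (dhomog_is_dhomog p)).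

Lemma laplacian_hom_is_linear : linear laplacian_hom.
Proof.
move=> c p q; apply/val_inj => /=; rewrite /laplacian.
rewrite scaler_sumr -big_split /=; apply: eq_bigr => i _.
by rewrite !linearP.
Qed.
HB.instance Definition _ :=
  GRing.isLinear.Build R[i] (dhomog 3 R[i] m) (dhomog 3 R[i] m.-2) _
    laplacian_hom laplacian_hom_is_linear.

Definition harmonic : {vspace dhomog 3 R[i] m} := lker (linfun laplacian_hom).

Lemma mem_harmonic (p : dhomog 3 R[i] m) :
  (p \in harmonic) = (laplacian p == 0).
Proof. by rewrite memv_ker lfunE. Qed.

Definition H := subvs_of harmonic.

Definition mpoly_of_H (p : H) : {mpoly R[i][3]} := mpoly_of_dhomog (vsval p).

(* [vsproj] is total: for k not orthogonal it projects onto [harmonic], so that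
   only the values tau k with k orthogonal are meaningful, see [tauE]. *)
Definition tau_fun k (p : H) : H :=
  vsproj harmonic
    (DHomog (dhomog_subst_lin (invmx k) (dhomog_is_dhomog (vsval p)))).

Lemma tau_fun_is_linear k : linear (tau_fun k).
Proof.
move=> c p q; rewrite /tau_fun -linearP; congr vsproj.
by apply/val_inj => /=; rewrite /subst_lin linearP.
Qed.
HB.instance Definition _ k :=
  GRing.isLinear.Build R[i] H H _ (tau_fun k) (tau_fun_is_linear k).

Definition tau k : 'End(H) := linfun (tau_fun k).

Lemma tauE k (p : H) : O3 k ->
  mpoly_of_H (tau k p) = subst_lin (invmx k) (mpoly_of_H p).
Proof.
move=> kO; rewrite /mpoly_of_H lfunE /= vsprojK // mem_harmonic /=.
rewrite laplacian_subst_lin; last first.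
  have [ku _] := mulmx1_unit kO.
  have -> : invmx k = k^T by rewrite -[LHS]mulmx1 -kO mulKmx.
  by rewrite /O3 trmxK; apply: mulmx1C.
have := valP p; rewrite -[val p]/(vsval p) mem_harmonic => /eqP ->.
by rewrite /subst_lin raddf0.
Qed.

End Degree.
End Harmonic.
End Harmonic.

From mathcomp Require Import all_classical all_reals all_analysis.
Import numFieldNormedType.Exports.
Import Harmonic.

Local Open Scope classical_set_scope.

Section VectorIntegral.
Context {R : realType} d {T : measurableType d}.
Variables (mu : {measure set T -> \bar R}) (D : set T).

Definition cintegrable (f : T -> R[i]) :=
  mu.-integrable D (fun x => (complex.Re (f x))%:E) /\
  mu.-integrable D (fun x => (complex.Im (f x))%:E).

(* Integrals of complex and of vector-valued functions are taken componentwise;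
   the result does not depend on the basis. *)
Definition cint (f : T -> R[i]) : R[i] :=
  (\int[mu]_(x in D) complex.Re (f x)) +i* (\int[mu]_(x in D) complex.Im (f x)).

Definition vintegrable {V : vectType R[i]} (f : T -> V) :=
  forall i, cintegrable (fun x => coord (vbasis {:V}) i (f x)).

Definition vint {V : vectType R[i]} (f : T -> V) : V :=
  \sum_i cint (fun x => coord (vbasis {:V}) i (f x)) *: (vbasis {:V})`_i.

End VectorIntegral.

Section VectorDerivative.
Context {R : realType} {V : vectType R[i]}.

Definition cderive (f : R -> R[i]) (t : R) : R[i] :=
  (fun s => complex.Re (f s))^`() t +i* (fun s => complex.Im (f s))^`() t.

Definition vderive (f : R -> V) (t : R) : V :=
  \sum_i cderive (fun s => coord (vbasis {:V}) i (f s)) t *: (vbasis {:V})`_i.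

End VectorDerivative.

Definition endtr {K : fieldType} {V : vectType K} (f : 'End(V)) : K :=
  \tr (passmx.mxof (vbasis {:V}) (vbasis {:V}) f).

Notation R3 R :=
  (measurableTypeR R * measurableTypeR R * measurableTypeR R)%type.

Section Spherical.
Variable R : realType.

Definition col3 (x : R3 R) : 'cV[R]_3 := \col_i nth 0 [:: x.1.1; x.1.2; x.2] i.

Definition of_col3 (v : 'cV[R]_3) : R3 R := (v 0 0, v 1 0, v 2 0).

Definition act (k : 'M[R]_3) (x : R3 R) : R3 R := of_col3 (k *m col3 x).

Definition opp3 (x : R3 R) : R3 R := of_col3 (- col3 x).

Definition dot3 (x y : R3 R) : R := \sum_(i < 3) col3 x i 0 * col3 y i 0.

Definition leb3 (c : {nonneg R}) : {measure set (R3 R) -> \bar R} :=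
  mscale c
    ((@lebesgue_measure R \x @lebesgue_measure R) \x @lebesgue_measure R)%E.

Definition leb1 (c : {nonneg R}) : {measure set (measurableTypeR R) -> \bar R} :=
  mscale c (@lebesgue_measure R).

(* Multiples of Lebesgue measure, dx = a Leb and dy = b Leb on R^3 and dr = c Leb
   on R, for which the inversion formulas hold without constants.  The first
   equation is the classical formula F(x) = \int Fhat(y) e^{i<x,y>} dy.  The
   second one reads dy = (2m+1) r^2 dr dsigma, the sphere having area 4 pi.  The
   factor 2m+1 is forced: if F(x) = f(|x|) Id, then the transform of F at
   Phi_{r,j} is the Fourier transform of f at radius r for every j, whereas
   \sum_j Phi_{r,j}(0) = (2m+1) Id. *)
Definition normalized_measures (m : nat) (a b c : {nonneg R}) :=
  a%:num * b%:num * (2 * pi) ^+ 3 = 1 /\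
  4 * pi * b%:num = (2 * m).+1%:R * c%:num.

Definition sphere : set (R3 R) := [set x | dot3 x x = 1].

Definition is_sphere_measure (sigma : probability (R3 R) R) :=
  sigma sphere = 1%E /\
  forall k A, O3 k -> measurable A -> sigma (act k @^-1` A) = sigma A.

Definition expi (t : R) : R[i] := cos t +i* sin t.

Definition expmx n (A : 'M[R]_n.+1) : 'M[R]_n.+1 :=
  \matrix_(i, j) limn (series (fun l => l`!%:R^-1 * (A ^+ l) i j)).

Definition mx_of_rows (s : seq (seq R)) : 'M[R]_3 :=
  \matrix_(i, j) nth 0 (nth [::] s i) j.

Definition Y (i : 'I_3) : 'M[R]_3 := mx_of_rows (nth [::]
  [:: [:: [:: 0; 0; 0]; [:: 0; 0; 1]; [:: 0; -1; 0]];
      [:: [:: 0; 0; -1]; [:: 0; 0; 0]; [:: 1; 0; 0]];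
      [:: [:: 0; 1; 0]; [:: -1; 0; 0]; [:: 0; 0; 0]]] i).

Section Representation.
Variable m : nat.
Notation V := (H R m).

Definition derived_tau (X : 'M[R]_3) : 'End(V) :=
  vderive (fun t => tau m (expmx (t *: X))) 0.

Definition dtau (x : R3 R) : 'End(V) :=
  \sum_(i < 3) (col3 x i 0)%:C *: derived_tau (Y i).

(* tau_m being irreducible, such an inner product is unique up to a scalar, which
   does not affect the orthogonal projections below. *)
Definition unitary (ip : {dot V for @Num.conj R[i]}) :=
  forall k, SO3 k -> forall p q, ip (tau m k p) (tau m k q) = ip p q.

Definition orth_proj (ip : {dot V for @Num.conj R[i]}) (U : {vspace V}) :
  'End(V) := daddv_pi U (orthov ip U).

Definition P ip (j : int) (xi : R3 R) : 'End(V) :=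
  orth_proj ip (passmx.leigenspace (dtau xi) (0 +i* j%:~R)).

Definition Phi sigma ip (r : R) (j : int) (x : R3 R) : 'End(V) :=
  (2 * m).+1%:R *:
    vint sigma sphere (fun xi => expi (- (r * dot3 x xi)) *: P ip j xi).

(* Elements of L^1 are classes modulo null sets: for each k the equivariance is
   only required almost everywhere. *)
Definition equivariant a (F : R3 R -> 'End(V)) :=
  forall k, SO3 k -> {ae leb3 a, forall x,
    F (act k x) = (tau m k \o F x \o (tau m k)^-1)%VF}.

Definition L1tau a (F : R3 R -> 'End(V)) :=
  vintegrable (leb3 a) setT F /\ equivariant a F.

Definition fourier a (F : R3 R -> 'End(V)) (y : R3 R) : 'End(V) :=
  vint (leb3 a) setT (fun x => expi (- dot3 x y) *: F x).

Definition spherical_fourier a sigma ip (F : R3 R -> 'End(V)) r j : R[i] :=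
  (2 * m).+1%:R^-1 * cint (leb3 a) setT
    (fun x => endtr (F x \o Phi sigma ip r j (opp3 x))%VF).

Definition inversion_integrand a sigma ip (F : R3 R -> 'End(V)) (j : int)
    (x : R3 R) (r : measurableTypeR R) : 'End(V) :=
  (spherical_fourier a sigma ip F r j * (r ^+ 2)%:C) *: Phi sigma ip r j x.

End Representation.
End Spherical.

(* Main.v *)
Require Import Defs.
From HB Require Import structures.
From mathcomp Require Import all_boot all_order all_algebra.
From mathcomp Require Import sesquilinear complex.
From mathcomp Require mpoly.
From mathcomp Require Import ring lra zify.
Set Implicit Arguments.
Unset Strict Implicit.
Unset Printing Implicit Defensive.
Import Order.TTheory GRing.Theory Num.Theory.
Local Open Scope ring_scope.
Local Open Scope complex_scope.

(** The formula is Fourier inversion on R^3, written in polar coordinates and in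
    an eigenbasis of the operators dtau (xi).

    Let G be the Fourier transform of F.  Equivariance of F gives
    G (k y) = tau k G (y) tau k^-1 for every rotation k.  For a unit vector xi and
    r > 0, the endomorphism G (r xi) therefore commutes with the rotations around
    xi.  The weights -m, ..., m of such rotations on harmonic polynomials of degree
    m are simple, so G (r xi) is diagonal in the eigenbasis of dtau (xi):
      G (r xi) = \sum_j c_j (r) P_j (xi),  c_j (r) = tr (G (r xi) P_j (xi)),
    and c_j (r) does not depend on xi because SO(3) is transitive on the sphere
    ([axis_expansion], [SO3_transitive]).  By Fubini's theorem and the substitution
    xi -> - xi, which exchanges P_j and P_{- j}, the spherical transform of F at
    Phi_{r, j} is c_{- j} (r), and
      Phi_{r, j} (x) = (2m+1) \int_{S^2} e^{i r <x, xi>} P_{- j} (xi) dsigma (xi).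
    Summing over j, the right-hand side of the formula is the integral of
    e^{i <x, y>} G (y) in polar coordinates, that is F (x) for almost every x.

    Four ingredients carry this argument.

    - Representation theory.  The operator dtau (xi) is the restriction of the
      vector field x |-> xi * x (cross product) to harmonic polynomials
      ([dtau_generates]), so that dtau (k xi) = tau k dtau (xi) tau k^-1 and only
      the third axis has to be studied.  In the coordinates x_1 + i x_2,
      x_1 - i x_2, x_3 the field is diagonal on monomials; homogeneity bounds the
      weights ([weight_annihilation]) and the Laplace equation shows that a
      harmonic weight vector is determined by one coefficient ([weight_simple]).

    - The orthogonal projections P_j (xi) are the Lagrange interpolation
      polynomials of the numbers i j at dtau (xi) ([orth_projE]).  All properties of
      P_j that are needed are algebraic consequences of this, including its
      measurability and boundedness in xi.

    - Fourier inversion ([fourier_inversion]).  The integral of f over a box is the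
      limit of pairings of its transform with those of softened indicators of
      boxes, the softening being convolution with a Poisson kernel.

    - Polar coordinates ([polar_coordinates]).  The invariant probability sigma is
      only given by its invariance.  Replacing the direction of a vector by an
      independent one with law sigma does not change the Fourier transform of
      Lebesgue measure on a ball, hence preserves Lebesgue measure
      ([polar_measure]).  The law of the radius follows from dilations, and the
      volume of the ball from a Gaussian integral. *)

(** * Spectral projections as interpolation polynomials *)

Section EndoTrace.
Variables (K : fieldType) (V : vectType K).
Local Notation e := (vbasis {:V}).

Lemma coord_e (v : V) : v = \sum_i coord e i v *: e`_i.
Proof. exact: (coord_vbasis (memvf v)). Qed.

Lemma eq_coord (v w : V) : (forall i, coord e i v = coord e i w) -> v = w.
Proof.
by move=> h; rewrite (coord_e v) (coord_e w); apply: eq_bigr => i _; rewrite h.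
Qed.

Lemma endtrE (f : 'End(V)) : endtr f = \sum_i coord e i (f e`_i).
Proof.
rewrite /endtr /mxtrace; apply: eq_bigr => i _.
by rewrite !mxE /= passmx.vecof_delta.
Qed.

Lemma endtr_linear : linear (@endtr K V : 'End(V) -> K^o).
Proof.
move=> c f g; rewrite !endtrE scaler_sumr -big_split; apply: eq_bigr => i _.
by rewrite !lfunE /= !lfunE linearP.
Qed.
HB.instance Definition _ := GRing.isLinear.Build K 'End(V) K^o _ (@endtr K V) endtr_linear.

(** Functionals that separate the points of V span its dual.  Through this lemma,
    facts about any convenient separating family (such as the coefficients of a
    polynomial) reach the coordinates in which derivatives are defined. *)
Lemma coord_separating (J : finType) (psi : J -> V -> K) :
  (forall a, linear (psi a : V -> K^o)) ->
  (forall v, (forall a, psi a v = 0) -> v = 0) ->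
  exists N : J -> 'I_(\dim {:V}) -> K,
    forall v i, coord e i v = \sum_a psi a v * N a i.
Proof.
move=> lin sep.
pose M := \matrix_(i < \dim {:V}, a < #|J|) psi (enum_val a) e`_i.
have psiM a v : psi a v = ((\row_i coord e i v) *m M) 0 (enum_rank a).
  have psi_sum (I : Type) (s : seq I) (F : I -> V) :
      psi a (\sum_(i <- s) F i) = \sum_(i <- s) psi a (F i).
    have lD u w : psi a (u + w) = psi a u + psi a w.
      by have := lin a 1 u w; rewrite !scale1r.
    have l0 : psi a 0 = 0 by apply: (addrI (psi a 0)); rewrite -lD !addr0.
    exact: big_morph.
  rewrite {1}(coord_e v) psi_sum mxE; apply: eq_bigr => i _.
  rewrite !mxE enum_rankK; have := lin a (coord e i v) e`_i 0.
  have -> : psi a 0 = 0 by rewrite -(big_nil 0 +%R xpredT (fun i : 'I_0 => 0)) psi_sum big_nil.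
  by rewrite !addr0.
have fM : row_free M.
  apply/row_freeP; exists (pinvmx M); apply: mulmxVp.
  rewrite -kermx_eq0; apply/eqP/row_matrixP => k; rewrite row0.
  set u := row k _; have uM : u *m M = 0.
    by apply/sub_kermxP; exact: row_sub.
  have v0 : \sum_i u 0 i *: e`_i = 0 :> V.
    apply: sep => a; rewrite psiM.
    suff -> : \row_i coord e i (\sum_i u 0 i *: e`_i) = u by rewrite uM mxE.
    apply/rowP => i; rewrite mxE coord_sum_free//; exact: (basis_free (vbasisP _)).
  apply/rowP => i; rewrite [RHS]mxE.
  by rewrite -(coord_sum_free (u 0) i (basis_free (vbasisP {:V}))) v0 linear0.
exists (fun a i => pinvmx M (enum_rank a) i) => v i.
have -> : coord e i v = ((\row_i coord e i v) *m M *m pinvmx M) 0 i.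
  by rewrite -mulmxA mulmxVp// mulmx1 mxE.
rewrite mxE (reindex (@enum_rank J)) /=; last exact: onW_bij (enum_rank_bij J).
by apply: eq_bigr => a _; rewrite psiM.
Qed.

End EndoTrace.

Section Spectral.
Variables (K : fieldType) (V : vectType K) (n : nat) (lam : 'I_n -> K).
Hypothesis lam_inj : injective lam.
Implicit Types (S T A : 'End(V)) (u v w : V).

(** The Lagrange interpolation polynomials of the values lam, at T: the spectral
    projections of T when it is diagonalizable with eigenvalues among lam. *)
Definition lagrange T (j : 'I_n) : 'End(V) :=
  \big[@comp_lfun _ _ _ _ / \1%VF]_(i < n | i != j)
    ((lam j - lam i)^-1 *: (T - lam i *: \1%VF)).

Lemma comp_lfun_apply S T A : (S \o T = A)%VF -> forall w, S (T w) = A w.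
Proof. by move=> <- w; rewrite comp_lfunE. Qed.

Definition eigenspaces_span T := forall v, exists2 u : 'I_n -> V,
  v = \sum_j u j & forall j, T (u j) = lam j *: u j.

Definition simple_spectrum T := forall (j : 'I_n) u v,
  T u = lam j *: u -> T v = lam j *: v -> u != 0 -> exists c, v = c *: u.

(** Distinct linear factors T - a that kill v together split v into eigenvectors:
    with v' = (T - a) v = sum_b u_b, the components are u_b / (b - a) and the rest. *)
Lemma foldl_eigen T (s : seq K) v : uniq s ->
  foldl (fun w a => T w - a *: w) v s = 0 ->
  exists2 u : K -> V, v = \sum_(a <- s) u a & forall a, a \in s -> T (u a) = a *: u a.
Proof.
elim: s v => [|a s ih] v /=; first by move=> _ ->; exists (fun=> 0) => //; rewrite big_nil.
move=> /andP[as_ us] /(ih _ us) [u e eu].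
pose r := v - \sum_(b <- s) (b - a)^-1 *: u b.
exists (fun b => if b == a then r else (b - a)^-1 *: u b).
  rewrite big_cons eqxx /r big_seq [X in _ + X]big_seq.
  rewrite [X in _ = _ + X](eq_bigr (fun b => (b - a)^-1 *: u b)) ?subrK// => b bs.
  by case: eqP => // ba; rewrite ba (negPf as_) in bs.
move=> b; rewrite inE; case: eqP => [->|/eqP ba] /= bs; last first.
  by rewrite linearZ /= eu// !scalerA mulrC.
apply/eqP; rewrite -subr_eq0; apply/eqP.
have -> : T r - a *: r =
    (T v - a *: v) - \sum_(b <- s) (b - a)^-1 *: (T (u b) - a *: u b).
  rewrite /r linearB /= scalerBr linear_sum scaler_sumr /= opprB.
  have -> : \sum_(b <- s) (b - a)^-1 *: (T (u b) - a *: u b) =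
      \sum_(b <- s) T ((b - a)^-1 *: u b) - \sum_(b <- s) a *: ((b - a)^-1 *: u b).
    rewrite -sumrB; apply: eq_bigr => d _.
    have -> : T ((d - a)^-1 *: u d) = (d - a)^-1 *: T (u d) by exact: linearZ.
    by rewrite scalerBr !scalerA (mulrC a).
  move: (\sum_(b <- s) _) (\sum_(b <- s) _) (T v) (a *: v) => y z x w.
  by rewrite opprB [y - w]addrC addrACA [- z + y]addrC.
rewrite e -sumrB big_seq big1// => c cs.
rewrite eu// -scalerBl scalerA mulVf ?scale1r ?subrr// subr_eq0.
by apply: contraNneq as_ => <-.
Qed.

Lemma lagrange_eigen T j (k : 'I_n) v : T v = lam k *: v -> lagrange T j v = (j == k)%:R *: v.
Proof.
move=> Tv.
have -> : lagrange T j v = (\prod_(i < n | i != j) ((lam j - lam i)^-1 * (lam k - lam i))) *: v.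
  rewrite /lagrange; apply: (big_ind2 (fun (f : 'End(V)) c => f v = c *: v)).
  - by rewrite id_lfunE scale1r.
  - by move=> f c g d ef eg; rewrite comp_lfunE eg linearZ /= ef scalerA mulrC.
  - by move=> i _; rewrite scale_lfunE add_lfunE opp_lfunE scale_lfunE id_lfunE Tv -scalerBl scalerA.
have [<-|jk] := eqVneq j k.
  rewrite big1 // => i ij; rewrite mulVf// subr_eq0 (inj_eq lam_inj).
  by rewrite eq_sym.
by rewrite (bigD1 k) 1?eq_sym//= subrr mulr0 mul0r.
Qed.

Lemma lagrange_comp T T' (k : 'End(V)) j : (k \o T = T' \o k)%VF ->
  (k \o lagrange T j = lagrange T' j \o k)%VF.
Proof.
move=> kT; rewrite /lagrange.
apply: (big_ind2 (fun f g : 'End(V) => (k \o f = g \o k)%VF)).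
- by rewrite comp_lfun1l comp_lfun1r.
- by move=> f f' g g' ef eg; rewrite comp_lfunA ef -comp_lfunA eg comp_lfunA.
move=> i _; rewrite -comp_lfunZr -comp_lfunZl; congr (_ *: _).
rewrite comp_lfunDr comp_lfunDl kT comp_lfunNr comp_lfunNl; congr (_ - _).
by rewrite -comp_lfunZr -comp_lfunZl comp_lfun1l comp_lfun1r.
Qed.

Section Diagonal.
Variable T : 'End(V).
Hypothesis Td : eigenspaces_span T.
Local Notation Q := (lagrange T).

Lemma lagrangeT j v : T (Q j v) = lam j *: Q j v.
Proof.
have [u -> eu] := Td v; rewrite linear_sum (bigD1 j) //= big1 ?addr0 => [|i ij].
  by rewrite (lagrange_eigen _ (eu j)) eqxx scale1r eu.
by rewrite (lagrange_eigen _ (eu i)) eq_sym (negPf ij) scale0r.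
Qed.

Lemma sum_lagrange v : \sum_j Q j v = v.
Proof.
have [u -> eu] := Td v; under eq_bigr => j _ do rewrite linear_sum.
rewrite exchange_big /=; apply: eq_bigr => i _.
rewrite (bigD1 i) //= big1 ?addr0 => [|j ji].
  by rewrite (lagrange_eigen _ (eu i)) eqxx scale1r.
by rewrite (lagrange_eigen _ (eu i)) (negPf ji) scale0r.
Qed.

Lemma lagrange_id i j v : Q i (Q j v) = (i == j)%:R *: Q j v.
Proof. exact: lagrange_eigen (lagrangeT j v). Qed.

(** A carries the image of Q j into the eigenspace of S for chi j, which is that
    same image because chi separates the eigenspaces of T. *)
Lemma commute_lagrange S A (chi : 'I_n -> K) : injective chi ->
  (forall j v, T v = lam j *: v -> S v = chi j *: v) ->
  (A \o S = S \o A)%VF -> forall j, (A \o Q j = Q j \o A)%VF.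
Proof.
move=> chi_inj ST AS.
have off i j v : i != j -> Q i (A (Q j v)) = 0.
  move=> ij; pose w := A (Q j v).
  have Sw : S w = chi j *: w.
    by have := congr1 (fun f : 'End(V) => f (Q j v)) AS;
      rewrite !comp_lfunE (ST j _ (lagrangeT j v)) linearZ => <-.
  have : Q i (S w) = chi i *: Q i w.
    rewrite -{1}(sum_lagrange w) linear_sum /= linear_sum (bigD1 i) //= big1 ?addr0.
      by rewrite (ST i _ (lagrangeT i w)) linearZ /= lagrange_id eqxx scale1r.
    move=> l li; rewrite (ST l _ (lagrangeT l w)) linearZ /= lagrange_id.
    by rewrite eq_sym (negPf li) scale0r scaler0.
  rewrite Sw linearZ /= => /eqP; rewrite -subr_eq0 -scalerBl scaler_eq0 subr_eq0.
  by rewrite (inj_eq chi_inj) eq_sym (negPf ij) => /eqP.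
move=> j; apply/lfunP => v; rewrite !comp_lfunE.
transitivity (Q j (A (Q j v))).
  by rewrite -{1}(sum_lagrange (A (Q j v))) (bigD1 j) //= big1 ?addr0 => // i ij; exact: off.
rewrite -{2}(sum_lagrange v) !linear_sum (bigD1 j) //= big1 ?addr0 => // i ij.
by apply: off; rewrite eq_sym.
Qed.

Hypothesis Ts : simple_spectrum T.

(** On the line Q j V, A is a scalar; this scalar is the trace of A Q j because
    Q j has rank at most 1. *)
Lemma commute_expansion A : (forall j, A \o Q j = Q j \o A)%VF ->
  A = \sum_j endtr (A \o Q j)%VF *: Q j.
Proof.
move=> AQ.
have key j : (A \o Q j)%VF = endtr (A \o Q j)%VF *: Q j.
  have [Q0|Qn0] := eqVneq (Q j) 0; first by rewrite Q0 comp_lfun0r scaler0.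
  have [v Qv0] : exists v, Q j v != 0.
    have [i h|h] := pickP (fun i : 'I_(\dim {:V}) => Q j (vbasis {:V})`_i != 0); first by exists (vbasis {:V})`_i.
    case/eqP: Qn0; apply/lfunP => v; rewrite zero_lfunE (coord_e v) linear_sum big1// => i _.
    by rewrite linearZ /=; have/negbFE/eqP -> := h i; rewrite scaler0.
  pose u := Q j v; have [l ul] : exists l, coord (vbasis {:V}) l u != 0.
    have [l h|h] := pickP (fun l : 'I_(\dim {:V}) => coord (vbasis {:V}) l u != 0); first by exists l.
    by case/eqP: Qv0; apply: eq_coord => i; rewrite linear0; have/negbFE/eqP := h i.
  pose phi w := coord (vbasis {:V}) l (Q j w) / coord (vbasis {:V}) l u.
  have Qphi w : Q j w = phi w *: u.
    have [c e] := Ts (lagrangeT j v) (lagrangeT j w) Qv0.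
    by rewrite /phi e linearZ /= mulfK.
  have TAu : T (A u) = lam j *: A u.
    have := congr1 (fun f : 'End(V) => f v) (AQ j); rewrite !comp_lfunE -/u => ->.
    exact: lagrangeT.
  have [c Au] := Ts (lagrangeT j v) TAu Qv0.
  suff <- : c = endtr (A \o Q j)%VF.
    by apply/lfunP => w; rewrite comp_lfunE scale_lfunE Qphi linearZ /= Au !scalerA mulrC.
  have phiu : phi u = 1 by rewrite /phi /u lagrange_id eqxx scale1r divff.
  rewrite endtrE.
  under eq_bigr => i _ do rewrite comp_lfunE Qphi linearZ /= Au scalerA linearZ /= mulrAC.
  rewrite -mulr_suml -[LHS]mul1r -phiu; congr (_ * _).
  rewrite {1}[u]coord_e /phi linear_sum /= linear_sum mulr_suml; apply: eq_bigr => i _.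
  by rewrite linearZ /= linearZ /= -mulrA mulrC.
apply/lfunP => v; rewrite -{1}(sum_lagrange v) linear_sum sum_lfunE.
by apply: eq_bigr => j _; rewrite -key comp_lfunE.
Qed.

End Diagonal.

Lemma lagrange_opp T (rev : 'I_n -> 'I_n) j : eigenspaces_span T ->
  (forall i, lam (rev i) = - lam i) -> involutive rev ->
  lagrange (- T) j = lagrange T (rev j).
Proof.
move=> Td lrev revK; apply/lfunP => v; have [u -> eu] := Td v.
rewrite !linear_sum; apply: eq_bigr => i _ /=.
rewrite (lagrange_eigen _ (eu i)).
have -> : lagrange (- T) j (u i) = (j == rev i)%:R *: u i.
  by apply: lagrange_eigen; rewrite opp_lfunE eu lrev scaleNr.
by rewrite -(inj_eq (can_inj revK)) revK.
Qed.

Lemma eigenspaces_span_conj T T' (k k' : 'End(V)) : (T' \o k = k \o T)%VF ->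
  (k \o k' = \1)%VF -> eigenspaces_span T -> eigenspaces_span T'.
Proof.
move=> kT kk Td v; have [u e eu] := Td (k' v).
exists (fun j => k (u j)) => [|j].
  by rewrite -linear_sum -e /= (comp_lfun_apply kk) id_lfunE.
by rewrite (comp_lfun_apply kT) comp_lfunE eu linearZ.
Qed.

Lemma simple_spectrum_conj T T' (k k' : 'End(V)) : (k' \o T' = T \o k')%VF ->
  (k \o k' = \1)%VF -> simple_spectrum T -> simple_spectrum T'.
Proof.
move=> kT kk Ts j u v eu ev u0.
have kkE w : k (k' w) = w by rewrite (comp_lfun_apply kk) id_lfunE.
have ek w : T' w = lam j *: w -> T (k' w) = lam j *: k' w.
  by move=> ew; rewrite -(comp_lfunE T) -kT comp_lfunE ew linearZ.
have [|c e] := Ts j _ _ (ek _ eu) (ek _ ev).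
  by apply: contraNneq u0 => k0; rewrite -(kkE u) k0 linear0.
by exists c; rewrite -(kkE v) e linearZ /= kkE.
Qed.

End Spectral.

(** * Rotations and vector fields acting on polynomials *)

Module HarmonicWeights.
Import mpoly Harmonic.

Lemma sum3 (V : nmodType) (f : 'I_3 -> V) : \sum_i f i = f 0 + f 1 + f 2.
Proof.
rewrite !big_ord_recl big_ord0 addr0 addrA.
by congr (_ + f _ + f _); exact/val_inj.
Qed.

Section LinearSubstitution.
Variable C : comNzRingType.
Implicit Types (K L Z : 'M[C]_3) (p q : {mpoly C[3]}).

(** The polynomial x |-> p (K x). *)
Definition subc K p := p \mPo [tuple \sum_(j < 3) K i j *: 'X_j | i < 3].

Lemma subcX K (i : 'I_3) : subc K 'X_i = \sum_(j < 3) K i j *: 'X_j.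
Proof. by rewrite /subc comp_mpolyXU -tnth_nth tnth_mktuple. Qed.

Lemma subcD K p q : subc K (p + q) = subc K p + subc K q.
Proof. exact: comp_mpolyD. Qed.

Lemma subcZ K c p : subc K (c *: p) = c *: subc K p.
Proof. exact: comp_mpolyZ. Qed.

Lemma subcM K p q : subc K (p * q) = subc K p * subc K q.
Proof. exact: (rmorphM (comp_mpoly _)). Qed.

Lemma subc_sum K (I : Type) (s : seq I) (P : pred I) (F : I -> {mpoly C[3]}) :
  subc K (\sum_(i <- s | P i) F i) = \sum_(i <- s | P i) subc K (F i).
Proof. exact: raddf_sum. Qed.

Lemma subcC K c : subc K c%:MP = c%:MP.
Proof. exact: comp_mpolyC. Qed.

Lemma mpoly_ring_ind (P : {mpoly C[3]} -> Prop) :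
  (forall c, P c%:MP) -> (forall i, P 'X_i) -> (forall p q, P p -> P q -> P (p + q)) ->
  (forall p q, P p -> P q -> P (p * q)) -> forall p, P p.
Proof.
move=> PC PX PD PM; elim/mpolyind => [|c m p _ _ ih].
  by rewrite -mpolyC0; exact: PC.
apply: PD => //; rewrite -mul_mpolyC; apply: (PM); first exact: PC.
rewrite mpolyXE_id; apply: (big_ind P) => [||i _]; first by rewrite -mpolyC1; exact: PC.
  exact: PM.
elim: (m i) => [|d ih']; first by rewrite expr0 -mpolyC1; exact: PC.
by rewrite exprS; apply: PM.
Qed.

Lemma subc_comp K L p : subc K (subc L p) = subc (L *m K) p.
Proof.
elim/mpoly_ring_ind: p => [c|i|p q ep eq|p q ep eq].
- by rewrite !subcC.
- rewrite !subcX subc_sum.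
  under eq_bigr => j _ do rewrite subcZ subcX scaler_sumr.
  rewrite exchange_big /=; apply: eq_bigr => j _.
  rewrite mxE scaler_suml; apply: eq_bigr => l _.
  by rewrite scalerA.
- by rewrite !subcD ep eq.
- by rewrite !subcM ep eq.
Qed.

Lemma subc1 p : subc 1%:M p = p.
Proof.
elim/mpoly_ring_ind: p => [c|i|p q ep eq|p q ep eq].
- by rewrite subcC.
- rewrite subcX (bigD1 i) //= mxE eqxx scale1r big1 ?addr0// => j ji.
  by rewrite mxE eq_sym (negPf ji) scale0r.
- by rewrite subcD ep eq.
- by rewrite subcM ep eq.
Qed.

Lemma mderiv_subc K (i : 'I_3) p :
  mderiv i (subc K p) = \sum_(j < 3) K j i *: subc K (mderiv j p).
Proof.
rewrite /subc mderiv_comp; apply: eq_bigr => j _; rewrite tnth_mktuple.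
have -> : mderiv i (\sum_(l < 3) K j l *: 'X_l : {mpoly C[3]}) = (K j i)%:MP.
  rewrite raddf_sum /= (bigD1 i) //= big1 ?addr0.
    by rewrite mderivZ mderivX mnm1E eqxx scale1r subm_self mpolyX0 -alg_mpolyC.
  by move=> l li; rewrite mderivZ mderivX mnm1E (negPf li) scale0r scaler0.
by rewrite mulrC mul_mpolyC.
Qed.

Lemma dhomog_subc d K p : p \is d.-homog -> subc K p \is d.-homog.
Proof.
move=> /dhomogP hp; rewrite /subc comp_mpolyE big_seq rpred_sum // => m mp.
apply: rpredZ; have <- : mdeg m = d := hp _ mp; rewrite mdegE.
apply: (big_ind2 (fun q (n : nat) => q \is n.-homog)) => [|q1 n1 q2 n2|i _].
- exact: dhomog1.
- exact: dhomogM.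
rewrite tnth_mktuple -[X in X.-homog]mul1n; apply: dhomogMn.
by apply: rpred_sum => j _; rewrite rpredZ // dhomogX /= mdeg1.
Qed.

(** The derivative at t = 0 of p ((1 + t Z) x): the vector field x |-> Z x acting
    on polynomials. *)
Definition vfield Z p := \sum_(j < 3) \sum_(l < 3) Z j l *: ('X_l * mderiv j p).

Lemma vfieldD Z p q : vfield Z (p + q) = vfield Z p + vfield Z q.
Proof.
rewrite /vfield -big_split; apply: eq_bigr => j _; rewrite -big_split.
by apply: eq_bigr => l _; rewrite mderivD mulrDr scalerDr.
Qed.

Lemma vfieldZ Z c p : vfield Z (c *: p) = c *: vfield Z p.
Proof.
rewrite /vfield scaler_sumr; apply: eq_bigr => j _; rewrite scaler_sumr.
by apply: eq_bigr => l _; rewrite mderivZ -scalerAr !scalerA mulrC.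
Qed.

Lemma vfieldM Z p q : vfield Z (p * q) = vfield Z p * q + p * vfield Z q.
Proof.
rewrite /vfield mulr_suml mulr_sumr -big_split; apply: eq_bigr => j _ /=.
rewrite mulr_suml mulr_sumr -big_split; apply: eq_bigr => l _ /=.
rewrite mderivM -scalerAl -scalerAr -scalerDr; congr (_ *: _).
by ring.
Qed.

Lemma vfieldC Z c : vfield Z c%:MP = 0.
Proof. by rewrite /vfield big1// => j _; rewrite big1// => l _; rewrite mderivC mulr0 scaler0. Qed.

Lemma vfield_sum Z (I : Type) (s : seq I) (P : pred I) (F : I -> {mpoly C[3]}) :
  vfield Z (\sum_(i <- s | P i) F i) = \sum_(i <- s | P i) vfield Z (F i).
Proof.
by apply: big_morph; [exact: vfieldD|rewrite -mpolyC0 vfieldC].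
Qed.

Lemma vfieldX Z (i : 'I_3) : vfield Z 'X_i = \sum_(l < 3) Z i l *: 'X_l.
Proof.
rewrite /vfield (bigD1 i) //= [X in _ + X]big1 ?addr0 => [|j ji].
  apply: eq_bigr => l _.
  by rewrite mderivX mnm1E eqxx scale1r subm_self mpolyX0 mulr1.
rewrite big1// => l _; rewrite mderivX mnm1E eq_sym (negPf ji) scale0r.
by rewrite mulr0 scaler0.
Qed.

Lemma vfield_linear Z1 Z2 c p : vfield (c *: Z1 + Z2) p = c *: vfield Z1 p + vfield Z2 p.
Proof.
rewrite /vfield scaler_sumr -big_split; apply: eq_bigr => j _ /=.
rewrite scaler_sumr -big_split; apply: eq_bigr => l _ /=.
by rewrite !mxE scalerDl scalerA.
Qed.

(** Both sides are derivations along the substitution K, so that it suffices to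
    compare them on the variables. *)
Lemma vfield_subc K Z Z' p : Z' *m K = K *m Z ->
  vfield Z (subc K p) = subc K (vfield Z' p).
Proof.
move=> e; elim/mpoly_ring_ind: p => [c|i|p q ep eq|p q ep eq].
- by rewrite subcC !vfieldC -mpolyC0 subcC.
- rewrite vfieldX subcX subc_sum.
  have -> : vfield Z (\sum_(j < 3) K i j *: 'X_j) =
      \sum_(l < 3) (K *m Z) i l *: 'X_l.
    rewrite vfield_sum.
    under eq_bigr => j _ do rewrite vfieldZ vfieldX scaler_sumr.
    rewrite exchange_big /=; apply: eq_bigr => l _; rewrite mxE scaler_suml.
    by apply: eq_bigr => j _; rewrite scalerA.
  rewrite -e; under [RHS]eq_bigr => j _ do rewrite subcZ subcX scaler_sumr.
  rewrite [RHS]exchange_big /=; apply: eq_bigr => l _; rewrite mxE scaler_suml.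
  by apply: eq_bigr => j _; rewrite scalerA.
- by rewrite subcD !vfieldD subcD ep eq.
- by rewrite subcM !vfieldM subcD !subcM ep eq.
Qed.

Lemma mcoeff_Xmderiv (j : 'I_3) p m : ('X_j * mderiv j p)@_m = p@_m *+ m j.
Proof.
have [mj0|mj] := posnP (m j).
  rewrite mj0 mulr0n mulrC; apply/eqP; rewrite mcoeff_eq0; apply/negP => h.
  have := msuppM_le h; rewrite msuppX => /allpairsP[[m1 m2] /= [_]].
  rewrite inE => /eqP -> em; move: mj0; rewrite em mnmDE mnm1E eqxx.
  by rewrite addn1.
have le : (U_(j) <= m)%MM by rewrite lep1mP -lt0n.
have := mcoeffMX (mderiv j p) U_(j) (m - U_(j))%MM.
rewrite addmC submK// mulrC => ->; rewrite mcoeff_deriv submK//.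
by rewrite mnmBE mnm1E eqxx subn1 prednK.
Qed.

(** X_j d/dX_j multiplies the monomial X^mu by mu_j, so that the weights of a
    polynomial can be read off coefficient by coefficient. *)
Lemma mcoeff_vfield_diag (d : 'rV[C]_3) p m :
  (vfield (diag_mx d) p)@_m = (\sum_(j < 3) d 0 j *+ m j) * p@_m.
Proof.
rewrite /vfield raddf_sum mulr_suml; apply: eq_bigr => j _ /=.
rewrite (bigD1 j) //= big1 ?addr0 => [|l lj].
  by rewrite mxE eqxx mulr1n mcoeffZ mcoeff_Xmderiv mulrnAr mulrnAl.
by rewrite mxE eq_sym (negPf lj) scale0r.
Qed.

Section CurveDerivative.
Variables (T : Type) (t0 : T) (D : (T -> C) -> C -> Prop).
Hypotheses (D_ext : forall f g a, f =1 g -> D f a -> D g a)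
  (D_cst : forall c, D (fun=> c) 0)
  (D_add : forall f g a b, D f a -> D g b -> D (fun t => f t + g t) (a + b))
  (D_mul : forall f g a b, D f a -> D g b ->
    D (fun t => f t * g t) (a * g t0 + f t0 * b)).

Lemma D_sum (I : Type) (s : seq I) (P : pred I) (f : I -> T -> C) (a : I -> C) :
  (forall i, P i -> D (f i) (a i)) ->
  D (fun t => \sum_(i <- s | P i) f i t) (\sum_(i <- s | P i) a i).
Proof.
move=> Df; elim: s => [|i s ih].
  rewrite big_nil; apply: (D_ext (f := fun=> 0)) => [t|]; last exact: D_cst.
  by rewrite big_nil.
rewrite big_cons; have [Pi|nPi] := boolP (P i).
  apply: (D_ext (f := fun t => f i t + \sum_(j <- s | P j) f j t)).
    by move=> t; rewrite big_cons Pi.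
  by apply: D_add => //; exact: Df.
by apply: (D_ext _ ih) => t; rewrite big_cons (negPf nPi).
Qed.

(** The derivation rules propagate from the variables to all polynomials.  D is
    meant to be differentiation of functions of a real variable. *)
Lemma subc_curve (K : T -> 'M[C]_3) Z : K t0 = 1%:M ->
  (forall i j, D (fun t => K t i j) (Z i j)) ->
  forall p m, D (fun t => (subc (K t) p)@_m) (vfield Z p)@_m.
Proof.
move=> K0 KZ; elim/mpoly_ring_ind => [c m|i m|p q ep eq m|p q ep eq m].
- rewrite vfieldC mcoeff0; apply: (D_ext (f := fun=> (c%:MP_[3])@_m)) => [t|].
    by rewrite subcC.
  exact: D_cst.
- rewrite vfieldX raddf_sum /=.
  apply: (D_ext (f := fun t => \sum_(l < 3) (K t i l *: 'X_l)@_m)).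
    by move=> t; rewrite subcX raddf_sum.
  apply: D_sum => l _; rewrite mcoeffZ.
  have := D_mul (KZ i l) (D_cst ('X_l : {mpoly C[3]})@_m).
  rewrite mulr0 addr0; apply: D_ext => t; by rewrite mcoeffZ.
- rewrite vfieldD mcoeffD.
  by apply: (D_ext _ (D_add (ep m) (eq m))) => t; rewrite subcD mcoeffD.
rewrite vfieldM mcoeffD !mcoeffM -big_split /=.
apply: (D_ext (f := fun t =>
  \sum_(k : 'X_{1..3 < (mdeg m).+1, (mdeg m).+1} | m == (k.1 + k.2)%MM)
    (subc (K t) p)@_k.1 * (subc (K t) q)@_k.2)).
  by move=> t; rewrite subcM mcoeffM.
apply: D_sum => k _.
by have := D_mul (ep k.1) (eq k.2); rewrite K0 !subc1.
Qed.

End CurveDerivative.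

End LinearSubstitution.

(** * Weights of harmonic polynomials *)

Section Weights.
Variables (C : numFieldType) (I : C).
Hypothesis I2 : I * I = -1.
Implicit Types (p q : {mpoly C[3]}) (mu nu : 'X_{1..3}).

Definition mx3 (s : seq (seq C)) : 'M[C]_3 := \matrix_(i, j) nth 0 (nth [::] s i) j.

(** The coordinates z = x_1 + i x_2, w = x_1 - i x_2, x_3, in which the rotations
    about the third axis are diagonal, and the inverse change of coordinates. *)
Definition of_zw : 'M[C]_3 :=
  mx3 [:: [:: 2^-1; 2^-1; 0]; [:: - I / 2; I / 2; 0]; [:: 0; 0; 1]].

Definition to_zw : 'M[C]_3 :=
  mx3 [:: [:: 1; I; 0]; [:: 1; - I; 0]; [:: 0; 0; 1]].

(** The field (- x_2, x_1, 0), whose flow is the rotation about the third axis. *)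
Definition rot3_gen : 'M[C]_3 :=
  mx3 [:: [:: 0; -1; 0]; [:: 1; 0; 0]; [:: 0; 0; 0]].

Lemma of_to_zw : of_zw *m to_zw = 1%:M.
Proof.
apply/matrixP => i j; rewrite !mxE sum3 !mxE.
case: i => -[|[|[|//]]] ?; case: j => -[|[|[|//]]] ? /=;
  rewrite ?(mulr0, mul0r, addr0, add0r, mulr1, mul1r) //.
- by field.
- by ring.
- by field.
have -> : - I / 2 * I + I / 2 * - I = - (I * I) by field.
by rewrite I2 opprK.
Qed.

Lemma subc_to_of p : subc to_zw (subc of_zw p) = p.
Proof. by rewrite subc_comp of_to_zw subc1. Qed.

Lemma subc_of_to p : subc of_zw (subc to_zw p) = p.
Proof. by rewrite subc_comp (mulmx1C of_to_zw) subc1. Qed.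

Lemma subc_of_inj p q : subc of_zw p = subc of_zw q -> p = q.
Proof. by move=> e; rewrite -(subc_to_of p) e subc_to_of. Qed.

Let dI : 'rV[C]_3 := \row_j nth 0 [:: I; - I; 0] j.

Lemma mcoeff_rot3_gen p mu : (subc of_zw (vfield rot3_gen p))@_mu =
  I * ((mu 0%R)%:R - (mu 1%R)%:R) * (subc of_zw p)@_mu.
Proof.
have e : rot3_gen *m of_zw = of_zw *m diag_mx dI.
  apply/matrixP => i j; rewrite !mxE !sum3 !mxE.
  case: i => -[|[|[|//]]] ?; case: j => -[|[|[|//]]] ? /=;
    rewrite ?(mulr0, mul0r, addr0, add0r, mulr1, mul1r, mulr1n, mulr0n) //.
  - by field.
  - by field.
  - by transitivity (- (I * I) / 2); [rewrite I2 opprK mul1r|field].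
  - by transitivity (- (I * I) / 2); [rewrite I2 opprK mul1r|field].
rewrite -(vfield_subc p e) mcoeff_vfield_diag sum3 !mxE /= mul0rn addr0.
by rewrite mulrBr !mulr_natr mulNrn.
Qed.

Lemma mdeg_dhomog m p mu : p \is m.-homog -> p@_mu != 0 -> mdeg mu = m.
Proof. by move=> /dhomogP hp nz; apply: hp; rewrite mcoeff_msupp. Qed.

Definition weight (m a : nat) : C := I * (a%:R - m%:R).

(** A homogeneous polynomial of degree m only has monomials of weight between -m
    and m. *)
Lemma weight_annihilation m p : p \is m.-homog ->
  foldl (fun q a => vfield rot3_gen q - weight m a *: q) p (iota 0 (2 * m).+1) = 0.
Proof.
move=> hp; apply: subc_of_inj; rewrite -mpolyC0 subcC mpolyC0; apply/mpolyP => mu.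
have coef s q : (subc of_zw (foldl (fun q a => vfield rot3_gen q - weight m a *: q) q s))@_mu
    = (\prod_(a <- s) (I * ((mu 0%R)%:R - (mu 1%R)%:R) - weight m a)) * (subc of_zw q)@_mu.
  elim: s q => [|a s ih] q /=; first by rewrite big_nil mul1r.
  rewrite ih big_cons -scaleNr subcD subcZ mcoeffD mcoeffZ mcoeff_rot3_gen.
  by rewrite mulNr -mulrBl mulrA [X in X * _ = _]mulrC.
rewrite coef mcoeff0.
have [->|nz] := eqVneq ((subc of_zw p)@_mu) 0; first by rewrite mulr0.
have dm : mdeg mu = m := mdeg_dhomog (dhomog_subc of_zw hp) nz.
have le : (mu 0%R + mu 1%R <= m)%N by rewrite -dm mdegE sum3 leq_addr.
have h : (m + mu 0%R - mu 1%R)%N \in iota 0 (2 * m).+1.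
  by rewrite mem_iota /= add0n; move: le; move: (mu 0%R) (mu 1%R) => x y; clear; lia.
rewrite (big_rem _ h) /= /weight natrB ?natrD; last first.
  by move: le; move: (mu 0%R) (mu 1%R) => x y; clear; lia.
set D := (X in X * _ * _); suff -> : D = 0 by rewrite !mul0r.
by rewrite /D; ring.
Qed.

Definition lapc p := \sum_(i < 3) mderiv i (mderiv i p).

(** The rows u, v, w of [to_zw] satisfy u . v = 2 and w . w = 1, and all their other
    bilinear dot products vanish. *)
Lemma lapc_subc_to q : lapc (subc to_zw q) =
  subc to_zw (4 *: mderiv 0 (mderiv 1 q) + mderiv 2 (mderiv 2 q)).
Proof.
have e (i : 'I_3) : mderiv i (mderiv i (subc to_zw q)) =
    \sum_(j < 3) \sum_(l < 3) (to_zw j i * to_zw l i) *: subc to_zw (mderiv l (mderiv j q)).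
  rewrite mderiv_subc raddf_sum; apply: eq_bigr => j _ /=.
  by rewrite mderivZ mderiv_subc scaler_sumr; apply: eq_bigr => l _; rewrite scalerA.
rewrite /lapc; under eq_bigr => i _ do rewrite e.
rewrite subcD subcZ; have := mderiv_comm 0 1 q; move: e => _.
pose S l j := subc to_zw (mderiv l (mderiv j q)).
rewrite -/(S 0 1) -/(S 2 2) => c01; have {c01} c01 : S 1 0 = S 0 1 by rewrite /S c01.
transitivity (\sum_(i < 3) \sum_(j < 3) \sum_(l < 3) (to_zw j i * to_zw l i) *: S l j) => //.
move: S c01 => S c01; rewrite exchange_big /=.
under eq_bigr => j _ do rewrite exchange_big /=.
have G j l : \sum_(i < 3) (to_zw j i * to_zw l i) *: S l j =
    (mx3 [:: [:: 0; 2; 0]; [:: 2; 0; 0]; [:: 0; 0; 1]] j l) *: S l j.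
  rewrite -scaler_suml; congr (_ *: _); rewrite sum3 !mxE.
  case: j => -[|[|[|//]]] ?; case: l => -[|[|[|//]]] ? /=;
    rewrite ?(mulr0, mul0r, addr0, add0r, mulr1, mul1r) //.
  - by rewrite I2 subrr.
  - by rewrite mulrN I2 opprK.
  - by rewrite mulNr I2 opprK.
  - by rewrite mulrNN I2 subrr.
under eq_bigr => j _ do under eq_bigr => l _ do rewrite G.
rewrite !sum3 !mxE /= c01 !(scale0r, addr0, add0r, scale1r) -scalerDl.
by congr (_ *: _ + _); rewrite -natrD.
Qed.

Lemma harmonic_zw p : lapc p = 0 ->
  4 *: mderiv 0 (mderiv 1 (subc of_zw p)) + mderiv 2 (mderiv 2 (subc of_zw p)) = 0.
Proof.
rewrite -{1}(subc_to_of p) lapc_subc_to => /(congr1 (subc of_zw)).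
by rewrite subc_of_to -mpolyC0 subcC mpolyC0.
Qed.

(** The Laplace equation 4 q_zw + q_33 = 0 expresses the coefficients through
    those of degree at most 1 in x_3. *)
Lemma harmonic_zw_eq0 q :
  4 *: mderiv 0 (mderiv 1 q) + mderiv 2 (mderiv 2 q) = 0 ->
  (forall mu, (mu 2%R <= 1)%N -> q@_mu = 0) -> q = 0.
Proof.
move=> eq0 low; apply/mpolyP => mu; rewrite mcoeff0.
move: {2}(mu 2%R).+1 (ltnSn (mu 2%R)) => n; elim: n mu => // n ih mu mun.
have [le1|gt1] := leqP (mu 2%R) 1; first exact: low.
pose nu := (mu - U_(2) - U_(2))%MM.
have munu : mu = (nu + U_(2) + U_(2))%MM.
  apply/mnmP => i; rewrite !mnmDE !mnmBE !mnm1E.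
  by have [<-|_] := eqVneq 2 i; rewrite ?subn0 ?addn0//; move: gt1; case: (mu 2%R) => [|[|k]]//=; lia.
have := congr1 (mcoeff nu) eq0; rewrite mcoeffD mcoeffZ !mcoeff_deriv mcoeff0.
have -> : q@_(nu + U_(0) + U_(1)) = 0.
  apply: ih; rewrite !mnmDE !mnm1E /= !addn0; move: mun; rewrite munu !mnmDE !mnm1E eqxx.
  by lia.
rewrite !mul0rn mulr0 add0r -munu => /eqP; rewrite !mulrn_eq0 /= => /eqP.
exact.
Qed.

Let I0 : I != 0.
Proof.
by apply/eqP => I0; move: I2; rewrite I0 mulr0 => /eqP; rewrite eq_sym oppr_eq0 oner_eq0.
Qed.

(** The index a counts the weights from - m; the equation mu_0 - mu_1 = a - m is
    written without subtraction. *)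
Lemma weight_support m a (r : {mpoly C[3]}) mu : r \is m.-homog ->
  vfield rot3_gen r = weight m a *: r -> (subc of_zw r)@_mu != 0 ->
  (mu 0%R + m = mu 1%R + a)%N /\ (mu 0%R + mu 1%R + mu 2%R = m)%N.
Proof.
move=> hr wr nz; have dm : mdeg mu = m := mdeg_dhomog (dhomog_subc of_zw hr) nz.
split; last by rewrite -dm mdegE sum3.
have := mcoeff_rot3_gen r mu; rewrite wr subcZ mcoeffZ => /(mulIf nz) /(mulfI I0) e.
by apply/eqP; rewrite -(eqr_nat C) !natrD; apply/eqP; move/eqP: e; rewrite subr_eq => /eqP e;
  rewrite [_ + a%:R]addrC e; ring.
Qed.

(** A harmonic weight vector is determined by its one coefficient of degree at
    most 1 in x_3: the parity of the degree and the weight give the monomial. *)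
Lemma weight_simple m a p p' : p \is m.-homog -> p' \is m.-homog ->
  lapc p = 0 -> lapc p' = 0 -> vfield rot3_gen p = weight m a *: p ->
  vfield rot3_gen p' = weight m a *: p' -> p != 0 -> exists c, p' = c *: p.
Proof.
move=> hp hp' Lp Lp' wp wp' p0.
pose q := subc of_zw p; pose q' := subc of_zw p'.
have supp := weight_support.
have harm (r s : {mpoly C[3]}) c : lapc r = 0 -> lapc s = 0 ->
    4 *: mderiv 0 (mderiv 1 (subc of_zw (r - c *: s))) +
    mderiv 2 (mderiv 2 (subc of_zw (r - c *: s))) = 0.
  move=> Lr Ls; apply: harmonic_zw; rewrite /lapc.
  under eq_bigr => i _ do rewrite !mderivB !mderivZ.
  by rewrite sumrB -scaler_sumr; move: Lr Ls; rewrite /lapc => -> ->; rewrite scaler0 subr0.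
have [mu mu2 qmu] : exists2 mu : 'X_{1..3}, (mu 2%R <= 1)%N & q@_mu != 0.
  have [/hasP[mu _ /andP[h1 h2]]|/hasPn h] :=
      boolP (has (fun mu : 'X_{1..3} => (mu 2%R <= 1)%N && (q@_mu != 0)) (msupp q)).
    by exists mu.
  case/negP: p0; apply/eqP; apply: subc_of_inj.
  rewrite -mpolyC0 subcC mpolyC0; apply: harmonic_zw_eq0; first exact: harmonic_zw.
  move=> mu mu2; apply/eqP; apply/negPn/negP => nz.
  by have := h mu; rewrite mcoeff_msupp mu2 nz => /(_ isT).
exists (q'@_mu / q@_mu); apply/eqP; rewrite -subr_eq0; apply/eqP; apply: subc_of_inj.
have -> : subc of_zw 0 = 0 by rewrite -mpolyC0 subcC.
apply: harmonic_zw_eq0; first exact: harm.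
move=> nu nu2; rewrite -scaleNr subcD subcZ mcoeffD mcoeffZ -/q -/q'.
have [->|ne] := eqVneq nu mu; first by rewrite mulNr divfK// subrr.
have sq := supp _ _ p mu hp wp qmu.
have uniq : (nu 0%R + m = nu 1%R + a)%N /\ (nu 0%R + nu 1%R + nu 2%R = m)%N -> nu = mu.
  case: sq => h1 h2 [h3 h4]; apply/mnmP => i.
  have [e0 [e1 e2]] : nu 0%R = mu 0%R /\ nu 1%R = mu 1%R /\ nu 2%R = mu 2%R.
    move: h1 h2 h3 h4 nu2 mu2.
    move: (nu 0%R) (nu 1%R) (nu 2%R) (mu 0%R) (mu 1%R) (mu 2%R) => x y z x' y' z'; clear; lia.
  case: i => -[|[|[|//]]] H.
  - by rewrite (_ : Ordinal H = 0) //; exact/val_inj.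
  - by rewrite (_ : Ordinal H = 1) //; exact/val_inj.
  - by rewrite (_ : Ordinal H = 2) //; exact/val_inj.
have -> : q@_nu = 0.
  by apply/eqP/negPn/negP => /(supp _ _ p nu hp wp)/uniq/eqP; rewrite (negPf ne).
have -> : q'@_nu = 0.
  by apply/eqP/negPn/negP => /(supp _ _ p' nu hp' wp')/uniq/eqP; rewrite (negPf ne).
by rewrite mulr0 addr0.
Qed.

Lemma mcoeff_subc_diag (d : 'rV[C]_3) p mu :
  (subc (diag_mx d) p)@_mu = (\prod_(j < 3) d 0 j ^+ mu j) * p@_mu.
Proof.
elim/mpolyind: p => [|c nu p _ _ ih].
  by rewrite -mpolyC0 subcC mpolyC0 mcoeff0 mulr0.
rewrite subcD subcZ !mcoeffD !mcoeffZ ih mulrDr; congr (_ + _).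
have -> : subc (diag_mx d) 'X_[nu] = (\prod_(j < 3) d 0 j ^+ nu j) *: 'X_[nu].
  rewrite mpolyXE_id -scaler_prod [LHS](rmorph_prod (comp_mpoly _)).
  apply: eq_bigr => i _ /=.
  have e : subc (diag_mx d) 'X_i = d 0 i *: 'X_i.
    rewrite subcX (bigD1 i) //= mxE eqxx mulr1n big1 ?addr0// => j ji.
    by rewrite mxE eq_sym (negPf ji) scale0r.
  by rewrite (rmorphXn (comp_mpoly _)) -exprZn; congr (_ ^+ _); exact: e.
rewrite mcoeffZ mcoeffX; have [->|_] := eqVneq nu mu; last by rewrite !mulr0.
by rewrite mulrCA.
Qed.

End Weights.

(** * The infinitesimal action on harmonic polynomials *)

Section Rep.
Variables (R : rcfType) (m : nat).
Local Notation V := (H R m).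
Local Notation C := R[i].
Implicit Types (k l : 'M[R]_3) (p : V) (T : 'End(V)) (Z : 'M[C]_3).

Definition cmx k : 'M[C]_3 := map_mx (real_complex R) k.

Lemma mpoly_of_H_inj : injective (@mpoly_of_H R m).
Proof. by move=> p q /val_inj/val_inj. Qed.

Lemma mpoly_of_H_linear c p q :
  mpoly_of_H (c *: p + q) = c *: mpoly_of_H p + mpoly_of_H q.
Proof. by rewrite /mpoly_of_H linearP. Qed.

Lemma mpoly_of_H_homog p : mpoly_of_H p \is m.-homog.
Proof. exact: dhomog_is_dhomog. Qed.

Lemma mpoly_of_H_harmonic p : lapc (mpoly_of_H p) = 0.
Proof. by have := valP p; rewrite -[val p]/(vsval p) mem_harmonic => /eqP. Qed.

Lemma mpoly_of_H0 : mpoly_of_H (0 : V) = 0.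
Proof. by have := mpoly_of_H_linear (-1) (0 : V) 0; rewrite scaler0 addr0 scaleN1r addNr. Qed.

Lemma mpoly_of_HZ c p : mpoly_of_H (c *: p) = c *: mpoly_of_H p.
Proof. by rewrite -[c *: p]addr0 mpoly_of_H_linear mpoly_of_H0 addr0. Qed.

Lemma mpoly_of_HB p q : mpoly_of_H (p - q) = mpoly_of_H p - mpoly_of_H q.
Proof. by rewrite addrC -scaleN1r mpoly_of_H_linear scaleN1r addrC. Qed.

(** The inverse of an orthogonal matrix is its transpose. *)
Lemma tau_subc k p : O3 k -> mpoly_of_H (tau m k p) = subc (cmx k)^T (mpoly_of_H p).
Proof.
move=> kO; transitivity (subst_lin (invmx k) (mpoly_of_H p)); first exact: tauE.
have [ku _] := mulmx1_unit kO.
have -> : invmx k = k^T by rewrite -[LHS]mulmx1 -kO mulKmx.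
have -> : subst_lin k^T (mpoly_of_H p) = subc (cmx k^T) (mpoly_of_H p).
  rewrite /subst_lin /subc; apply: (congr1 (fun t => mpoly_of_H p \mPo t)).
  apply: eq_from_tnth => i.
  by rewrite !tnth_mktuple; apply: eq_bigr => j _; rewrite [cmx _ _ _]mxE.
by rewrite /cmx map_trmx.
Qed.

Lemma O3M k l : O3 k -> O3 l -> O3 (k *m l).
Proof. by rewrite /O3 trmx_mul mulmxA => kO lO; rewrite -(mulmxA k) lO mulmx1. Qed.

Lemma tauM k l : O3 k -> O3 l -> tau m (k *m l) = (tau m k \o tau m l)%VF.
Proof.
move=> kO lO; apply/lfunP => p; apply: mpoly_of_H_inj.
rewrite comp_lfunE (tau_subc _ (O3M kO lO)) (tau_subc _ kO) (tau_subc _ lO).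
by rewrite subc_comp /cmx map_mxM trmx_mul.
Qed.

Lemma tau1 : tau m (1%:M : 'M[R]_3) = \1%VF.
Proof.
have O1 : O3 (1%:M : 'M[R]_3) by rewrite /O3 trmx1 mulmx1.
apply/lfunP => p; apply: mpoly_of_H_inj.
by rewrite id_lfunE (tau_subc _ O1) /cmx map_mx1 trmx1 subc1.
Qed.

(** T is the restriction to harmonic polynomials of the derivation given by the
    linear vector field Z. *)
Definition generates T Z := forall p, mpoly_of_H (T p) = vfield Z (mpoly_of_H p).

Lemma generates_conj T T' Z Z' k : O3 k -> generates T Z -> generates T' Z' ->
  Z *m (cmx k)^T = (cmx k)^T *m Z' -> (tau m k \o T = T' \o tau m k)%VF.
Proof.
move=> kO TZ TZ' e; apply/lfunP => p; apply: mpoly_of_H_inj.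
by rewrite !comp_lfunE (tau_subc _ kO) TZ TZ' (tau_subc _ kO) (vfield_subc _ e).
Qed.

Lemma generates_linear T T' Z Z' c : generates T Z -> generates T' Z' ->
  generates (c *: T + T') (c *: Z + Z').
Proof.
move=> TZ TZ' p; rewrite add_lfunE scale_lfunE mpoly_of_H_linear TZ TZ'.
by rewrite vfield_linear.
Qed.

Section Curve.
Variables (X : Type) (t0 : X) (D : (X -> C) -> C -> Prop).
Hypotheses (D_ext : forall f g a, f =1 g -> D f a -> D g a)
  (D_cst : forall c, D (fun=> c) 0)
  (D_add : forall f g a b, D f a -> D g b -> D (fun t => f t + g t) (a + b))
  (D_mul : forall f g a b, D f a -> D g b ->
    D (fun t => f t * g t) (a * g t0 + f t0 * b))
  (D_uniq : forall f a b, D f a -> D f b -> a = b).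

Let D_mulr f a c : D f a -> D (fun t => f t * c) (a * c).
Proof. by move=> Df; have := D_mul Df (D_cst c); rewrite mulr0 addr0. Qed.

(** The coefficients of the polynomials tau (K t) p separate endomorphisms, so that
    their derivatives, which [subc_curve] computes, determine those of all
    coordinates of tau (K t). *)
Lemma generates_curve (K : X -> 'M[R]_3) Z : (forall t, O3 (K t)) -> K t0 = 1%:M ->
  (forall i j, D (fun t => (K t j i)%:C) (Z i j)) ->
  exists2 T, generates T Z & forall i,
    D (fun t => coord (vbasis {:'End(V)}) i (tau m (K t)))
      (coord (vbasis {:'End(V)}) i T).
Proof.
move=> KO K0 KZ.
pose psi (p : V) (mu : 'X_{1..3}) (f : 'End(V)) : C := (mpoly_of_H (f p))@_mu.
have psi_lin p mu c f g : psi p mu (c *: f + g) = c * psi p mu f + psi p mu g.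
  by rewrite /psi add_lfunE scale_lfunE mpoly_of_H_linear mcoeffD mcoeffZ.
have psi_coord p mu f : psi p mu f =
    \sum_i coord (vbasis {:'End(V)}) i f * psi p mu (vbasis {:'End(V)})`_i.
  have p0 : psi p mu 0 = 0 by rewrite /psi zero_lfunE mpoly_of_H0 mcoeff0.
  rewrite {1}(coord_e f); elim/big_rec2: _ => [|i y x _ <-]; first exact: p0.
  exact: psi_lin.
have Dpsi p mu : D (fun t => psi p mu (tau m (K t))) (vfield Z (mpoly_of_H p))@_mu.
  apply: (D_ext (f := fun t => (subc (cmx (K t))^T (mpoly_of_H p))@_mu)).
    by move=> t; rewrite /psi (tau_subc _ (KO t)).
  apply: (subc_curve D_ext D_cst D_add D_mul (K := fun t => (cmx (K t))^T)).
    by rewrite K0 /cmx map_mx1 trmx1.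
  by move=> i j; apply: (D_ext _ (KZ i j)) => t; rewrite !mxE.
pose J := ('I_(\dim {:V}) * 'X_{1..3 < m.+1})%type.
pose phi (a : J) := psi (vbasis {:V})`_a.1 (bmnm a.2).
have [N eN] : exists N : J -> 'I_(\dim {:'End(V)}) -> C,
    forall v i, coord (vbasis {:'End(V)}) i v = \sum_a phi a v * N a i.
  apply: coord_separating => [a c f g|f f0]; first exact: psi_lin.
  apply/lfunP => p; rewrite (coord_e p) !linear_sum; apply: eq_bigr => i _.
  rewrite !linearZ /= zero_lfunE; congr (_ *: _); apply: mpoly_of_H_inj.
  rewrite mpoly_of_H0; apply/mpolyP => mu; rewrite mcoeff0.
  have [le|gt] := ltnP (mdeg mu) m.+1; first exact: (f0 (i, BMultinom le)).
  apply/eqP/negPn/negP => /(mdeg_dhomog (mpoly_of_H_homog _)) e.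
  by rewrite e ltnn in gt.
pose d i := \sum_(a : J) (vfield Z (mpoly_of_H (vbasis {:V})`_a.1))@_(bmnm a.2) * N a i.
have Dd i : D (fun t => coord (vbasis {:'End(V)}) i (tau m (K t))) (d i).
  apply: (D_ext (f := fun t => \sum_a phi a (tau m (K t)) * N a i)).
    by move=> t; rewrite -eN.
  by apply: (D_sum D_ext D_cst D_add) => a _; apply: D_mulr; exact: Dpsi.
pose T : 'End(V) := \sum_i d i *: (vbasis {:'End(V)})`_i.
have cT i : coord (vbasis {:'End(V)}) i T = d i.
  by rewrite coord_sum_free//; exact: (basis_free (vbasisP _)).
exists T => [p|i]; last by rewrite cT; exact: Dd.
apply/mpolyP => mu; apply: (D_uniq _ (Dpsi p mu)).
rewrite -/(psi p mu T) psi_coord.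
apply: (D_ext (f := fun t => \sum_i coord (vbasis {:'End(V)}) i (tau m (K t)) *
  psi p mu (vbasis {:'End(V)})`_i)).
  by move=> t; rewrite -psi_coord.
by apply: (D_sum D_ext D_cst D_add) => i _; rewrite cT; apply: D_mulr; exact: Dd.
Qed.

End Curve.

Local Notation I := (0 +i* 1 : C).

Let I2 : I * I = -1.
Proof. by rewrite -expr2 sqr_i. Qed.

(** The eigenvalues i j, -m <= j <= m, indexed from 0. *)
Definition ev (j : 'I_(2 * m).+1) : C := 0 +i* (j%:Z - m%:Z)%:~R.

Lemma evE j : ev j = weight I m j.
Proof.
rewrite /weight /ev; apply/eqP; rewrite eq_complex.
have -> : (j%:R - m%:R : C) = ((j%:R - m%:R : R))%:C by rewrite rmorphB !rmorph_nat.
by rewrite /= !mul0r !mulr0 !mul1r subr0 add0r rmorphB /= !eqxx.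
Qed.

Lemma ev_inj : injective ev.
Proof.
by move=> i j [] /intr_inj/(addIr _) [] /val_inj.
Qed.

Lemma ev_rev j : ev (rev_ord j) = - ev j.
Proof.
apply/eqP; rewrite eq_complex /= oppr0 eqxx /= -rmorphN /=; apply/eqP; congr (_%:~R).
by have := ltn_ord j; lia.
Qed.

Section Rot3.
Variable T : 'End(V).
Hypothesis TZ : generates T (rot3_gen C).

Lemma generates_eigenspaces_span : eigenspaces_span ev T.
Proof.
move=> v.
have inj : injective (fun a : nat => weight I m a).
  move=> a b; rewrite /weight => /mulfI h; apply/eqP; rewrite -(eqr_nat C); apply/eqP.
  by apply: (addIr (- m%:R)); apply: h; rewrite eq_complex /= oner_eq0 andbF.
pose s := [seq weight I m a | a <- iota 0 (2 * m).+1].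
have us : uniq s by rewrite map_inj_uniq ?iota_uniq.
have [|u e eu] := @foldl_eigen _ V T s v us.
  apply: mpoly_of_H_inj; rewrite mpoly_of_H0.
  rewrite -(weight_annihilation I2 (mpoly_of_H_homog v)) /s.
  elim: (iota _ _) v => [|a r ih] v; first by [].
  rewrite /= ih; congr (foldl _ _ _).
  by rewrite mpoly_of_HB mpoly_of_HZ TZ.
exists (fun j => u (ev j)) => [|j].
  rewrite e; have -> : s = [seq weight I m a | a <- index_iota 0 (2 * m).+1] by rewrite /s /index_iota subn0.
  rewrite big_map big_mkord.
  by apply: eq_bigr => j _; rewrite evE.
by apply: eu; rewrite evE; apply: map_f; rewrite mem_iota /= add0n.
Qed.

Let eigen j v : T v = ev j *: v ->
  vfield (rot3_gen C) (mpoly_of_H v) = weight I m j *: mpoly_of_H v.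
Proof. by move=> e; rewrite -TZ e mpoly_of_HZ evE. Qed.

Lemma generates_simple : simple_spectrum ev T.
Proof.
move=> j u v eu ev' u0.
have [|c e] := weight_simple I2 (mpoly_of_H_homog u) (mpoly_of_H_homog v)
  (mpoly_of_H_harmonic u) (mpoly_of_H_harmonic v) (eigen eu) (eigen ev').
  by apply: contraNneq u0 => e; apply/eqP/mpoly_of_H_inj; rewrite e mpoly_of_H0.
by exists c; apply: mpoly_of_H_inj; rewrite mpoly_of_HZ.
Qed.

Definition rot3 (c s : R) : 'M[R]_3 := \matrix_(i, j)
  nth 0 (nth [::] [:: [:: c; - s; 0]; [:: s; c; 0]; [:: 0; 0; 1]] i) j.

(** With z = c - i s of modulus 1, the weight mu_0 - mu_1 = j - m gives
    z ^ mu_0 / z ^ mu_1 = z ^ j / z ^ m. *)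
Lemma tau_rot3 c s j v : O3 (rot3 c s) -> c ^+ 2 + s ^+ 2 = 1 -> T v = ev j *: v ->
  tau m (rot3 c s) v = ((c +i* - s) ^+ j * (c +i* s) ^+ m) *: v.
Proof.
move=> kO cs Tv; apply: mpoly_of_H_inj; rewrite (tau_subc _ kO) mpoly_of_HZ.
apply: (@subc_of_inj C I I2).
pose z : C := c +i* - s; pose y : C := c +i* s; pose d : 'rV[C]_3 := \row_j nth 0 [:: z; y; 1] j.
have zy : z * y = 1.
  apply/eqP; rewrite eq_complex /= mulNr opprK -!expr2 cs eqxx /=.
  by rewrite mulNr mulrC subrr.
have e : (cmx (rot3 c s))^T *m of_zw I = of_zw I *m diag_mx d.
  have h2 : (2^-1 : C) = (2^-1)%:C by rewrite fmorphV rmorph_nat.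
  apply/matrixP => i j'; rewrite !mxE !sum3 !mxE.
  case: i => -[|[|[|//]]] ?; case: j' => -[|[|[|//]]] ? /=;
    apply/eqP; rewrite ?h2 eq_complex /=; apply/andP; split; apply/eqP;
    rewrite ?(mulr0n, mulr1n) /=; ring.
rewrite subcZ subc_comp e -subc_comp; apply/mpolyP => mu.
rewrite mcoeff_subc_diag mcoeffZ.
set q := (subc _ _); have [->|nz] := eqVneq q@_mu 0; first by rewrite !mulr0.
have [h _] := weight_support I2 (mpoly_of_H_homog v) (eigen Tv) nz.
congr (_ * _); rewrite big_ord_recl big_ord_recl big_ord_recl big_ord0 !mxE /=.
rewrite expr1n !mulr1 -/z -/y.
have -> : mu (lift ord0 ord0) = mu 1 by congr (mu _); exact/val_inj.
have -> : mu ord0 = mu 0 by congr (mu _); exact/val_inj.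
have zyn n : z ^+ n * y ^+ n = 1 by rewrite -exprMn zy expr1n.
rewrite -[LHS]mul1r -(zyn m) mulrACA -!exprD addnC h addnC exprD.
have key (u w : C) n : u ^+ n * w ^+ n = 1 ->
    u ^+ j * u ^+ n * w ^+ (m + n) = u ^+ j * w ^+ m.
  by move=> uw; rewrite (addnC m) exprD mulrA -(mulrA (u ^+ j)) uw mulr1.
exact: key (zyn _).
Qed.

End Rot3.

End Rep.

End HarmonicWeights.

From mathcomp Require Import all_classical all_reals all_analysis measurable_realfun.
Import numFieldNormedType.Exports.
Import Harmonic HarmonicWeights.
Local Open Scope classical_set_scope.
Local Open Scope complex_scope.
Local Open Scope ring_scope.

(** * Complex-valued functions and their integrals *)

Section ComplexModulus.
Variable R : realType.
Implicit Types z w : R[i].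

Lemma ReD z w : complex.Re (z + w) = complex.Re z + complex.Re w.
Proof. by case: z w => [? ?] [? ?]. Qed.

Lemma ImD z w : complex.Im (z + w) = complex.Im z + complex.Im w.
Proof. by case: z w => [? ?] [? ?]. Qed.

Lemma ReM z w : complex.Re (z * w) =
  complex.Re z * complex.Re w - complex.Im z * complex.Im w.
Proof. by case: z w => [? ?] [? ?]. Qed.

Lemma ImM z w : complex.Im (z * w) =
  complex.Re z * complex.Im w + complex.Im z * complex.Re w.
Proof. by case: z w => [? ?] [? ?]. Qed.

Lemma complex_ext z w : complex.Re z = complex.Re w ->
  complex.Im z = complex.Im w -> z = w.
Proof. by case: z w => [? ?] [? ?] /= -> ->. Qed.

(** A norm equivalent to the modulus, which bounds and is bounded by the real and
    imaginary parts without square roots. *)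
Definition cabs z := `|complex.Re z| + `|complex.Im z|.

Lemma cabs_ge0 z : 0 <= cabs z.
Proof. by rewrite addr_ge0. Qed.

Lemma cabsD z w : cabs (z + w) <= cabs z + cabs w.
Proof.
rewrite /cabs ReD ImD.
have := ler_normD (complex.Re z) (complex.Re w).
have := ler_normD (complex.Im z) (complex.Im w).
lra.
Qed.

Lemma cabsM z w : cabs (z * w) <= cabs z * cabs w.
Proof.
rewrite /cabs ReM ImM.
have := ler_normB (complex.Re z * complex.Re w) (complex.Im z * complex.Im w).
have := ler_normD (complex.Re z * complex.Im w) (complex.Im z * complex.Re w).
rewrite !normrM; lra.
Qed.

Lemma cabs_real (x : R) : cabs x%:C = `|x|.
Proof. by rewrite /cabs /= normr0 addr0. Qed.

Lemma Re_le_cabs z : `|complex.Re z| <= cabs z.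
Proof. by rewrite lerDl. Qed.

Lemma Im_le_cabs z : `|complex.Im z| <= cabs z.
Proof. by rewrite lerDr. Qed.

Lemma expiD (s t : R) : expi (s + t) = expi s * expi t.
Proof. by apply: complex_ext; rewrite ?ReM ?ImM /= ?cosD ?sinD; ring. Qed.

Lemma expi0 : expi 0 = 1 :> R[i].
Proof. by rewrite /expi cos0 sin0. Qed.

Lemma cabs_expi (t : R) : cabs (expi t) <= 2.
Proof.
have c1 : `|cos t| <= 1 by rewrite ler_norml cos_geN1 cos_le1.
have s1 : `|sin t| <= 1 by rewrite ler_norml sin_geN1 sin_le1.
by rewrite /cabs /= -[2]/(1 + 1) lerD.
Qed.

Definition ccvg (u : nat -> R[i]) z :=
  (fun n => complex.Re (u n)) @ \oo --> complex.Re z /\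
  (fun n => complex.Im (u n)) @ \oo --> complex.Im z.

Lemma ccvg_unique u z w : ccvg u z -> ccvg u w -> z = w.
Proof.
move=> [r1 i1] [r2 i2].
by apply: complex_ext;
  [exact: (cvg_unique _ r1 r2)|exact: (cvg_unique _ i1 i2)].
Qed.

Lemma ccvgM u v z w : ccvg u z -> ccvg v w -> ccvg (fun n => u n * v n) (z * w).
Proof.
move=> [r1 i1] [r2 i2]; split.
  under eq_fun do rewrite ReM.
  by rewrite ReM; apply: cvgB; apply: cvgM.
under eq_fun do rewrite ImM.
by rewrite ImM; apply: cvgD; apply: cvgM.
Qed.

Lemma ccvg_cst z : ccvg (fun=> z) z.
Proof. by split; exact: cvg_cst. Qed.

End ComplexModulus.

Section ComplexMeasurable.
Context {R : realType} d {T : measurableType d}.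
Implicit Types f g : T -> R[i].

Definition cmeas f := measurable_fun setT (fun x => complex.Re (f x)) /\
  measurable_fun setT (fun x => complex.Im (f x)).

Lemma cmeas_cst z : cmeas (fun=> z).
Proof. by split; exact: measurable_cst. Qed.

Lemma cmeasD f g : cmeas f -> cmeas g -> cmeas (fun x => f x + g x).
Proof.
move=> [f1 f2] [g1 g2]; split.
  by under eq_fun do rewrite ReD; exact: measurable_funD.
by under eq_fun do rewrite ImD; exact: measurable_funD.
Qed.

Lemma cmeasM f g : cmeas f -> cmeas g -> cmeas (fun x => f x * g x).
Proof.
move=> [f1 f2] [g1 g2]; split.
  by under eq_fun do rewrite ReM; apply: measurable_funB; exact: measurable_funM.
by under eq_fun do rewrite ImM; apply: measurable_funD; exact: measurable_funM.
Qed.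

Lemma cmeas_real (h : T -> R) : measurable_fun setT h -> cmeas (fun x => (h x)%:C).
Proof. by move=> mh; split => //=; exact: measurable_cst. Qed.

Lemma cmeas_expi (h : T -> R) :
  measurable_fun setT h -> cmeas (fun x => expi (h x)).
Proof.
move=> mh; split => /=; apply: measurableT_comp => //.
  by apply: continuous_measurable_fun; exact: continuous_cos.
by apply: continuous_measurable_fun; exact: continuous_sin.
Qed.

Lemma measurable_cabs f : cmeas f -> measurable_fun setT (fun x => cabs (f x)).
Proof.
by move=> [f1 f2]; apply: measurable_funD; apply: measurableT_comp.
Qed.

Lemma cmeas_cvg (f_ : nat -> T -> R[i]) f : (forall n, cmeas (f_ n)) ->
  (forall x, ccvg (f_ ^~ x) (f x)) -> cmeas f.
Proof.
move=> mf cf; split.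
  by apply: (measurable_fun_cvg (fun n => (mf n).1)) => x _; exact: (cf x).1.
by apply: (measurable_fun_cvg (fun n => (mf n).2)) => x _; exact: (cf x).2.
Qed.

End ComplexMeasurable.

Lemma cmeas_comp {R : realType} d1 d2 (T1 : measurableType d1)
    (T2 : measurableType d2) (f : T2 -> R[i]) (h : T1 -> T2) :
  cmeas f -> measurable_fun setT h -> cmeas (fun x => f (h x)).
Proof.
move=> [f1 f2] mh.
by split; [apply: (measurableT_comp f1)|apply: (measurableT_comp f2)].
Qed.

Section ComplexIntegral.
Context {R : realType} d {T : measurableType d}.
Variable mu : {measure set T -> \bar R}.
Implicit Types f g : T -> R[i].

Local Notation L1 := (cintegrable mu setT).
Local Notation "'Int' f" := (cint mu setT f) (at level 10, f at level 8).

Lemma Re_cint D f : complex.Re (cint mu D f) = \int[mu]_(x in D) complex.Re (f x).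
Proof. by []. Qed.

Lemma Im_cint D f : complex.Im (cint mu D f) = \int[mu]_(x in D) complex.Im (f x).
Proof. by []. Qed.

Lemma cintegrable_cmeas f : L1 f -> cmeas f.
Proof.
by move=> [/measurable_int/measurable_EFinP f1 /measurable_int/measurable_EFinP].
Qed.

(** Absolute integrability: the working criterion for integrability below. *)
Lemma cintegrableP f : L1 f <->
  cmeas f /\ mu.-integrable setT (fun x => (cabs (f x))%:E).
Proof.
split=> [fL1|[[f1 f2] fi]].
  have mf := cintegrable_cmeas fL1; split=> //.
  have := integrableD measurableT (integrable_abse fL1.1) (integrable_abse fL1.2).
  by apply: eq_integrable.
split; apply: le_integrable fi => //=.
- exact/measurable_EFinP.
- by move=> x _; rewrite lee_fin (ger0_norm (cabs_ge0 _)) Re_le_cabs.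
- exact/measurable_EFinP.
- by move=> x _; rewrite lee_fin (ger0_norm (cabs_ge0 _)) Im_le_cabs.
Qed.

Lemma cintegrable_le f (h : T -> R) : cmeas f -> (forall x, cabs (f x) <= h x) ->
  mu.-integrable setT (fun x => (h x)%:E) -> L1 f.
Proof.
move=> mf fh hi; apply/cintegrableP; split=> //; apply: le_integrable hi => //.
  by apply/measurable_EFinP; exact: measurable_cabs.
move=> x _ /=; rewrite lee_fin (ger0_norm (cabs_ge0 _)).
exact: le_trans (fh x) (ler_norm _).
Qed.

Lemma cintegrableM_bounded f g (M : R) : L1 f -> cmeas g ->
  (forall x, cabs (g x) <= M) -> L1 (fun x => f x * g x).
Proof.
move=> /cintegrableP[mf fi] mg gM.
apply: (@cintegrable_le _ (fun x => M * cabs (f x))).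
- exact: cmeasM.
- move=> x; apply: le_trans (cabsM _ _) _.
  by rewrite mulrC ler_wpM2r// cabs_ge0.
- exact: (integrableZl measurableT M fi).
Qed.

Lemma cintegrableZ f z : L1 f -> L1 (fun x => z * f x).
Proof.
move=> fi; under eq_fun do rewrite mulrC.
by apply: cintegrableM_bounded fi (cmeas_cst z) (fun=> lexx _).
Qed.

Lemma cintegrableD f g : L1 f -> L1 g -> L1 (fun x => f x + g x).
Proof.
move=> [f1 f2] [g1 g2]; split.
  by apply: eq_integrable (integrableD measurableT f1 g1) => // x _; rewrite /= ReD.
by apply: eq_integrable (integrableD measurableT f2 g2) => // x _; rewrite /= ImD.
Qed.

Lemma cintegrable0 : L1 (fun=> 0).
Proof. by split; exact: integrable0. Qed.

Lemma cintegrable_sum (I : Type) (s : seq I) (f : I -> T -> R[i]) :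
  (forall i, L1 (f i)) -> L1 (fun x => \sum_(i <- s) f i x).
Proof.
move=> fi; elim: s => [|i s ih].
  by under eq_fun do rewrite big_nil; exact: cintegrable0.
by under eq_fun do rewrite big_cons; exact: cintegrableD.
Qed.

Lemma cintD f g : L1 f -> L1 g ->
  Int (fun x => f x + g x) = Int f + Int g.
Proof.
move=> [f1 f2] [g1 g2]; rewrite /cint; apply: complex_ext => /=.
  by rewrite -RintegralD//; under eq_Rintegral do rewrite ReD.
by rewrite -RintegralD//; under eq_Rintegral do rewrite ImD.
Qed.

Lemma cintZ f z : L1 f -> Int (fun x => z * f x) = z * Int f.
Proof.
move=> [f1 f2]; rewrite /cint; apply: complex_ext; rewrite ?ReM ?ImM /=.
  rewrite -!RintegralZl// -RintegralB//.
  - by under eq_Rintegral do rewrite ReM.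
  - exact: (integrableZl measurableT _ f1).
  - exact: (integrableZl measurableT _ f2).
rewrite -!RintegralZl// -RintegralD//.
- by under eq_Rintegral do rewrite ImM.
- exact: (integrableZl measurableT _ f2).
- exact: (integrableZl measurableT _ f1).
Qed.

Lemma cint0 : Int (fun=> 0) = 0.
Proof.
rewrite /cint /=.
have -> : \int[mu]_(x in setT) (0 : R) = 0.
  by rewrite /Rintegral integral0_eq.
by [].
Qed.

Lemma cint_sum (I : Type) (s : seq I) (f : I -> T -> R[i]) :
  (forall i, L1 (f i)) ->
  Int (fun x => \sum_(i <- s) f i x) = \sum_(i <- s) Int (f i).
Proof.
move=> fi; elim: s => [|i s ih].
  by under eq_fun do rewrite big_nil; rewrite big_nil cint0.
under eq_fun do rewrite big_cons.
by rewrite big_cons cintD// ?ih//; exact: cintegrable_sum.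
Qed.

Lemma ae_eq_cint f g : cmeas f -> cmeas g ->
  {ae mu, forall x, f x = g x} -> Int f = Int g.
Proof.
move=> [f1 f2] [g1 g2] fg; apply: complex_ext; rewrite /cint/= /Rintegral;
  congr fine; apply: ae_eq_integral => //; try exact/measurable_EFinP.
  by apply: filterS fg => x /= ->.
by apply: filterS fg => x /= ->.
Qed.

Lemma cint_cvg (f_ : nat -> T -> R[i]) f (h : T -> R) :
  (forall n, cmeas (f_ n)) -> (forall x, ccvg (f_ ^~ x) (f x)) ->
  (forall n x, cabs (f_ n x) <= h x) ->
  mu.-integrable setT (fun x => (h x)%:E) ->
  L1 f /\ ccvg (fun n => Int (f_ n)) (Int f).
Proof.
move=> mf cf fh hi; have [mf1 mf2] := cmeas_cvg mf cf.
have [||||Ri _ Rc] := dominated_convergence (mu := mu) measurableT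
    (f_ := fun n x => (complex.Re (f_ n x))%:E)
    (f := fun x => (complex.Re (f x))%:E) _ _ _ hi.
- by move=> n; apply/measurable_EFinP; exact: (mf n).1.
- exact/measurable_EFinP.
- by apply/nearW => x _; apply: cvg_EFin; [exact: nearW|exact: (cf x).1].
- apply/nearW => x n _; rewrite lee_fin.
  exact: le_trans (Re_le_cabs _) (fh n x).
have [||||Ii _ Ic] := dominated_convergence (mu := mu) measurableT
    (f_ := fun n x => (complex.Im (f_ n x))%:E)
    (f := fun x => (complex.Im (f x))%:E) _ _ _ hi.
- by move=> n; apply/measurable_EFinP; exact: (mf n).2.
- exact/measurable_EFinP.
- by apply/nearW => x _; apply: cvg_EFin; [exact: nearW|exact: (cf x).2].
- apply/nearW => x n _; rewrite lee_fin.
  exact: le_trans (Im_le_cabs _) (fh n x).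
split; first by split.
split; rewrite /cint /= /Rintegral.
- apply: fine_cvg; rewrite fineK//.
  by apply: integrable_fin_num.
- apply: fine_cvg; rewrite fineK//.
  by apply: integrable_fin_num.
Qed.

End ComplexIntegral.

Section ComplexFubini.
Context {R : realType} d1 d2 {T1 : measurableType d1} {T2 : measurableType d2}.
Variables (m1 : {sigma_finite_measure set T1 -> \bar R})
  (m2 : {sigma_finite_measure set T2 -> \bar R}).

Lemma Rintegral_fubini (f : T1 * T2 -> R) :
  (m1 \x m2)%E.-integrable setT (EFin \o f) ->
  [/\ m1.-integrable setT (fun x => (\int[m2]_y f (x, y))%:E),
      m2.-integrable setT (fun y => (\int[m1]_x f (x, y))%:E),
      \int[m1]_x (\int[m2]_y f (x, y)) = \int[(m1 \x m2)%E]_z f z &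
      \int[m2]_y (\int[m1]_x f (x, y)) = \int[(m1 \x m2)%E]_z f z].
Proof.
move=> fi; have F1 := integrable_fubini_F fi.
have F2 : m2.-integrable setT (fubini_G m1 (EFin \o f)).
  apply/integrableP; split; first exact: (measurable_fubini_G fi).
  apply: le_lt_trans ((integrable21ltyP m1 m2 (measurable_int _ fi)).1 fi).
  apply: ge0_le_integral => //.
  - by apply: measurableT_comp => //; exact: (measurable_fubini_G fi).
  - apply: (measurable_fun_fubini_tonelli_G (abse \o (EFin \o f))) => //.
      by apply: measurableT_comp => //; exact: (measurable_int _ fi).
    by move=> y; rewrite /= lee_fin.
  - move=> y _; apply: le_abse_integral => //.
    apply: measurableT_comp; first exact: (measurable_int _ fi).
    exact: measurable_pair2.
have e1 : {ae m1, forall x,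
    (\int[m2]_y f (x, y))%:E = fubini_F m2 (EFin \o f) x}.
  have := integrable_ae measurableT F1; apply: filterS => x /(_ I) h.
  by rewrite /Rintegral fineK.
have e2 : {ae m2, forall y,
    (\int[m1]_x f (x, y))%:E = fubini_G m1 (EFin \o f) y}.
  have := integrable_ae measurableT F2; apply: filterS => x /(_ I) h.
  by rewrite /Rintegral fineK.
have mF1 : measurable_fun setT (fun x => (\int[m2]_y f (x, y))%:E).
  apply/measurable_EFinP; apply: (measurableT_comp (@fine_measurable R setT _)) => //.
  exact: (measurable_int _ F1).
have mF2 : measurable_fun setT (fun x => (\int[m1]_y f (y, x))%:E).
  apply/measurable_EFinP; apply: (measurableT_comp (@fine_measurable R setT _)) => //.
  exact: (measurable_int _ F2).
have fle (z : \bar R) : (`|(fine z)%:E| <= `|z|)%E.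
  by case: z => [r| |] //=; rewrite ?normr0 ?leey.
split.
- apply: le_integrable F1 => // x _ /=.
  exact: fle.
- apply: le_integrable F2 => // x _ /=.
  exact: fle.
- rewrite /Rintegral -(integral12_prod_meas1 fi); congr fine.
  apply: ae_eq_integral => //; first exact: (measurable_int _ F1).
  by apply: filterS e1 => x /= e _.
- rewrite /Rintegral -(integral21_prod_meas1 fi); congr fine.
  apply: ae_eq_integral => //; first exact: (measurable_int _ F2).
  by apply: filterS e2 => x /= e _.
Qed.

Lemma measurable_Rintegral (f : T1 * T2 -> R) : measurable_fun setT f ->
  measurable_fun setT (fun x => \int[m2]_y f (x, y)).
Proof.
move=> mf; have mef : measurable_fun setT (EFin \o f) by exact/measurable_EFinP.
apply: (measurableT_comp (@fine_measurable R setT _)) => //.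
rewrite (_ : (fun x => _) = (fun x => (\int[m2]_y (EFin \o f)^\+ (x, y)) -
    (\int[m2]_y (EFin \o f)^\- (x, y)))%E); last first.
  apply/funext => x; rewrite [LHS]integralE.
  by congr (_ - _)%E; apply: eq_integral => y _; rewrite ?funeposE ?funenegE.
apply: emeasurable_funB.
  apply: (measurable_fun_fubini_tonelli_F ((EFin \o f)^\+%E)) => //.
    by apply: measurable_funepos; exact: mef.
apply: (measurable_fun_fubini_tonelli_F ((EFin \o f)^\-%E)) => //.
by apply: measurable_funeneg; exact: mef.
Qed.

Lemma cmeas_cint (f : T1 * T2 -> R[i]) : cmeas f ->
  cmeas (fun x => cint m2 setT (fun y => f (x, y))).
Proof.
by move=> [f1 f2]; split;
  [exact: (measurable_Rintegral f1)|exact: (measurable_Rintegral f2)].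
Qed.

Lemma cint_fubini (f : T1 * T2 -> R[i]) :
  cintegrable (m1 \x m2)%E setT f ->
  [/\ cintegrable m1 setT (fun x => cint m2 setT (fun y => f (x, y))),
      cintegrable m2 setT (fun y => cint m1 setT (fun x => f (x, y))),
      cint m1 setT (fun x => cint m2 setT (fun y => f (x, y))) =
        cint (m1 \x m2)%E setT f &
      cint m2 setT (fun y => cint m1 setT (fun x => f (x, y))) =
        cint (m1 \x m2)%E setT f].
Proof.
move=> [/Rintegral_fubini[a1 a2 a3 a4] /Rintegral_fubini[b1 b2 b3 b4]].
by split; [split|split|rewrite /cint /= a3 b3|rewrite /cint /= a4 b4].
Qed.

Lemma integrable_tensor (f : T1 -> R) (g : T2 -> R) :
  m1.-integrable setT (EFin \o f) -> m2.-integrable setT (EFin \o g) ->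
  (m1 \x m2)%E.-integrable setT (fun z => (f z.1 * g z.2)%:E).
Proof.
move=> fi gi.
have mf : measurable_fun setT f by apply/measurable_EFinP; exact: measurable_int fi.
have mg : measurable_fun setT g by apply/measurable_EFinP; exact: measurable_int gi.
apply/integrable12ltyP.
  apply/measurable_EFinP; apply: measurable_funM.
    exact: (measurableT_comp mf).
  exact: (measurableT_comp mg).
pose G := (\int[m2]_y `|(g y)%:E|)%E.
have Gfin : G \is a fin_num.
  by have := integrable_fin_num measurableT (integrable_abse gi).
have G0 : (0 <= G)%E by exact: integral_ge0.
under eq_integral => x _.
  have -> : (\int[m2]_y `|(f (x, y).1 * g (x, y).2)%:E| = `|(f x)%:E| * G)%E.
    rewrite -ge0_integralZl//; last first.
      by apply: measurableT_comp => //; exact/measurable_EFinP.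
    by apply: eq_integral => y _; rewrite EFinM abseM.
  over.
rewrite ge0_integralZr//; last first.
  by apply: measurableT_comp => //; exact/measurable_EFinP.
have := integrable_fin_num measurableT (integrable_abse fi).
rewrite -(fineK Gfin) => /fineK; rewrite /comp => <-.
by rewrite -EFinM ltry.
Qed.

(** The shape in which Fubini is used throughout: a product of two integrable
    functions of one variable each and of a bounded function of both. *)
Lemma cintegrable_tensor (f : T1 -> R[i]) (g : T2 -> R[i])
    (h : T1 * T2 -> R[i]) (M : R) :
  cintegrable m1 setT f -> cintegrable m2 setT g -> cmeas h ->
  (forall z, cabs (h z) <= M) ->
  cintegrable (m1 \x m2)%E setT (fun z => f z.1 * g z.2 * h z).
Proof.
move=> fi gi mh hM.
have fg : cintegrable (m1 \x m2)%E setT (fun z => f z.1 * g z.2).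
  have [mf fn] := (cintegrableP _ _).1 fi; have [mg gn] := (cintegrableP _ _).1 gi.
  apply: cintegrable_le (integrable_tensor fn gn); last first.
    by move=> x; exact: cabsM.
  by apply: cmeasM; [apply: (cmeas_comp mf)|apply: (cmeas_comp mg)].
exact: cintegrableM_bounded fg mh hM.
Qed.

Lemma cint_tensor (f : T1 -> R[i]) (g : T2 -> R[i]) :
  cintegrable m1 setT f -> cintegrable m2 setT g ->
  cintegrable (m1 \x m2)%E setT (fun z => f z.1 * g z.2) /\
  cint (m1 \x m2)%E setT (fun z => f z.1 * g z.2) =
    cint m1 setT f * cint m2 setT g.
Proof.
move=> fi gi.
have fg : cintegrable (m1 \x m2)%E setT (fun z => f z.1 * g z.2).
  have := cintegrable_tensor fi gi (cmeas_cst 1) (fun=> lexx _).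
  by under eq_fun do rewrite mulr1.
split=> //; have [_ _ <- _] := cint_fubini fg.
under [X in cint _ _ X]eq_fun => x do rewrite /= (cintZ _ gi) mulrC.
by rewrite cintZ// mulrC.
Qed.

End ComplexFubini.

Section ComplexTransfer.
Context {R : realType} d1 d2 {X : measurableType d1} {Y : measurableType d2}.
Variables (mu : {measure set X -> \bar R}) (nu : {measure set Y -> \bar R}).
Variable phi : X -> Y.
Hypothesis mphi : measurable_fun setT phi.
Hypothesis muphi : forall A, measurable A -> mu (phi @^-1` A) = nu A.

Lemma ge0_integral_transfer (f : Y -> \bar R) : measurable_fun setT f ->
  (forall y, 0 <= f y)%E -> (\int[mu]_x f (phi x) = \int[nu]_y f y)%E.
Proof.
move=> mf f0.
rewrite -[LHS]/(\int[mu]_(x in phi @^-1` setT) (f \o phi) x)%E.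
rewrite -ge0_integral_pushforward//.
by apply: eq_measure_integral => A mA _; exact: muphi.
Qed.

Lemma integrable_transfer (f : Y -> \bar R) : measurable_fun setT f ->
  mu.-integrable setT (f \o phi) <-> nu.-integrable setT f.
Proof.
move=> mf; split=> /integrableP[_ fi]; apply/integrableP; split=> //.
- rewrite -ge0_integral_transfer//.
  by apply: measurableT_comp => //.
- exact: measurableT_comp.
- move: fi; rewrite -ge0_integral_transfer//.
  by apply: measurableT_comp => //.
Qed.

Lemma integral_transfer (f : Y -> \bar R) : measurable_fun setT f ->
  mu.-integrable setT (f \o phi) -> (\int[mu]_x f (phi x) = \int[nu]_y f y)%E.
Proof.
move=> mf fi.
rewrite -[LHS]/(\int[mu]_(x in phi @^-1` setT) (f \o phi) x)%E.
rewrite -integral_pushforward//.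
by apply: eq_measure_integral => A mA _; exact: muphi.
Qed.

Lemma cintegrable_transfer (f : Y -> R[i]) : cmeas f ->
  cintegrable mu setT (f \o phi) <-> cintegrable nu setT f.
Proof.
move=> [m1 m2].
have e1 := integrable_transfer ((measurable_EFinP _ _).2 m1).
have e2 := integrable_transfer ((measurable_EFinP _ _).2 m2).
by split=> -[] a b; split; try exact/e1; try exact/e2.
Qed.

Lemma cint_transfer (f : Y -> R[i]) : cmeas f ->
  cintegrable mu setT (f \o phi) ->
  cint mu setT (f \o phi) = cint nu setT f.
Proof.
move=> [m1 m2] [i1 i2]; rewrite /cint /Rintegral; congr (fine _ +i* fine _).
  exact: integral_transfer ((measurable_EFinP _ _).2 m1) i1.
exact: integral_transfer ((measurable_EFinP _ _).2 m2) i2.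
Qed.

End ComplexTransfer.

Section ComplexDomain.
Context {R : realType} d {T : measurableType d}.
Variable mu : {measure set T -> \bar R}.
Implicit Types (f : T -> R[i]) (D : set T).

Definition crestr D f x : R[i] := (\1_D x : R)%:C * f x.

Lemma cint_restr D f : measurable D ->
  (cintegrable mu D f <-> cintegrable mu setT (crestr D f)) /\
  cint mu D f = cint mu setT (crestr D f).
Proof.
move=> mD.
have eR : (fun x => complex.Re (crestr D f x)) = (fun x => complex.Re (f x)) \_ D.
  apply/funext => x; rewrite /crestr ReM patchE indicE /= mul0r subr0.
  by case: (x \in D); rewrite ?mul1r ?mul0r.
have eI : (fun x => complex.Im (crestr D f x)) = (fun x => complex.Im (f x)) \_ D.
  apply/funext => x; rewrite /crestr ImM patchE indicE /= mul0r addr0.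
  by case: (x \in D); rewrite ?mul1r ?mul0r.
split; last first.
  rewrite /cint Rintegral_mkcond [X in _ +i* X]Rintegral_mkcond.
  by rewrite -eR -eI.
have eR' : (fun x => (complex.Re (crestr D f x))%:E) =
    (fun x => (complex.Re (f x))%:E) \_ D.
  apply/funext => x; move: (congr1 (fun g => (g x)%:E) eR) => /= ->.
  by rewrite !patchE; case: ifP.
have eI' : (fun x => (complex.Im (crestr D f x))%:E) =
    (fun x => (complex.Im (f x))%:E) \_ D.
  apply/funext => x; move: (congr1 (fun g => (g x)%:E) eI) => /= ->.
  by rewrite !patchE; case: ifP.
rewrite /cintegrable eR' eI'.
by split=> -[a b]; split; move: a b; rewrite -?integrable_mkcond.
Qed.

Lemma eq_cint D f g : measurable D -> (forall x, D x -> f x = g x) ->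
  (cintegrable mu D f <-> cintegrable mu D g) /\ cint mu D f = cint mu D g.
Proof.
move=> mD fg; have [e1 e2] := cint_restr f mD; have [e3 e4] := cint_restr g mD.
suff e : crestr D f = crestr D g by rewrite e2 e4 e1 e3 e.
apply/funext => x; rewrite /crestr indicE.
by have [/set_mem/fg ->//|] := boolP (x \in D); rewrite !mul0r.
Qed.

Lemma cintegrable_finite f (M : R) : (mu setT < +oo)%E -> cmeas f ->
  (forall x, cabs (f x) <= M) -> cintegrable mu setT f.
Proof.
move=> muT mf fM; apply: (cintegrable_le mf fM).
apply: (@measurable_bounded_integrable _ _ _ mu (fun=> M) setT) => //.
by exists `|M|; split=> [|x Mx y _ /=]; [exact: num_real|exact: ltW].
Qed.

Lemma integrable_indic_fin D : measurable D -> (mu D < +oo)%E ->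
  mu.-integrable setT (fun x => (\1_D x : R)%:E).
Proof.
move=> mD Dfin; apply/integrableP; split.
  by apply/measurable_EFinP; exact: measurable_indic.
rewrite (eq_integral (fun x => (\1_D x)%:E)); last first.
  by move=> t _; rewrite gee0_abs// lee_fin.
by rewrite integral_indic// setIT.
Qed.

Lemma cintegrable_indic D : measurable D -> (mu D < +oo)%E ->
  cintegrable mu setT (fun x => (\1_D x : R)%:C).
Proof.
by move=> mD Dfin; split; [exact: integrable_indic_fin|exact: integrable0].
Qed.

Lemma cabs_cint f : cintegrable mu setT f ->
  cabs (cint mu setT f) <= \int[mu]_(x in setT) cabs (f x).
Proof.
move=> fi; have [_ ai] := (cintegrableP _ _).1 fi.
have [i1 i2] := fi.
rewrite /cabs RintegralD//; [|exact: integrable_norm i1|exact: integrable_norm i2].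
by rewrite lerD//; apply: le_normr_Rintegral.
Qed.

End ComplexDomain.

(** * The Poisson kernel on the line *)

Section Calculus.
Variable R : realType.
Local Notation mu := (@lebesgue_measure R).
Implicit Types (f g F : R -> R) (x a b k : R).

Lemma dvD f g x a b : is_derive x 1 f a -> is_derive x 1 g b ->
  is_derive x 1 (fun y => f y + g y) (a + b).
Proof. exact: is_deriveD. Qed.

Lemma dvM f g x a b : is_derive x 1 f a -> is_derive x 1 g b ->
  is_derive x 1 (fun y => f y * g y) (a * g x + f x * b).
Proof.
move=> df dg; apply: is_derive_eq (is_deriveM df dg) _.
by rewrite /GRing.scale /= addrC mulrC.
Qed.

Lemma dvZ f x a k : is_derive x 1 f a -> is_derive x 1 (fun y => k * f y) (k * a).
Proof. by move=> df; exact: is_deriveZ. Qed.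

Lemma dvN f x a : is_derive x 1 f a -> is_derive x 1 (fun y => - f y) (- a).
Proof. exact: is_deriveN. Qed.

Lemma dv_comp f g x a b : is_derive (g x) 1 f a -> is_derive x 1 g b ->
  is_derive x 1 (fun y => f (g y)) (a * b).
Proof.
by move=> df dg; apply: is_derive_eq (is_derive1_comp df dg) _; rewrite mulrC.
Qed.

Lemma dv_lin (k x : R) : is_derive x 1 (fun y => k * y) k.
Proof. by apply: is_derive_eq (dvZ k (is_derive_id x (1 : R))) _; rewrite mulr1. Qed.

Lemma dv_cst (k x : R) : is_derive x 1 (fun=> k) 0.
Proof. exact: is_derive_cst. Qed.

Lemma ctD f g : continuous f -> continuous g -> continuous (fun x => f x + g x).
Proof. by move=> cf cg x; apply: cvgD; [exact: cf|exact: cg]. Qed.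

Lemma ctM f g : continuous f -> continuous g -> continuous (fun x => f x * g x).
Proof. by move=> cf cg x; apply: cvgM; [exact: cf|exact: cg]. Qed.

Lemma ctN f : continuous f -> continuous (fun x => - f x).
Proof. by move=> cf x; apply: cvgN; exact: cf. Qed.

Lemma ctZ f k : continuous f -> continuous (fun x => k * f x).
Proof. by move=> cf; apply: ctM => // x; exact: cvg_cst. Qed.

Lemma ct_comp f g : continuous f -> continuous g -> continuous (fun x => f (g x)).
Proof. by move=> cf cg x; apply: continuous_comp; [exact: cg|exact: cf]. Qed.

Lemma ct_cst k : continuous (fun _ : R => k).
Proof. by move=> x; exact: cvg_cst. Qed.

Lemma ct_id : continuous (fun x : R => x).
Proof. by move=> x; exact: cvg_id. Qed.

Lemma dv_continuous F f : (forall x, is_derive x 1 F (f x)) -> continuous F.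
Proof.
move=> dF x; apply: differentiable_continuous.
by apply/derivable1_diffP; exact: (@ex_derive _ _ _ _ _ _ _ (dF x)).
Qed.

Lemma ftc_half_line f F (a l : R) : (forall x, a <= x -> 0 <= f x) ->
  continuous f -> (forall x, is_derive x 1 F (f x)) ->
  F x @[x --> +oo%R] --> l ->
  (\int[mu]_(x in `[a, +oo[) (f x)%:E = (l - F a)%:E)%E.
Proof.
move=> f0 cf dF Fl; rewrite (ge0_continuous_FTC2y f0 _ Fl).
- by rewrite EFinB.
- exact: continuous_subspaceT.
- by move=> x _; exact: (@ex_derive _ _ _ _ _ _ _ (dF x)).
- by apply: cvg_at_right_filter; exact: (dv_continuous dF).
- by move=> x _; rewrite derive1E; exact: (@derive_val _ _ _ _ _ _ _ (dF x)).
Qed.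

Lemma ftc_segment f F (a b : R) : a < b -> continuous f ->
  (forall x, is_derive x 1 F (f x)) ->
  (\int[mu]_(x in `[a, b]) (f x)%:E = (F b - F a)%:E)%E.
Proof.
move=> ab cf dF; rewrite (continuous_FTC2 (F := F) ab).
- by rewrite EFinB.
- exact: continuous_subspaceT.
- split.
  + by move=> x _; exact: (@ex_derive _ _ _ _ _ _ _ (dF x)).
  + by apply: cvg_at_right_filter; exact: (dv_continuous dF).
  + by apply: cvg_at_left_filter; exact: (dv_continuous dF).
- by move=> x _; rewrite derive1E; exact: (@derive_val _ _ _ _ _ _ _ (dF x)).
Qed.

Lemma expR_decay (e : R) : 0 < e -> expR (- (e * x)) @[x --> +oo%R] --> (0 : R).
Proof.
move=> e0; apply: (cvg_comp (fun x => e * x) (fun x => expR (- x))).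
  by apply: gt0_cvgMry => //; exact: cvg_id.
exact: cvgr_expR.
Qed.

Lemma even_integral f : (forall x, 0 <= f x) -> continuous f ->
  (forall x, f (- x) = f x) ->
  (\int[mu]_x (f x)%:E = 2%:E * \int[mu]_(x in `[0%R, +oo[) (f x)%:E)%E.
Proof.
move=> f0 cf ef; rewrite ge0_symfun_integralT//; last by move=> x /=; rewrite ef.
by rewrite set_itvcy.
Qed.

Variables (e s : R).
Hypothesis e0 : 0 < e.

Let f x := expR (- (e * `|x|)) * (1 + cos (s * x)).
Let F x := - (e^-1 * expR (- (e * x))) +
  (e ^+ 2 + s ^+ 2)^-1 *
    (expR (- (e * x)) * (s * sin (s * x) + - (e * cos (s * x)))).

Let es0 : e ^+ 2 + s ^+ 2 != 0.
Proof. by rewrite gt_eqF// ltr_pwDl ?exprn_gt0 ?sqr_ge0. Qed.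

Let dF x : is_derive x 1 F (expR (- (e * x)) * (1 + cos (s * x))).
Proof.
have dE : is_derive x 1 (fun y => expR (- (e * y))) (- e * expR (- (e * x))).
  have h : is_derive x 1 (fun y => - (e * y)) (- e).
    under eq_fun do rewrite -mulNr.
    exact: dv_lin.
  by rewrite mulrC; apply: dv_comp h; exact: is_derive_expR.
have dS : is_derive x 1 (fun y => sin (s * y)) (cos (s * x) * s).
  by apply: dv_comp (dv_lin s x); exact: is_derive_sin.
have dC : is_derive x 1 (fun y => cos (s * y)) (- sin (s * x) * s).
  by apply: dv_comp (dv_lin s x); exact: is_derive_cos.
have := dvD (dvN (dvZ e^-1 dE)) (dvZ (e ^+ 2 + s ^+ 2)^-1
  (dvM dE (dvD (dvZ s dS) (dvN (dvZ e dC))))).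
move=> /is_derive_eq; apply.
by move=> /=; field; rewrite es0 gt_eqF.
Qed.

Let cf : continuous f.
Proof.
apply: ctM.
  apply: (ct_comp (@continuous_expR R)); apply: ctN; apply: ctZ.
  exact: norm_continuous.
apply: ctD; first exact: ct_cst.
by apply: (ct_comp (@continuous_cos R)); apply: ctZ; exact: ct_id.
Qed.

Let f0 x : 0 <= f x.
Proof.
apply: mulr_ge0; first exact: expR_ge0.
have := cos_geN1 (s * x); lra.
Qed.

Let Fy : F x @[x --> +oo%R] --> (0 : R).
Proof.
have E0 := expR_decay e0.
rewrite [X in _ --> X](_ : 0 = - (e^-1 * 0) + (e ^+ 2 + s ^+ 2)^-1 * 0); last first.
  by rewrite !mulr0 oppr0 addr0.
apply: cvgD; first by apply: cvgN; apply: cvgM; [exact: cvg_cst|exact: E0].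
apply: cvgM; [exact: cvg_cst|apply/norm_cvg0P].
apply: (@squeeze_cvgr _ _ _ _ (fun=> 0) (fun x => expR (- (e * x)) * (`|s| + e))).
- apply: nearW => x; rewrite normr_ge0 /= normrM (ger0_norm (expR_ge0 _)).
  rewrite ler_wpM2l ?expR_ge0//.
  apply: le_trans (ler_normD _ _) _; rewrite normrN !normrM (gtr0_norm e0).
  apply: lerD.
    by rewrite ler_piMr// ler_norml sin_geN1 sin_le1.
  by rewrite ler_piMr ?(ltW e0)// ler_norml cos_geN1 cos_le1.
- exact: cvg_cst.
- rewrite -[X in _ --> X](mul0r (`|s| + e)).
  by apply: cvgM; [exact: E0|exact: cvg_cst].
Qed.

(** The 1 makes the integrand nonnegative, as the fundamental theorem of calculus
    on a half-line requires. *)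
Lemma integral_exp_cos1 : (\int[mu]_x
    (expR (- (e * `|x|)) * (1 + cos (s * x)))%:E =
  (2 * (e^-1 + e / (e ^+ 2 + s ^+ 2)))%:E)%E.
Proof.
rewrite even_integral//; last by move=> x; rewrite /f normrN mulrN cosN.
rewrite (_ : (\int[mu]_(x in _) _ = \int[mu]_(x in `[0%R, +oo[)
    (expR (- (e * x)) * (1 + cos (s * x)))%:E)%E); last first.
  apply: eq_integral => x; rewrite inE/= in_itv/= andbT => x0.
  by rewrite ger0_norm.
rewrite (ftc_half_line _ _ dF Fy).
- rewrite -EFinM /F !mulr0 oppr0 expR0 sin0 cos0 !mulr1 mulr0 mul1r add0r.
  by congr EFin; field; rewrite es0 gt_eqF.
- move=> x x0; apply: mulr_ge0; first exact: expR_ge0.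
  have := cos_geN1 (s * x); lra.
- apply: ctM.
    by apply: (ct_comp (@continuous_expR R)); apply: ctN; apply: ctZ; exact: ct_id.
  apply: ctD; first exact: ct_cst.
  by apply: (ct_comp (@continuous_cos R)); apply: ctZ; exact: ct_id.
Qed.

End Calculus.

Section PoissonKernel.
Variable R : realType.
Local Notation mu := (@lebesgue_measure R).

Lemma poisson_integrable (e : R) : 0 < e ->
  mu.-integrable setT (fun y => (expR (- (e * `|y|)))%:E) /\
  \int[mu]_y expR (- (e * `|y|)) = 2 / e.
Proof.
move=> e0.
have mE : measurable_fun setT (fun y : R => expR (- (e * `|y|))).
  apply: continuous_measurable_fun.
  apply: (ct_comp (@continuous_expR R)); apply: ctN; apply: ctZ.
  exact: norm_continuous.
have E : (\int[mu]_y (expR (- (e * `|y|)))%:E = (2 / e)%:E)%E.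
  rewrite (_ : 2 / e = 2^-1 * (2 * (e^-1 + e / (e ^+ 2 + 0 ^+ 2)))); last first.
    by field; rewrite gt_eqF.
  rewrite EFinM -integral_exp_cos1// -ge0_integralZl//=.
  - by apply: eq_integral => y _; rewrite -EFinM mul0r cos0; congr EFin; field.
  - apply/measurable_EFinP; apply: measurable_funM => //.
    by under eq_fun do rewrite mul0r; exact: measurable_cst.
split; last by rewrite /Rintegral E.
apply/integrableP; split; first exact/measurable_EFinP.
rewrite (_ : (fun y => `|_|%E) = fun y => (expR (- (e * `|y|)))%:E); last first.
  by apply/funext => y /=; rewrite ger0_norm ?expR_ge0.
by rewrite E ltry.
Qed.

Lemma odd_Rintegral (f : R -> R) : mu.-integrable setT (EFin \o f) ->
  (forall x, f (- x) = - f x) -> \int[mu]_x f x = 0.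
Proof.
move=> fi fo.
have mf := measurable_int _ fi.
have tr (A : set (measurableTypeR R)) : measurable A -> mu (-%R @^-1` A) = mu A.
  exact: lebesgue_measureN.
have fi' : mu.-integrable setT ((EFin \o f) \o -%R).
  apply/(@integrable_transfer R _ _ (measurableTypeR R) (measurableTypeR R) mu mu
    _ (@oppr_measurable R setT) tr) => //.
have := @integral_transfer R _ _ (measurableTypeR R) (measurableTypeR R) mu mu
    _ (@oppr_measurable R setT) tr _ mf fi'.
rewrite (_ : (\int[mu]_x (EFin \o f) (- x)%R)%E =
    (\int[mu]_x ((-1)%:E * (f x)%:E))%E); last first.
  by apply: eq_integral => x _; rewrite /= fo EFinN mulN1e.
rewrite integralZl// => /(congr1 fine).
rewrite fineM//; last exact: integrable_fin_num.
by rewrite -/(Rintegral mu setT f) /= mulN1r => /eqP; rewrite eqNr => /eqP.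
Qed.

(** The Fourier pair behind inversion: exp (- e |y|) and 2 e / (e^2 + s^2).  It plays the
    part usually given to Gaussians because its primitive is an arctangent. *)
Lemma poisson_fourier (e s : R) : 0 < e ->
  cintegrable mu setT (fun y => (expR (- (e * `|y|)))%:C * expi (s * y)) /\
  cint mu setT (fun y => (expR (- (e * `|y|)))%:C * expi (s * y)) =
    (2 * (e / (e ^+ 2 + s ^+ 2)))%:C.
Proof.
move=> e0; have [Ei E] := poisson_integrable e0.
have EL1 : cintegrable mu setT (fun y => (expR (- (e * `|y|)))%:C).
  by split => //=; exact: integrable0.
have me : cmeas (fun y : measurableTypeR R => expi (s * y)).
  by apply: cmeas_expi; apply: continuous_measurable_fun; apply: ctZ; exact: ct_id.
have L1 := cintegrableM_bounded EL1 me (fun y => cabs_expi _).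
split=> //; have [L1r L1i] := L1.
have eR y : complex.Re ((expR (- (e * `|y|)))%:C * expi (s * y)) =
    expR (- (e * `|y|)) * cos (s * y) by rewrite ReM /= mul0r subr0.
have eI y : complex.Im ((expR (- (e * `|y|)))%:C * expi (s * y)) =
    expR (- (e * `|y|)) * sin (s * y) by rewrite ImM /= mul0r addr0.
have {}L1r : mu.-integrable setT
    (fun y => (expR (- (e * `|y|)) * cos (s * y))%:E).
  by apply: eq_integrable L1r => // y _; rewrite eR.
have {}L1i : mu.-integrable setT
    (fun y => (expR (- (e * `|y|)) * sin (s * y))%:E).
  by apply: eq_integrable L1i => // y _; rewrite eI.
apply: complex_ext; rewrite ?Re_cint ?Im_cint.
  under eq_Rintegral do rewrite eR.
  have : \int[mu]_y (expR (- (e * `|y|)) + expR (- (e * `|y|)) * cos (s * y)) =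
      2 * (e^-1 + e / (e ^+ 2 + s ^+ 2)).
    rewrite /Rintegral (_ : (\int[mu]_x _)%E =
      (2 * (e^-1 + e / (e ^+ 2 + s ^+ 2)))%:E)//.
    rewrite -integral_exp_cos1//; apply: eq_integral => y _.
    by rewrite mulrDr mulr1.
  rewrite RintegralD// E; set I := (X in _ + X); set J := e / _ => h.
  by apply: (@addrI _ (2 / e)); rewrite h /=; ring.
under eq_Rintegral do rewrite eI.
apply: odd_Rintegral => // y.
by rewrite normrN mulrN sinN mulrN.
Qed.

End PoissonKernel.

Section SoftIndicator.
Variable R : realType.
Local Notation mu := (@lebesgue_measure R).
Implicit Types (a b x y : R) (n : nat).

(** The multiplier e^{- t |y|} with t = (n+1)^-2, whose transform is a Poisson
    kernel of width t.  The factor e^{i y / (n+1)} shifts this kernel by 1 / (n+1),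
    a distance that is large compared with its width. *)
Definition pkern n y : R[i] :=
  ((2 * pi)^-1 * expR (- (n.+1%:R ^- 2 * `|y|)))%:C * expi (n.+1%:R^-1 * y).

Definition window a b y : R[i] :=
  cint mu setT (fun u => (\1_(`]a, b]) u : R)%:C * expi (u * y)).

(** The integral over ]a, b] of the shifted Poisson kernel centred at x. *)
Definition soft n a b x : R := pi^-1 *
  (atan (n.+1%:R ^+ 2 * (b - x) + n.+1%:R) -
   atan (n.+1%:R ^+ 2 * (a - x) + n.+1%:R)).

Lemma cintegrable_itv a b :
  cintegrable mu setT (fun u => (\1_(`]a, b]) u : R)%:C).
Proof.
split => /=; last exact: integrable0.
exact: integrable_indic_itv.
Qed.

Lemma cmeas_window a b : cmeas (window a b : measurableTypeR R -> _).
Proof.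
pose f (z : measurableTypeR R * measurableTypeR R) : R[i] :=
  (\1_(`]a, b]) z.2 : R)%:C * expi (z.2 * z.1).
apply: (@cmeas_cint R _ _ _ _ mu f); apply: cmeasM.
  apply: cmeas_real.
  have mi : measurable_fun setT (\1_(`]a, b]) : measurableTypeR R -> R).
    exact: measurable_indic.
  exact: (measurableT_comp mi measurable_snd).
by apply: cmeas_expi; apply: measurable_funM.
Qed.

Lemma window_bound a b y : a < b -> cabs (window a b y) <= 2 * (b - a).
Proof.
move=> ab; have me : cmeas (fun u : measurableTypeR R => expi (u * y)).
  by apply: cmeas_expi; apply: measurable_funM.
have Li := cintegrableM_bounded (cintegrable_itv a b) me (fun u => cabs_expi _).
apply: le_trans (cabs_cint Li) _.
have Ii : mu.-integrable setT (EFin \o \1_(`]a, b])).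
  exact: integrable_indic_itv.
have -> : 2 * (b - a) = \int[mu]_u (2 * \1_(`]a, b]) u).
  rewrite RintegralZl// /Rintegral integral_indic// setIT.
  congr (_ * _); have /= := lebesgue_measure_itv `]a, b].
  by rewrite lte_fin ab => /(congr1 fine)/esym.
apply: le_Rintegral => //.
- by have [] := (cintegrableP _ _).1 Li.
- exact: (integrableZl measurableT 2 Ii).
- move=> u _; apply: le_trans (cabsM _ _) _.
  rewrite cabs_real ger0_norm// mulrC.
  by rewrite ler_wpM2r// cabs_expi.
Qed.

Lemma pkern_integrable n : cintegrable mu setT (pkern n).
Proof.
have N0 : 0 < n.+1%:R ^- 2 :> R by rewrite invr_gt0 exprn_gt0// ltr0n.
have [Ei _] := poisson_integrable N0.
apply: (@cintegrableM_bounded _ _ _ _ _ _ 2) => [||y].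
- split => /=; last exact: integrable0.
  exact: (integrableZl measurableT _ Ei).
- by apply: cmeas_expi; apply: measurable_funM.
- exact: cabs_expi.
Qed.

Lemma pkern_bound n y : cabs (pkern n y) <= pi^-1.
Proof.
apply: le_trans (cabsM _ _) _; rewrite cabs_real.
have pi0 := pi_gt0 R.
rewrite ger0_norm; last by rewrite mulr_ge0 ?expR_ge0// invr_ge0 mulr_ge0// ltW.
have pi_half (p : R) : 0 < p -> p^-1 = (2 * p)^-1 * 1 * 2.
  by move=> p0; field; rewrite gt_eqF.
rewrite (pi_half _ pi0).
have p0 : 0 <= (2 * pi : R)^-1 by rewrite invr_ge0 mulr_ge0// ltW.
apply: ler_pM; rewrite ?mulr_ge0 ?expR_ge0 ?cabs_ge0 ?cabs_expi//.
rewrite ler_wpM2l// -expR0 ler_expR oppr_le0 mulr_ge0// invr_ge0 exprn_ge0//.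
Qed.

Lemma inv_succ_cvg0 : (fun n => n.+1%:R^-1 : R) @ \oo --> (0 : R).
Proof. exact: cvg_harmonic. Qed.

Lemma pkern_cvg y : ccvg (pkern ^~ y) ((2 * pi)^-1)%:C.
Proof.
have h1 : (fun n => expR (- (n.+1%:R ^- 2 * `|y|)) : R) @ \oo --> (1 : R).
  rewrite -[X in _ --> X]expR0; apply: continuous_cvg; first exact: continuous_expR.
  rewrite -[X in _ --> X]oppr0; apply: cvgN; rewrite -[X in _ --> X](mul0r `|y|).
  apply: cvgM; last exact: cvg_cst.
  have -> : (fun n => n.+1%:R ^- 2 : R) = (fun n => n.+1%:R^-1 * n.+1%:R^-1).
    by apply/funext => n; rewrite -exprVn expr2.
  by rewrite -[X in _ --> X](mulr0 0); apply: cvgM; exact: inv_succ_cvg0.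
have h2 : (fun n => n.+1%:R^-1 * y : R) @ \oo --> (0 : R).
  rewrite -[X in _ --> X](mul0r y); apply: cvgM; [exact: inv_succ_cvg0|exact: cvg_cst].
rewrite -[X in ccvg _ X]mulr1 -expi0; apply: ccvgM.
  split => /=; last exact: cvg_cst.
  rewrite -[X in _ --> X]mulr1; apply: cvgM; [exact: cvg_cst|exact: h1].
split => /=; apply: continuous_cvg => //.
  exact: continuous_cos.
exact: continuous_sin.
Qed.

Lemma soft_bound n a b x : `|soft n a b x| <= 1.
Proof.
have pi0 := pi_gt0 R; rewrite /soft normrM gtr0_norm ?invr_gt0//.
rewrite ler_pdivrMl// mulr1.
set u := atan _; set v := atan _.
have [u1 u2 v1 v2] : [/\ - (pi / 2) < u, u < pi / 2, - (pi / 2) < v & v < pi / 2].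
  by rewrite !atan_gtNpi2 !atan_ltpi2.
rewrite ler_norml; apply/andP; split; lra.
Qed.

(** The arguments of the arctangents are shifted by n+1 so that they tend to
    +oo also when they start from 0: the limit is then the indicator of the
    half-open interval at every point, with no exception at the endpoints. *)
Lemma atan_shift_cvg (c : R) :
  (fun n => atan (n.+1%:R ^+ 2 * c + n.+1%:R) : R) @ \oo -->
  (if 0 <= c then pi / 2 else - (pi / 2)).
Proof.
have ny (A : R) : \forall n \near \oo, A <= n.+1%:R.
  have /cvgryPge/(_ A) := @cvgr_idn R.
  by apply: filterS => n /le_trans; apply; rewrite ler_nat.
case: ifPn => [c0|].
  have h : (fun n => n.+1%:R ^+ 2 * c + n.+1%:R : R) @ \oo --> +oo%R.
    apply/cvgryPge => A; apply: filterS (ny A) => n /le_trans; apply.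
    by rewrite lerDr mulr_ge0// sqr_ge0.
  exact: (cvg_comp _ _ h (@cvgy_atan R)).
rewrite -ltNge => c0.
have h : (fun n => - (n.+1%:R ^+ 2 * c + n.+1%:R) : R) @ \oo --> +oo%R.
  apply/cvgryPge => A; apply: filterS (ny ((`|A| + 1) / - c)) => n.
  rewrite ler_pdivrMr ?oppr_gt0// => An.
  have n1 : 1 <= n.+1%:R :> R by rewrite ler1n.
  have -> : - (n.+1%:R ^+ 2 * c + n.+1%:R) = n.+1%:R * (n.+1%:R * - c - 1) by ring.
  apply: le_trans (ler_norm A) _; apply: (@le_trans _ _ (n.+1%:R * - c - 1)); first lra.
  by rewrite ler_peMl//; have := normr_ge0 A; lra.
rewrite -[X in _ --> X]opprK.
rewrite (_ : (fun n => _) = (fun n => - atan (- (n.+1%:R ^+ 2 * c + n.+1%:R)))).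
  rewrite opprK; apply: cvgN.
  exact: (cvg_comp _ _ h (@cvgy_atan R)).
by apply/funext => n; rewrite atanN opprK.
Qed.

Lemma soft_cvg a b x : a < b ->
  (fun n => soft n a b x) @ \oo --> (\1_(`]a, b]) x : R).
Proof.
move=> ab; rewrite /soft.
have -> : (\1_(`]a, b]) x : R) = pi^-1 *
    ((if 0 <= b - x then pi / 2 else - (pi / 2)) -
     (if 0 <= a - x then pi / 2 else - (pi / 2))).
  have : pi != 0 :> R by rewrite gt_eqF// pi_gt0.
  rewrite indicE mem_setE in_itv /= !subr_ge0.
  move: (pi : R) => p p0.
  case: (ltP a x) => ax; case: (leP x b) => xb /=; try by field.
  by move: (lt_le_trans xb ax); lra.
apply: cvgM; first exact: cvg_cst.
by apply: cvgB; exact: atan_shift_cvg.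
Qed.

Lemma pkern_fourier n s : cint mu setT (fun y => pkern n y * expi (s * y)) =
  (pi^-1 * (n.+1%:R ^+ 2 / (1 + (n.+1%:R ^+ 2 * s + n.+1%:R) ^+ 2)))%:C.
Proof.
have N0 : 0 < n.+1%:R ^- 2 :> R by rewrite invr_gt0 exprn_gt0// ltr0n.
have [Pi P] := poisson_fourier (s + n.+1%:R^-1) N0.
have pi0 : (pi : R) != 0 by rewrite gt_eqF// pi_gt0.
have n0 : n.+1%:R != 0 :> R by rewrite pnatr_eq0.
transitivity (((2 * pi)^-1)%:C * cint mu setT (fun y =>
    (expR (- (n.+1%:R ^- 2 * `|y|)))%:C * expi ((s + n.+1%:R^-1) * y)) : R[i]).
  rewrite -cintZ//; congr cint; apply/funext => y.
  rewrite /pkern rmorphM -!mulrA; congr (_ * (_ * _)).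
  by rewrite -expiD; congr expi; ring.
rewrite P -rmorphM; congr (_%:C).
have p1 : 1 + (n.+1%:R ^+ 2 * s + n.+1%:R) ^+ 2 != 0 :> R.
  by rewrite gt_eqF// ltr_pwDl// sqr_ge0.
have p2 : n.+1%:R ^- 2 ^+ 2 + (s + n.+1%:R^-1) ^+ 2 != 0 :> R.
  by rewrite gt_eqF// ltr_pwDl ?sqr_ge0// exprn_gt0.
move: (pi : R) pi0 (n.+1%:R : R) n0 p1 p2 => p p0 N n0 p1 p2.
have e : N ^- 2 ^+ 2 + (s + N^-1) ^+ 2 =
    (1 + (N ^+ 2 * s + N) ^+ 2) / N ^+ 4 by field.
by rewrite e; field; rewrite p0 n0 p1.
Qed.

Lemma soft_derive n x (u : R) :
  is_derive u 1 (fun u => pi^-1 * atan (n.+1%:R ^+ 2 * (u - x) + n.+1%:R))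
    (pi^-1 * (n.+1%:R ^+ 2 / (1 + (n.+1%:R ^+ 2 * (u - x) + n.+1%:R) ^+ 2))).
Proof.
apply: dvZ; set N := n.+1%:R.
rewrite [X in is_derive _ _ _ X]mulrC.
apply: (@dv_comp R atan (fun v => N ^+ 2 * (v - x) + N) u).
have := dvD (dvZ (N ^+ 2) (dvD (is_derive_id u (1 : R)) (dv_cst (- x) u))) (dv_cst N u).
by move=> /is_derive_eq; apply; rewrite !addr0 mulr1.
Qed.

Lemma one_sqr_neq0 (s : R) : 1 + s ^+ 2 != 0.
Proof. by rewrite gt_eqF// ltr_pwDl// sqr_ge0. Qed.

(** By Fubini, a product of transforms is the transform of a convolution; the
    primitive of the Poisson kernel is an arctangent. *)
Lemma soft_fourier n a b x : a < b ->
  cintegrable mu setT (fun y => pkern n y * window a b y * expi (- (x * y))) /\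
  cint mu setT (fun y => pkern n y * window a b y * expi (- (x * y))) =
    (soft n a b x)%:C.
Proof.
move=> ab.
have mw : cmeas (fun y : measurableTypeR R => expi (- (x * y))).
  by apply: cmeas_expi; apply: measurable_funN; apply: measurable_funM.
have L1 := cintegrableM_bounded (cintegrableM_bounded (pkern_integrable n)
  (cmeas_window a b) (fun y => window_bound y ab)) mw (fun y => cabs_expi _).
split=> //.
pose h (z : measurableTypeR R * measurableTypeR R) : R[i] := expi ((z.1 - x) * z.2).
have mh : cmeas h.
  by apply: cmeas_expi; apply: measurable_funM => //; apply: measurable_funB.
have := cintegrable_tensor (cintegrable_itv a b) (pkern_integrable n) mh
  (fun z => cabs_expi _).
move=> /cint_fubini[_ _ <-] /= E2.
transitivity (cint mu setT (fun y => cint mu setT (fun u =>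
   (\1_(`]a, b]) u : R)%:C * pkern n y * h (u, y)))).
  congr cint; apply/funext => y; rewrite mulrAC /window -cintZ.
    congr cint; apply/funext => u.
    rewrite /h /= mulrBl expiD; ring.
  have me : cmeas (fun u : measurableTypeR R => expi (u * y)).
    by apply: cmeas_expi; apply: measurable_funM.
  exact: cintegrableM_bounded (cintegrable_itv a b) me (fun u => cabs_expi _).
rewrite E2.
transitivity (cint mu setT (crestr `]a, b] (fun u =>
    (pi^-1 * (n.+1%:R ^+ 2 / (1 + (n.+1%:R ^+ 2 * (u - x) + n.+1%:R) ^+ 2)))%:C))).
  congr cint; apply/funext => u; rewrite /crestr -pkern_fourier -cintZ.
    by congr cint; apply/funext => y; rewrite mulrA.
  have me : cmeas (fun y : measurableTypeR R => expi ((u - x) * y)).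
    by apply: cmeas_expi; apply: measurable_funM.
  exact: cintegrableM_bounded (pkern_integrable n) me (fun u => cabs_expi _).
rewrite -(cint_restr mu _ (measurable_itv `]a, b])).2.
apply: complex_ext; rewrite ?Re_cint ?Im_cint /=; last first.
  by rewrite /Rintegral integral0_eq.
have cf : continuous (fun u : R => pi^-1 * (n.+1%:R ^+ 2 /
    (1 + (n.+1%:R ^+ 2 * (u - x) + n.+1%:R) ^+ 2))).
  apply: ctZ; apply: ctZ => u.
  apply: cvgV; first exact: one_sqr_neq0.
  apply: cvgD; first exact: cvg_cst.
  have cg : continuous (fun v : R => n.+1%:R ^+ 2 * (v - x) + n.+1%:R).
    apply: ctD; last exact: ct_cst.
    by apply: ctZ; apply: ctD; [exact: ct_id|exact: ct_cst].
  by apply: cvgM; exact: (cg u).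
rewrite /Rintegral integral_itv_obnd_cbnd; last first.
  apply/measurable_EFinP; apply: measurable_funTS.
  exact: continuous_measurable_fun.
rewrite (ftc_segment ab cf (soft_derive n x)).
by rewrite /= /soft -mulrBr.
Qed.

End SoftIndicator.

(** * Lebesgue measure on R^3 and Fourier inversion *)

Section ProductSigmaFinite.
Context {R : realType} d1 d2 {T1 : measurableType d1} {T2 : measurableType d2}.
Variables (m1 : {sigma_finite_measure set T1 -> \bar R})
  (m2 : {sigma_finite_measure set T2 -> \bar R}).

Lemma prod_sigma_finite : sigma_finite setT (m1 \x m2)%E.
Proof.
have /sigma_finiteP[F [FT ndF Ffin]] := sigma_finiteT m1.
have /sigma_finiteP[G [GT ndG Gfin]] := sigma_finiteT m2.
exists (fun n => F n `*` G n) => [|n].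
  apply/seteqP; split=> // -[x y] _.
  have : setT x by []. rewrite FT => -[i _ Fx].
  have : setT y by []. rewrite GT => -[j _ Gy].
  exists (maxn i j) => //; split.
    exact: (subsetPset _ _ (ndF _ _ (leq_maxl i j))) Fx.
  exact: (subsetPset _ _ (ndG _ _ (leq_maxr i j))) Gy.
have [mF Fn] := Ffin n; have [mG Gn] := Gfin n.
split; first exact: measurableX.
by rewrite product_measure1E// lte_mul_pinfty// ge0_fin_numE.
Qed.

(** The product measure, together with the sigma-finiteness that Fubini's theorem
    needs at the next product. *)
Definition prod_sf : {sigma_finite_measure set (T1 * T2)%type -> \bar R} :=
  HB.pack_for (SigmaFiniteMeasure.type _ R) (m1 \x m2)%E
    (Measure_isSigmaFinite.Build _ _ _ (m1 \x m2)%E prod_sigma_finite).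

Lemma prod_sfE A B : measurable A -> measurable B ->
  prod_sf (A `*` B) = (m1 A * m2 B)%E.
Proof. exact: product_measure1E. Qed.

End ProductSigmaFinite.

(** Lebesgue measure on R^3, before any normalization. *)
Definition leb (R : realType) : {sigma_finite_measure set (R3 R) -> \bar R} :=
  prod_sf (prod_sf (@lebesgue_measure R) (@lebesgue_measure R))
    (@lebesgue_measure R).
Arguments leb R : simpl never.

Section Boxes.
Variable R : realType.
Local Notation M := (measurableTypeR R).
Implicit Types (a b x y : R3 R) (n : nat).

Lemma dot3E x y : dot3 x y = x.1.1 * y.1.1 + x.1.2 * y.1.2 + x.2 * y.2.
Proof. by rewrite /dot3 !big_ord_recl big_ord0 addr0 /col3 !mxE /= addrA. Qed.

Lemma dot3C x y : dot3 x y = dot3 y x.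
Proof. by rewrite !dot3E; ring. Qed.

Lemma measurable_x1 : measurable_fun setT (fun x : R3 R => x.1.1).
Proof. exact: (measurableT_comp measurable_fst measurable_fst). Qed.

Lemma measurable_x2 : measurable_fun setT (fun x : R3 R => x.1.2).
Proof. exact: (measurableT_comp measurable_snd measurable_fst). Qed.

Lemma measurable_x3 : measurable_fun setT (fun x : R3 R => x.2).
Proof. exact: measurable_snd. Qed.

Lemma measurable_R3 d (T : measurableType d) (f : T -> R3 R) :
  measurable_fun setT (fun t => (f t).1.1) ->
  measurable_fun setT (fun t => (f t).1.2) ->
  measurable_fun setT (fun t => (f t).2) -> measurable_fun setT f.
Proof.
move=> f1 f2 f3.
rewrite (_ : f = fun t => (((f t).1.1, (f t).1.2), (f t).2)); last first.
  by apply/funext => t; case: (f t) => -[].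
by apply: measurable_fun_pair => //; apply: measurable_fun_pair.
Qed.

Lemma measurable_dot3 d (T : measurableType d) (f g : T -> R3 R) :
  measurable_fun setT f -> measurable_fun setT g ->
  measurable_fun setT (fun t => dot3 (f t) (g t)).
Proof.
move=> mf mg; under eq_fun do rewrite dot3E.
by apply: measurable_funD; [apply: measurable_funD|]; apply: measurable_funM;
  do [exact: (measurableT_comp measurable_x1)|exact: (measurableT_comp measurable_x2)|
  exact: (measurableT_comp measurable_x3)].
Qed.

Definition box a b : set (R3 R) :=
  (`]a.1.1, b.1.1] `*` `]a.1.2, b.1.2]) `*` `]a.2, b.2].

Definition lt3 a b := [/\ a.1.1 < b.1.1, a.1.2 < b.1.2 & a.2 < b.2].

Definition boxes : set (set (R3 R)) := [set A | exists a b, A = box a b].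

Lemma measurable_box a b : measurable (box a b).
Proof. by apply: measurableX; [apply: measurableX|]; exact: measurable_itv. Qed.

Lemma boxI a b c e : exists f g, box a b `&` box c e = box f g.
Proof.
exists ((Num.max a.1.1 c.1.1, Num.max a.1.2 c.1.2), Num.max a.2 c.2).
exists ((Num.min b.1.1 e.1.1, Num.min b.1.2 e.1.2), Num.min b.2 e.2).
apply/seteqP; split=> [[[x y] z]|[[x y] z]]; rewrite /box /= !in_itv /=.
  move=> [[[/andP[? ?] /andP[? ?]] /andP[? ?]] [[/andP[? ?] /andP[? ?]] /andP[? ?]]].
  by rewrite !gt_max !le_min; split; [split|]; apply/andP; split; apply/andP.
rewrite !gt_max !le_min.
move=> [[/andP[/andP[? ?] /andP[? ?]] /andP[/andP[? ?] /andP[? ?]]]].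
move=> /andP[/andP[? ?] /andP[? ?]].
by split; split; try split; apply/andP.
Qed.

Definition cst3 (r : R) : R3 R := ((r, r), r).

Definition cube n := box (cst3 (- n%:R)) (cst3 n%:R).

Lemma mem_cube x n : (`|x.1.1| < n%:R) -> (`|x.1.2| < n%:R) -> (`|x.2| < n%:R) ->
  cube n x.
Proof.
rewrite !ltr_norml /cube /box /= !in_itv /=.
by move=> /andP[-> /ltW->] /andP[-> /ltW->] /andP[-> /ltW->].
Qed.

Lemma cube_cover : \bigcup_n cube n = setT.
Proof.
rewrite -subTset => x _.
have [n xn] : exists n, `|x.1.1| + `|x.1.2| + `|x.2| < n%:R.
  exists (Num.bound (`|x.1.1| + `|x.1.2| + `|x.2|)).
  by apply: archi_boundP; rewrite !addr_ge0.
have := normr_ge0 x.1.1; have := normr_ge0 x.1.2; have := normr_ge0 x.2.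
by move=> ? ? ?; exists n => //; apply: mem_cube; lra.
Qed.

Let S := g_sigma_algebraType boxes.

Let mS a b : @measurable _ S (box a b).
Proof. by apply: sub_sigma_algebra; exists a, b. Qed.

Let mproj (p : R3 R -> R) (lo hi : R -> nat -> R3 R) :
  (forall u v, p @^-1` `]u, v] = \bigcup_n box (lo u n) (hi v n)) ->
  measurable_fun setT (p : S -> M).
Proof.
move=> pE; apply: (@measurability _ _ S M setT p (R.-ocitv).-measurable) => //.
move=> _ [_ [[u v] _ <-] <-] /=; rewrite setTI pE.
by apply: bigcupT_measurable => n; exact: mS.
Qed.

Let mproj1 : measurable_fun setT ((fun x => x.1.1) : S -> M).
Proof.
apply: (mproj (lo := fun u n => ((u, - n%:R), - n%:R))
  (hi := fun u n => ((u, n%:R), n%:R))) => u v.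
apply/seteqP; split=> [[[x y] z]|[[x y] z]] /=.
  have : setT ((x, y), z) by []. rewrite -cube_cover => -[n _ [[? ?] ?] ?].
  by exists n.
by move=> [n _ [[? ?] ?]].
Qed.

Let mproj2 : measurable_fun setT ((fun x => x.1.2) : S -> M).
Proof.
apply: (mproj (lo := fun u n => ((- n%:R, u), - n%:R))
  (hi := fun u n => ((n%:R, u), n%:R))) => u v.
apply/seteqP; split=> [[[x y] z]|[[x y] z]] /=.
  have : setT ((x, y), z) by []. rewrite -cube_cover => -[n _ [[? ?] ?] ?].
  by exists n.
by move=> [n _ [[? ?] ?]].
Qed.

Let mproj3 : measurable_fun setT ((fun x => x.2) : S -> M).
Proof.
apply: (mproj (lo := fun u n => ((- n%:R, - n%:R), u))
  (hi := fun u n => ((n%:R, n%:R), u))) => u v.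
apply/seteqP; split=> [[[x y] z]|[[x y] z]] /=.
  have : setT ((x, y), z) by []. rewrite -cube_cover => -[n _ [[? ?] ?] ?].
  by exists n.
by move=> [n _ [[? ?] ?]].
Qed.

(** Half-spaces orthogonal to the axes are countable unions of boxes. *)
Lemma measurable_boxes : @measurable _ (R3 R) = <<s boxes >>.
Proof.
apply/seteqP; split; last first.
  apply: smallest_sub; first exact: sigma_algebra_measurable.
  by move=> _ [a [b ->]]; exact: measurable_box.
move=> A mA.
have mid : measurable_fun setT (id : S -> R3 R).
  by apply: measurable_R3; [exact: mproj1|exact: mproj2|exact: mproj3].
by have := mid measurableT A mA; rewrite setTI preimage_id.
Qed.

Lemma setI_closed_boxes : setI_closed boxes.
Proof. by move=> _ _ [a [b ->]] [c [e ->]]; exact: boxI. Qed.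

Lemma box_degenerate a b : ~ lt3 a b -> box a b = set0.
Proof.
move=> nab; apply/seteqP; split=> // -[[x y] z]; rewrite /box /= !in_itv /=.
move=> [[/andP[? ?] /andP[? ?]] /andP[? ?]]; apply: nab.
by split; [exact: (@lt_le_trans _ _ x)|exact: (@lt_le_trans _ _ y)|
  exact: (@lt_le_trans _ _ z)].
Qed.

(** Boxes are stable under intersection, generate the Borel sets and cover the
    space. *)
Lemma box_measure_unique (m1 m2 : {measure set (R3 R) -> \bar R}) :
  (forall a b, lt3 a b -> m1 (box a b) = m2 (box a b)) ->
  (forall n, (m1 (cube n) < +oo)%E) ->
  forall A, measurable A -> m1 A = m2 A.
Proof.
move=> e fin A mA.
apply: (@g_sigma_algebra_measure_unique _ _ _ boxes _ cube) => //.
- by move=> _ [a [b ->]]; exact: measurable_box.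
- by move=> n; exists (cst3 (- n%:R)), (cst3 n%:R).
- exact: cube_cover.
- exact: setI_closed_boxes.
- move=> _ [a [b ->]]; have [ab|/box_degenerate->] := pselect (lt3 a b).
    exact: e.
  by rewrite !measure0.
- by rewrite -measurable_boxes.
Qed.

Lemma leb_box a b : lt3 a b -> leb R (box a b) =
  ((b.1.1 - a.1.1) * (b.1.2 - a.1.2) * (b.2 - a.2))%:E.
Proof.
move=> [ab1 ab2 ab3]; rewrite /leb prod_sfE//; last by apply: measurableX; exact: measurable_itv.
rewrite prod_sfE// EFinM EFinM.
have itv (u v : R) : u < v -> @lebesgue_measure R `]u, v] = (v - u)%:E.
  by move=> uv; rewrite lebesgue_measure_itv /= lte_fin uv.
by congr (_ * _ * _)%E; exact: itv.
Qed.

Lemma leb_box_fin a b : (leb R (box a b) < +oo)%E.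
Proof.
have [ab|/box_degenerate->] := pselect (lt3 a b); last by rewrite measure0.
by rewrite leb_box// ltry.
Qed.

(** By Dynkin's theorem, the integral of h vanishes on every measurable subset of
    a cube. *)
Lemma box_ae0 (h : R3 R -> R) :
  (forall n, (leb R).-integrable (cube n) (EFin \o h)) ->
  (forall a b, lt3 a b -> (\int[leb R]_(x in box a b) (h x)%:E = 0)%E) ->
  {ae leb R, forall x, h x = 0}.
Proof.
move=> hi h0.
have hbox a b : (\int[leb R]_(x in box a b) (h x)%:E = 0)%E.
  have [ab|/box_degenerate->] := pselect (lt3 a b); first exact: h0.
  by rewrite integral_set0.
have mc n : measurable (cube n) by exact: measurable_box.
suff ae n : {ae leb R, forall x, cube n x -> (h x)%:E = 0%E}.
  apply: filterS (ae_foralln ae) => x hx.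
  have : setT x by []. rewrite -cube_cover => -[n _ cx].
  by have [] := hx n cx.
have : ae_eq (leb R) (cube n) (EFin \o h) (cst 0%E).
  apply: integral_ae_eq => //.
  move=> E En mE; rewrite integral0.
  suff P A : <<s boxes >> A -> (\int[leb R]_(x in A `&` cube n) (h x)%:E = 0)%E.
    by rewrite -(setIidl En) P// -measurable_boxes.
  have int_sub B : measurable B ->
      (leb R).-integrable (B `&` cube n) (EFin \o h).
    move=> mB; apply: (integrableS (mc n)) (hi n); first exact: measurableI.
    exact: subIsetr.
  apply: (dynkin_induction (P := fun A =>
      (\int[leb R]_(x in A `&` cube n) (h x)%:E = 0)%E) measurable_boxes
      setI_closed_boxes) => //.
  - by rewrite setTI hbox.
  - by move=> _ [a [b ->]]; have [f [g ->]] := boxI a b (cst3 (- n%:R)) (cst3 n%:R).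
  - move=> B mB B0.
    have := hbox (cst3 (- n%:R)) (cst3 n%:R); rewrite -/(cube n).
    rewrite (_ : (\int[leb R]_(x in cube n) _ =
      \int[leb R]_(x in (B `&` cube n) `|` (~` B `&` cube n)) (h x)%:E)%E); last first.
      by rewrite -setIUl setUv setTI.
    rewrite integral_setU//; last 4 first.
    + exact: measurableI.
    + by apply: measurableI => //; exact: measurableC.
    + rewrite -setIUl setUv; exact: measurable_int (int_sub _ measurableT).
    + apply/disj_setPS => x [[Bx _] [nBx _]]; exact: nBx.
    by rewrite B0 add0e.
  - move=> F mF tF F0; rewrite setI_bigcupl integral_bigcup//.
    + by rewrite eseries0// => k _ _; exact: F0.
    + apply/trivIsetP => i j _ _ ij; rewrite setIACA setIid.
      by move/trivIsetP : tF => /(_ i j I I ij) ->; rewrite set0I.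
    + by move=> k; exact: measurableI.
    + by rewrite -setI_bigcupl; apply: int_sub; exact: bigcupT_measurable.
by apply: filterS => x /= hx /hx.
Qed.

End Boxes.

Section FourierBox.
Variable R : realType.
Local Notation M := (measurableTypeR R).
Local Notation mu := (@lebesgue_measure R).
Implicit Types (a b x y u : R3 R) (n : nat).

Lemma cint_tensor3 (f g h : M -> R[i]) :
  cintegrable mu setT f -> cintegrable mu setT g -> cintegrable mu setT h ->
  cintegrable (leb R) setT (fun x => f x.1.1 * g x.1.2 * h x.2) /\
  cint (leb R) setT (fun x => f x.1.1 * g x.1.2 * h x.2) =
    cint mu setT f * cint mu setT g * cint mu setT h.
Proof.
move=> fi gi hi; have [fgi fg] := cint_tensor fi gi.
by have := @cint_tensor R _ _ _ _ (prod_sf (@lebesgue_measure R) (@lebesgue_measure R))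
  (@lebesgue_measure R) _ _ fgi hi; rewrite fg.
Qed.

Definition pkern3 n y : R[i] := pkern n y.1.1 * pkern n y.1.2 * pkern n y.2.

Definition window3 a b y : R[i] :=
  window a.1.1 b.1.1 y.1.1 * window a.1.2 b.1.2 y.1.2 * window a.2 b.2 y.2.

Definition soft3 n a b x : R :=
  soft n a.1.1 b.1.1 x.1.1 * soft n a.1.2 b.1.2 x.1.2 * soft n a.2 b.2 x.2.

Lemma expi_dot3 x y :
  expi (- dot3 x y) = expi (- (x.1.1 * y.1.1)) * expi (- (x.1.2 * y.1.2)) *
    expi (- (x.2 * y.2)).
Proof. by rewrite dot3E !opprD !expiD. Qed.

Lemma soft3_fourier n a b x : lt3 a b ->
  cintegrable (leb R) setT
    (fun y => pkern3 n y * window3 a b y * expi (- dot3 x y)) /\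
  cint (leb R) setT (fun y => pkern3 n y * window3 a b y * expi (- dot3 x y)) =
    (soft3 n a b x)%:C.
Proof.
move=> [ab1 ab2 ab3].
have [i1 e1] := soft_fourier n x.1.1 ab1.
have [i2 e2] := soft_fourier n x.1.2 ab2.
have [i3 e3] := soft_fourier n x.2 ab3.
have := cint_tensor3 i1 i2 i3; rewrite e1 e2 e3 -!rmorphM /= => h.
rewrite (_ : (fun y => _) = (fun y : R3 R =>
  pkern n y.1.1 * window a.1.1 b.1.1 y.1.1 * expi (- (x.1.1 * y.1.1)) *
  (pkern n y.1.2 * window a.1.2 b.1.2 y.1.2 * expi (- (x.1.2 * y.1.2))) *
  (pkern n y.2 * window a.2 b.2 y.2 * expi (- (x.2 * y.2)))))//.
by apply/funext => y; rewrite expi_dot3 /pkern3 /window3; ring.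
Qed.

Lemma indic_boxE a b x : (\1_(box a b) x : R) =
  \1_(`]a.1.1, b.1.1]) x.1.1 * \1_(`]a.1.2, b.1.2]) x.1.2 * \1_(`]a.2, b.2]) x.2.
Proof.
rewrite !indicE.
have -> : (x \in box a b) = [&& x.1.1 \in `]a.1.1, b.1.1]%classic,
    x.1.2 \in `]a.1.2, b.1.2]%classic & x.2 \in `]a.2, b.2]%classic].
  apply/idP/and3P => [/set_mem[[h1 h2] h3]|[/set_mem h1 /set_mem h2 /set_mem h3]].
    by split; exact/mem_set.
  exact/mem_set.
by do 3 case: (_ \in _); rewrite /= ?mulr1 ?mulr0 ?mul0r.
Qed.

Lemma soft3_cvg a b x : lt3 a b ->
  (fun n => soft3 n a b x) @ \oo --> (\1_(box a b) x : R).
Proof.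
move=> [ab1 ab2 ab3]; rewrite indic_boxE.
by apply: cvgM; [apply: cvgM|]; exact: soft_cvg.
Qed.

Lemma soft3_bound n a b x : `|soft3 n a b x| <= 1.
Proof.
rewrite /soft3 normrM (normrM (soft _ _ _ _)).
have h (s t : R) : 0 <= s <= 1 -> 0 <= t <= 1 -> 0 <= s * t <= 1.
  by move=> /andP[? ?] /andP[? ?]; rewrite mulr_ge0//= mulr_ile1.
have g n' (a' b' x' : R) : 0 <= `|soft n' a' b' x'| <= 1.
  by rewrite normr_ge0 soft_bound.
have /andP[_] := h _ _ (h _ _ (g n a.1.1 b.1.1 x.1.1) (g n a.1.2 b.1.2 x.1.2))
  (g n a.2 b.2 x.2).
by [].
Qed.

Lemma pkern3_integrable n : cintegrable (leb R) setT (pkern3 n).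
Proof.
exact: (cint_tensor3 (pkern_integrable R n) (pkern_integrable R n)
  (pkern_integrable R n)).1.
Qed.

Lemma cabs3_le (z1 z2 z3 : R[i]) (k1 k2 k3 : R) : cabs z1 <= k1 -> cabs z2 <= k2 ->
  cabs z3 <= k3 -> cabs (z1 * z2 * z3) <= k1 * k2 * k3.
Proof.
move=> h1 h2 h3; apply: le_trans (cabsM _ _) _.
apply: ler_pM => //; rewrite ?cabs_ge0//.
apply: le_trans (cabsM _ _) _.
by apply: ler_pM => //; rewrite ?cabs_ge0.
Qed.

Lemma pkern3_bound n y : cabs (pkern3 n y) <= pi^-1 * pi^-1 * pi^-1.
Proof. by apply: cabs3_le; exact: pkern_bound. Qed.

Definition inv2pi3 : R := (2 * pi)^-1 * (2 * pi)^-1 * (2 * pi)^-1.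

Lemma pkern3_cvg y : ccvg (pkern3 ^~ y) inv2pi3%:C.
Proof.
by rewrite /inv2pi3 !rmorphM; apply: ccvgM; [apply: ccvgM|]; exact: pkern_cvg.
Qed.

Lemma cmeas_window3 a b : cmeas (window3 a b).
Proof.
have mw (p : R3 R -> M) (s t : R) : measurable_fun setT p ->
    cmeas (fun y => window s t (p y)).
  by move=> mp; exact: (cmeas_comp (cmeas_window s t) mp).
apply: cmeasM; [apply: cmeasM|].
- by apply: mw; exact: measurable_x1.
- by apply: mw; exact: measurable_x2.
- by apply: mw; exact: measurable_x3.
Qed.

Lemma window3_bounded a b : lt3 a b -> exists k, forall y, cabs (window3 a b y) <= k.
Proof.
move=> [ab1 ab2 ab3]; eexists => y.
by apply: cabs3_le; apply: window_bound.
Qed.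

Lemma indic_box_integrable a b :
  cintegrable (leb R) setT (fun u => (\1_(box a b) u : R)%:C).
Proof.
by apply: cintegrable_indic; [exact: measurable_box|exact: leb_box_fin].
Qed.

Lemma window3E a b y :
  window3 a b y = cint (leb R) setT (fun u => (\1_(box a b) u : R)%:C * expi (dot3 u y)).
Proof.
have wi (s t z : R) : cintegrable mu setT (fun v => (\1_(`]s, t]) v : R)%:C * expi (v * z)).
  have me : cmeas (fun v : M => expi (v * z)).
    by apply: cmeas_expi; apply: measurable_funM.
  exact: cintegrableM_bounded (cintegrable_itv s t) me (fun v => cabs_expi _).
have [_] := cint_tensor3 (wi a.1.1 b.1.1 y.1.1) (wi a.1.2 b.1.2 y.1.2) (wi a.2 b.2 y.2).
move=> e; rewrite /window3 /window -e; congr cint; apply/funext => u.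
rewrite indic_boxE dot3E !expiD !rmorphM; ring.
Qed.

(** Pairing an integrable function with the softened indicator of a box only
    involves its Fourier transform; letting the softening disappear recovers the
    integral of the function over the box.  The map X allows the transform to be
    that of an image measure. *)
Section Pairing.
Context d (T : measurableType d) (m : {sigma_finite_measure set T -> \bar R}).
Variables (X : T -> R3 R) (f : T -> R[i]).
Hypotheses (mX : measurable_fun setT X) (fi : cintegrable m setT f).

Definition ftrans y : R[i] := cint m setT (fun t => f t * expi (- dot3 (X t) y)).

Let mE : cmeas (fun z : T * R3 R => expi (- dot3 (X z.1) z.2)).
Proof.
apply: cmeas_expi; apply: measurable_funN; apply: measurable_dot3 => //.
exact: (measurableT_comp mX measurable_fst).
Qed.

Let pairing n a b : lt3 a b ->
  cint (leb R) setT (fun y => pkern3 n y * window3 a b y * ftrans y) =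
  cint m setT (fun t => f t * (soft3 n a b (X t))%:C).
Proof.
move=> ab; have [k wk] := window3_bounded ab.
have Ki := cintegrableM_bounded (pkern3_integrable n) (cmeas_window3 a b) wk.
have [_ _ e1 e2] := cint_fubini (cintegrable_tensor fi Ki mE (fun z => cabs_expi _)).
transitivity (cint (leb R) setT (fun y => cint m setT (fun t =>
    f t * (pkern3 n y * window3 a b y) * expi (- dot3 (X t) y)))).
  congr cint; apply/funext => y; rewrite /ftrans -cintZ.
    by congr cint; apply/funext => t; ring.
  have me : cmeas (fun t => expi (- dot3 (X t) y)).
    apply: cmeas_expi; apply: measurable_funN; exact: measurable_dot3.
  exact: cintegrableM_bounded fi me (fun t => cabs_expi _).
rewrite e2 -e1; congr cint; apply/funext => t /=.
have [i3 e3] := soft3_fourier n (X t) ab.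
by rewrite -e3 -cintZ//; congr cint; apply/funext => y; ring.
Qed.

Lemma pairing_cvg a b : lt3 a b ->
  ccvg (fun n => cint (leb R) setT (fun y => pkern3 n y * window3 a b y * ftrans y))
    (cint m setT (fun t => f t * (\1_(box a b) (X t))%:C)).
Proof.
move=> ab; under eq_fun do rewrite pairing//.
have mf := cintegrable_cmeas fi; have [_ ni] := (cintegrableP _ _).1 fi.
have ms n : measurable_fun setT (fun t => soft3 n a b (X t)).
  have msoft (p q : R) (g : T -> M) : measurable_fun setT g ->
      measurable_fun setT (fun t => soft n p q (g t)).
    move=> mg; have cs : continuous (soft n p q).
      apply: ctZ; apply: ctD.
        apply: (ct_comp (@continuous_atan R)); apply: ctD; last exact: ct_cst.
        by apply: ctZ; apply: ctD; [exact: ct_cst|apply: ctN; exact: ct_id].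
      apply: ctN; apply: (ct_comp (@continuous_atan R)); apply: ctD; last exact: ct_cst.
      by apply: ctZ; apply: ctD; [exact: ct_cst|apply: ctN; exact: ct_id].
    exact: (measurableT_comp (continuous_measurable_fun cs)).
  apply: measurable_funM; [apply: measurable_funM|]; apply: msoft.
  - exact: (measurableT_comp (@measurable_x1 R) mX).
  - exact: (measurableT_comp (@measurable_x2 R) mX).
  - exact: (measurableT_comp (@measurable_x3 R) mX).
have [||||_] := @cint_cvg _ _ _ m (fun n t => f t * (soft3 n a b (X t))%:C)
  (fun t => f t * (\1_(box a b) (X t))%:C) (fun t => cabs (f t)) => //.
- by move=> n; apply: cmeasM => //; exact: cmeas_real.
- move=> t; apply: ccvgM; first exact: ccvg_cst.
  by split => /=; [exact: soft3_cvg|exact: cvg_cst].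
- move=> n t; apply: le_trans (cabsM _ _) _; rewrite cabs_real.
  by rewrite ler_piMr ?cabs_ge0 ?soft3_bound.
Qed.

End Pairing.

(** By [pairing_cvg], integrals over boxes are limits of expressions that only
    involve the Fourier transform. *)
Lemma ftrans_inj d1 d2 (T1 : measurableType d1) (T2 : measurableType d2)
    (m1 : {sigma_finite_measure set T1 -> \bar R})
    (m2 : {sigma_finite_measure set T2 -> \bar R})
    (X1 : T1 -> R3 R) (X2 : T2 -> R3 R) (f1 : T1 -> R[i]) (f2 : T2 -> R[i]) :
  measurable_fun setT X1 -> measurable_fun setT X2 ->
  cintegrable m1 setT f1 -> cintegrable m2 setT f2 ->
  (forall y, ftrans m1 X1 f1 y = ftrans m2 X2 f2 y) ->
  forall a b, lt3 a b -> cint m1 setT (fun t => f1 t * (\1_(box a b) (X1 t))%:C) =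
    cint m2 setT (fun t => f2 t * (\1_(box a b) (X2 t))%:C).
Proof.
move=> mX1 mX2 i1 i2 e a b ab.
have c1 := pairing_cvg mX1 i1 ab; have c2 := pairing_cvg mX2 i2 ab.
have E n : cint (leb R) setT (fun y => pkern3 n y * window3 a b y * ftrans m1 X1 f1 y) =
    cint (leb R) setT (fun y => pkern3 n y * window3 a b y * ftrans m2 X2 f2 y).
  by congr cint; apply/funext => y; rewrite e.
by apply: (ccvg_unique c1); under eq_fun do rewrite E.
Qed.

(** Let g be the right-hand side.  The integral of f over a box is the limit of the
    pairings of its transform; by dominated convergence and Fubini this limit is
    also the integral of g over the box.  Hence f = g almost everywhere. *)
Theorem fourier_inversion (f : R3 R -> R[i]) :
  cintegrable (leb R) setT f -> cintegrable (leb R) setT (ftrans (leb R) id f) ->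
  {ae leb R, forall x, f x =
    inv2pi3%:C * cint (leb R) setT (fun y => ftrans (leb R) id f y * expi (dot3 x y))}.
Proof.
move=> fi hi; set fh := ftrans _ _ _ in hi *.
pose g x := inv2pi3%:C * cint (leb R) setT (fun y => fh y * expi (dot3 x y)).
have mh := cintegrable_cmeas hi; have [_ nhi] := (cintegrableP _ _).1 hi.
have mE2 : cmeas (fun z : R3 R * R3 R => expi (dot3 z.1 z.2)).
  by apply: cmeas_expi; apply: measurable_dot3.
have mEx x : cmeas (fun y => expi (dot3 x y)).
  by apply: cmeas_expi; exact: measurable_dot3.
have gi x : cintegrable (leb R) setT (fun y => fh y * expi (dot3 x y)).
  exact: cintegrableM_bounded hi (mEx x) (fun t => cabs_expi _).
have mg : cmeas g.
  apply: cmeasM; first exact: cmeas_cst.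
  pose h (z : R3 R * R3 R) : R[i] := fh z.2 * expi (dot3 z.1 z.2).
  apply: (@cmeas_cint R _ _ _ _ (leb R) h).
  by apply: cmeasM => //; exact: (cmeas_comp mh measurable_snd).
pose k := cabs inv2pi3%:C * (\int[leb R]_y (cabs (fh y) * 2)).
have gk x : cabs (g x) <= k.
  apply: le_trans (cabsM _ _) _; rewrite ler_wpM2l ?cabs_ge0//.
  apply: le_trans (cabs_cint (gi x)) _; apply: le_Rintegral => //.
  - by have [] := (cintegrableP _ _).1 (gi x).
  - exact: (integrableZr measurableT 2 nhi).
  - move=> y _; apply: le_trans (cabsM _ _) _.
    by rewrite ler_wpM2l ?cabs_ge0 ?cabs_expi.
have mbox a b : cmeas (fun u => (\1_(box a b) u : R)%:C).
  by apply: cmeas_real; apply: measurable_indic; exact: measurable_box.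
have bg a b : cintegrable (leb R) setT (fun u => (\1_(box a b) u)%:C * g u).
  exact: cintegrableM_bounded (indic_box_integrable a b) mg gk.
have bf a b : cintegrable (leb R) setT (fun u => (\1_(box a b) u)%:C * f u).
  under eq_fun do rewrite mulrC.
  apply: (cintegrableM_bounded fi (mbox a b)) => u.
  by rewrite cabs_real indicE; case: (_ \in _); rewrite ?normr1 ?normr0.
have fg a b : lt3 a b -> cint (leb R) setT (fun u => (\1_(box a b) u)%:C * f u) =
    cint (leb R) setT (fun u => (\1_(box a b) u)%:C * g u).
  move=> ab; have [w wk] := window3_bounded ab.
  have c1 := pairing_cvg (@measurable_id _ _ setT) fi ab; rewrite -/fh in c1.
  have [||||_ c2] := @cint_cvg _ _ _ (leb R)
      (fun n y => pkern3 n y * window3 a b y * fh y)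
      (fun y => inv2pi3%:C * window3 a b y * fh y)
      (fun y => pi^-1 * pi^-1 * pi^-1 * w * cabs (fh y)).
  - move=> n; apply: cmeasM => //; apply: cmeasM; last exact: cmeas_window3.
    exact: cintegrable_cmeas (pkern3_integrable n).
  - move=> y; apply: ccvgM; last exact: ccvg_cst.
    by apply: ccvgM; [exact: pkern3_cvg|exact: ccvg_cst].
  - by move=> n y; apply: cabs3_le => //; exact: pkern3_bound.
  - exact: (integrableZl measurableT _ nhi).
  under eq_fun do rewrite mulrC; rewrite (ccvg_unique c1 c2).
  have [_ _ e1 e2] := cint_fubini (cintegrable_tensor (indic_box_integrable a b) hi
    mE2 (fun z => cabs_expi _)).
  transitivity (inv2pi3%:C * cint (leb R) setT (fun y => cint (leb R) setT (fun u =>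
      (\1_(box a b) u : R)%:C * fh y * expi (dot3 u y)))).
    rewrite -cintZ; last first.
      by have [_ + _ _] := cint_fubini (cintegrable_tensor (indic_box_integrable a b) hi
        mE2 (fun z => cabs_expi _)).
    congr cint; apply/funext => y; rewrite -mulrA; congr (_ * _).
    rewrite window3E mulrC -cintZ.
      by congr cint; apply/funext => u; ring.
    have mEy : cmeas (fun u => expi (dot3 u y)).
      by apply: cmeas_expi; exact: measurable_dot3.
    exact: cintegrableM_bounded (indic_box_integrable a b) mEy (fun t => cabs_expi _).
  rewrite e2 -e1 -cintZ; last first.
    by have [+ _ _ _] := cint_fubini (cintegrable_tensor (indic_box_integrable a b) hi
        mE2 (fun z => cabs_expi _)).
  congr cint; apply/funext => u /=.
  rewrite /g mulrCA; congr (_ * _); rewrite -cintZ; last exact: gi.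
  congr cint; apply/funext => y; ring.
have fgi a b : cintegrable (leb R) (box a b) (fun u => f u + (-1) * g u).
  apply/(cint_restr _ _ (measurable_box a b)).1; rewrite /crestr.
  under eq_fun do rewrite mulrDr mulrCA.
  by apply: cintegrableD => //; exact: cintegrableZ.
have fg0 a b : lt3 a b -> cint (leb R) (box a b) (fun u => f u + (-1) * g u) = 0.
  move=> ab; rewrite (cint_restr _ _ (measurable_box a b)).2 /crestr.
  under [X in cint _ _ X]eq_fun do rewrite mulrDr mulrCA.
  rewrite cintD//; last exact: cintegrableZ.
  by rewrite cintZ// fg// mulN1r subrr.
have hR : {ae leb R, forall x, complex.Re (f x + (-1) * g x) = 0}.
  apply: box_ae0 => [n|a b ab]; first by have [] := fgi (cst3 (- n%:R)) (cst3 n%:R).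
  have /(congr1 (@complex.Re R)) := fg0 a b ab; rewrite Re_cint.
  have [+ _] := fgi a b => /(integrable_fin_num (measurable_box a b)) /fineK <-.
  by rewrite /Rintegral => ->.
have hI : {ae leb R, forall x, complex.Im (f x + (-1) * g x) = 0}.
  apply: box_ae0 => [n|a b ab]; first by have [] := fgi (cst3 (- n%:R)) (cst3 n%:R).
  have /(congr1 (@complex.Im R)) := fg0 a b ab; rewrite Im_cint.
  have [_ +] := fgi a b => /(integrable_fin_num (measurable_box a b)) /fineK <-.
  by rewrite /Rintegral => ->.
apply: filterS2 hR hI => x r0 i0.
apply/eqP; rewrite -subr_eq0 -mulN1r -/(g x); apply/eqP.
by apply: complex_ext; rewrite ?r0 ?i0.
Qed.

End FourierBox.

(** * Rotations of R^3 *)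

Section Geometry.
Variable R : realType.
Implicit Types (x y z w : R3 R) (k : 'M[R]_3) (r : R).

Lemma act_coords k x : act k x =
  ((k 0 0 * x.1.1 + k 0 1 * x.1.2 + k 0 2 * x.2,
    k 1 0 * x.1.1 + k 1 1 * x.1.2 + k 1 2 * x.2),
    k 2 0 * x.1.1 + k 2 1 * x.1.2 + k 2 2 * x.2).
Proof.
have e i : (k *m col3 x) i 0 = k i 0 * x.1.1 + k i 1 * x.1.2 + k i 2 * x.2.
  by rewrite mxE sum3 /col3 !mxE /=.
by rewrite /act /of_col3 !e.
Qed.

Lemma col3K : cancel (@of_col3 R) (@col3 R).
Proof.
move=> v; apply/matrixP => i j; rewrite (ord1 j) mxE /of_col3.
case: i => -[|[|[|//]]] i3 /=; congr (v _ 0); exact/val_inj.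
Qed.

Lemma of_col3K : cancel (@col3 R) (@of_col3 R).
Proof. by move=> [[x y] z]; rewrite /of_col3 /col3 !mxE. Qed.

Lemma col3_act k x : col3 (act k x) = k *m col3 x.
Proof. exact: col3K. Qed.

Lemma actM k l x : act (k *m l) x = act k (act l x).
Proof. by rewrite /act col3K mulmxA. Qed.

Lemma act1 x : act 1%:M x = x.
Proof. by rewrite /act mul1mx of_col3K. Qed.

Lemma dot3_mx x y : dot3 x y = ((col3 x)^T *m col3 y) 0 0.
Proof. by rewrite mxE; apply: eq_bigr => i _; rewrite [in RHS]mxE. Qed.

Lemma O3_tr k : O3 k -> k^T *m k = 1%:M.
Proof. exact: mulmx1C. Qed.

Lemma dot3_act k x y : O3 k -> dot3 (act k x) (act k y) = dot3 x y.
Proof.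
move=> /O3_tr kO; rewrite !dot3_mx !col3_act trmx_mul mulmxA.
by rewrite -(mulmxA _ k^T) kO mulmx1.
Qed.

Lemma O3T k : O3 k -> O3 k^T.
Proof. by move=> /O3_tr; rewrite /O3 trmxK. Qed.

Lemma SO3T k : SO3 k -> SO3 k^T.
Proof. by move=> [kO kd]; split; [exact: O3T|rewrite det_tr]. Qed.

Lemma actK k : O3 k -> cancel (act k) (act k^T).
Proof. by move=> /O3_tr kO x; rewrite -actM kO act1. Qed.

Lemma actKV k : O3 k -> cancel (act k^T) (act k).
Proof. by move=> kO x; rewrite -actM kO act1. Qed.

Lemma dot3_actr k x y : O3 k -> dot3 x (act k y) = dot3 (act k^T x) y.
Proof. by move=> kO; rewrite -{1}(actKV kO x) dot3_act. Qed.

Definition scale3 r x : R3 R := ((r * x.1.1, r * x.1.2), r * x.2).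

Definition add3 x y : R3 R := ((x.1.1 + y.1.1, x.1.2 + y.1.2), x.2 + y.2).

Lemma opp3E x : opp3 x = ((- x.1.1, - x.1.2), - x.2).
Proof. by rewrite /opp3 /of_col3 !mxE. Qed.

Lemma opp3_scale x : opp3 x = scale3 (-1) x.
Proof. by rewrite opp3E /scale3 !mulN1r. Qed.

Lemma act_scale k r x : act k (scale3 r x) = scale3 r (act k x).
Proof. by rewrite !act_coords /scale3 /=; congr ((_, _), _); ring. Qed.

Lemma act_add k x y : act k (add3 x y) = add3 (act k x) (act k y).
Proof. by rewrite !act_coords /add3 /=; congr ((_, _), _); ring. Qed.

Lemma scale3M r s x : scale3 r (scale3 s x) = scale3 (r * s) x.
Proof. by rewrite /scale3 /= !mulrA. Qed.

Lemma scale31 x : scale3 1 x = x.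
Proof. by case: x => -[x y] z; rewrite /scale3 /= !mul1r. Qed.

Lemma dot3Zl r x y : dot3 (scale3 r x) y = r * dot3 x y.
Proof. by rewrite !dot3E /scale3 /=; ring. Qed.

Lemma dot3Zr r x y : dot3 x (scale3 r y) = r * dot3 x y.
Proof. by rewrite !dot3E /scale3 /=; ring. Qed.

Definition norm3 x := Num.sqrt (dot3 x x).

Lemma dot3_ge0 x : 0 <= dot3 x x.
Proof. by rewrite dot3E -!expr2 !addr_ge0 ?sqr_ge0. Qed.

Lemma norm3_ge0 x : 0 <= norm3 x.
Proof. exact: sqrtr_ge0. Qed.

Lemma norm3_sqr x : norm3 x ^+ 2 = dot3 x x.
Proof. by rewrite sqr_sqrtr ?dot3_ge0. Qed.

Lemma norm3_act k x : O3 k -> norm3 (act k x) = norm3 x.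
Proof. by move=> kO; rewrite /norm3 dot3_act. Qed.

Lemma norm3_scale r x : norm3 (scale3 r x) = `|r| * norm3 x.
Proof. by rewrite /norm3 dot3Zl dot3Zr mulrA -expr2 sqrtrM ?sqr_ge0// sqrtr_sqr. Qed.

Lemma norm3_sphere x : sphere x -> norm3 x = 1.
Proof. by rewrite /sphere /norm3 /= => ->; rewrite sqrtr1. Qed.

Lemma norm3_eq0 x : norm3 x = 0 -> x = ((0, 0), 0).
Proof.
move=> x0; have := norm3_sqr x; rewrite x0 expr0n /= dot3E => /esym/eqP.
rewrite -!expr2 !paddr_eq0 ?addr_ge0 ?sqr_ge0// !sqrf_eq0.
by case: x {x0} => -[x y] z /= /andP[/andP[/eqP-> /eqP->] /eqP->].
Qed.

(** The value at the origin is the origin, since 0^-1 = 0. *)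
Definition dir x : R3 R := scale3 (norm3 x)^-1 x.

Lemma norm3_dir x : norm3 (dir x) <= 1.
Proof.
rewrite /dir norm3_scale ger0_norm ?invr_ge0 ?norm3_ge0//.
have [->|x0] := eqVneq (norm3 x) 0; first by rewrite mulr0.
by rewrite mulVf.
Qed.

Lemma dir_sphere x : sphere x -> dir x = x.
Proof. by move=> /norm3_sphere x1; rewrite /dir x1 invr1 scale31. Qed.

Lemma dir_scale r x : 0 < r -> dir (scale3 r x) = dir x.
Proof.
move=> r0; rewrite /dir norm3_scale gtr0_norm// scale3M invfM mulrAC mulVf ?mul1r//.
by rewrite gt_eqF.
Qed.

Lemma dir_act k x : O3 k -> dir (act k x) = act k (dir x).
Proof. by move=> kO; rewrite /dir norm3_act// act_scale. Qed.

(** Rotation by the angle pi about the axis spanned by w. *)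
Definition halfturn w : 'M[R]_3 :=
  (2 / dot3 w w) *: (col3 w *m (col3 w)^T) - 1%:M.

Lemma halfturnE w i j :
  halfturn w i j = 2 / dot3 w w * (col3 w i 0 * col3 w j 0) - (i == j)%:R.
Proof.
by rewrite /halfturn !mxE !big_ord_recl big_ord0 addr0 !mxE.
Qed.

Lemma det3 k : \det k = k 0 0 * (k 1 1 * k 2 2 - k 1 2 * k 2 1)
  - k 0 1 * (k 1 0 * k 2 2 - k 1 2 * k 2 0)
  + k 0 2 * (k 1 0 * k 2 1 - k 1 1 * k 2 0).
Proof.
rewrite (expand_det_row _ 0) !big_ord_recl big_ord0 addr0 /cofactor.
rewrite !(expand_det_row _ 0) !big_ord_recl !big_ord0 /cofactor !det_mx11 !mxE /=.
pose g (a b : nat) := k (inord a) (inord b).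
have kE i j : k i j = g i j by rewrite /g !inord_val.
by rewrite !kE /= /bump /= !addr0; ring.
Qed.

Lemma halfturn_SO3 w : dot3 w w != 0 -> SO3 (halfturn w).
Proof.
move=> w0; have ww : (col3 w)^T *m col3 w = (dot3 w w)%:M.
  by apply/matrixP => i j; rewrite (ord1 i) (ord1 j) -dot3_mx mxE eqxx.
split.
  rewrite /O3 /halfturn.
  have -> : (2 / dot3 w w *: (col3 w *m (col3 w)^T) - 1%:M)^T =
      2 / dot3 w w *: (col3 w *m (col3 w)^T) - 1%:M :> 'M[R]_3.
    by rewrite linearB linearZ /= trmx_mul trmxK trmx1.
  rewrite mulmxBl mul1mx mulmxBr mulmx1 -scalemxAl -scalemxAr scalerA.
  rewrite mulmxA -(mulmxA (col3 w)) ww mul_mx_scalar -scalemxAl scalerA.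
  rewrite (_ : 2 / dot3 w w * (2 / dot3 w w) * dot3 w w =
      2 / dot3 w w + 2 / dot3 w w); last by field.
  by rewrite scalerDl opprB addrK addrC subrK.
rewrite det3 !halfturnE /col3 !mxE /=.
move: w0; rewrite dot3E; case: w {ww} => -[x y] z /= w0.
by field.
Qed.

Lemma act_halfturn w x : act (halfturn w) x =
  add3 (scale3 (2 * dot3 w x / dot3 w w) w) (scale3 (-1) x).
Proof.
rewrite act_coords !halfturnE /col3 !mxE /= /add3 /scale3 /= !dot3E.
by congr ((_, _), _); ring.
Qed.

(** Transitivity of SO(3) on spheres: the half-turn about x + y exchanges x and
    y; when y = - x, any axis orthogonal to x will do. *)
Lemma SO3_transitive x y : dot3 x x = dot3 y y -> exists2 k, SO3 k & act k x = y.
Proof.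
move=> xy; pose w := add3 x y.
have [w0|w0] := eqVneq (dot3 w w) 0; last first.
  exists (halfturn w); first exact: halfturn_SO3.
  rewrite act_halfturn.
  have e : 2 * dot3 w x = dot3 w w.
    have -> : 2 * dot3 w x = dot3 w w + (dot3 x x - dot3 y y).
      by rewrite !dot3E /w /add3 /=; ring.
    by rewrite xy subrr addr0.
  rewrite e divff// scale31 /w /add3 /scale3 /=.
  by case: y {xy w w0 e} => -[y1 y2] y3 /=; congr ((_, _), _); ring.
have {w0} wE : w = ((0, 0), 0) by apply: norm3_eq0; rewrite /norm3 w0 sqrtr0.
have -> : y = scale3 (-1) x.
  case: x y @w wE {xy} => -[x1 x2] x3 [[y1 y2] y3] /=; rewrite /add3 /scale3 /= => -[h1 h2 h3].
  by congr ((_, _), _); lra.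
have [v vx v0] : exists2 v, dot3 v x = 0 & dot3 v v != 0.
  have [h|h] := boolP ((x.1.1 == 0) && (x.1.2 == 0)).
    move: h => /andP[/eqP h1 /eqP h2].
    by exists ((1, 0), 0); rewrite dot3E /= ?h1; [ring|rewrite !(mulr0, addr0, mulr1) oner_eq0].
  exists ((x.1.2, - x.1.1), 0); first by rewrite dot3E /=; ring.
  rewrite dot3E /= mulr0 addr0 mulrNN -!expr2 paddr_eq0 ?sqr_ge0//.
  by rewrite !sqrf_eq0 andbC.
exists (halfturn v); first exact: halfturn_SO3.
rewrite act_halfturn vx mulr0 mul0r /add3 /scale3 /=.
by congr ((_, _), _); ring.
Qed.

Lemma measurable_act k : measurable_fun setT (act k).
Proof.
rewrite [act k](funext (act_coords k)).
have m (a b c : R) : measurable_fun setT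
    (fun x : R3 R => a * x.1.1 + b * x.1.2 + c * x.2).
  apply: measurable_funD; [apply: measurable_funD|];
    apply: measurable_funM => //; [exact: measurable_x1|exact: measurable_x2].
by apply: measurable_R3 => /=; exact: m.
Qed.

Lemma measurable_scale3 d (T : measurableType d) (f : T -> R) (g : T -> R3 R) :
  measurable_fun setT f -> measurable_fun setT g ->
  measurable_fun setT (fun t => scale3 (f t) (g t)).
Proof.
move=> mf mg; apply: measurable_R3 => /=; apply: measurable_funM => //.
- exact: (measurableT_comp (@measurable_x1 R) mg).
- exact: (measurableT_comp (@measurable_x2 R) mg).
- exact: (measurableT_comp (@measurable_x3 R) mg).
Qed.

Lemma measurable_add3 d (T : measurableType d) (f g : T -> R3 R) :
  measurable_fun setT f -> measurable_fun setT g ->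
  measurable_fun setT (fun t => add3 (f t) (g t)).
Proof.
move=> mf mg; apply: measurable_R3 => /=; apply: measurable_funD.
- exact: (measurableT_comp (@measurable_x1 R) mf).
- exact: (measurableT_comp (@measurable_x1 R) mg).
- exact: (measurableT_comp (@measurable_x2 R) mf).
- exact: (measurableT_comp (@measurable_x2 R) mg).
- exact: (measurableT_comp (@measurable_x3 R) mf).
- exact: (measurableT_comp (@measurable_x3 R) mg).
Qed.

Lemma measurable_sqrt : measurable_fun setT (Num.sqrt : R -> R).
Proof. by apply: continuous_measurable_fun; exact: sqrt_continuous. Qed.

Lemma measurable_norm3 : measurable_fun setT norm3.
Proof.
apply: (measurableT_comp measurable_sqrt).
exact: measurable_dot3.
Qed.

Lemma measurable_inv : measurable_fun setT (fun r : R => r^-1).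
Proof.
(* r / (r^2 + 1/n) is continuous and tends to 1/r, with value 0 at 0 *)
have h0 n (r : R) : r ^+ 2 + n.+1%:R^-1 != 0.
  by rewrite gt_eqF// ltr_wpDl ?sqr_ge0// invr_gt0 ltr0n.
apply: (measurable_fun_cvg (h := fun n (r : R) => r / (r ^+ 2 + n.+1%:R^-1))).
  move=> n; apply: continuous_measurable_fun; apply: ctM; first exact: ct_id.
  move=> r; apply: cvgV => //.
  by apply: cvgD; [exact: exprn_continuous|exact: cvg_cst].
move=> r _; have [->|r0] := eqVneq r 0.
  by under eq_fun do rewrite mul0r; rewrite invr0; exact: cvg_cst.
rewrite (_ : r^-1 = r / (r ^+ 2 + 0)); last by field.
apply: cvgM; first exact: cvg_cst.
apply: cvgV; first by rewrite addr0 sqrf_eq0.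
by apply: cvgD; [exact: cvg_cst|exact: cvg_harmonic].
Qed.

Lemma measurable_dir : measurable_fun setT dir.
Proof.
apply: measurable_scale3 => //.
exact: (measurableT_comp measurable_inv measurable_norm3).
Qed.

End Geometry.

(** * Polar coordinates *)

Section Invariance.
Variable R : realType.
Implicit Types (x y t : R3 R) (k : 'M[R]_3) (A B : set (R3 R)).
Local Notation lam := (leb R).

Let mshift t : measurable_fun setT (fun x : R3 R => add3 x t).
Proof. exact: measurable_add3. Qed.

Lemma leb_translate t A : measurable A -> lam ((fun x => add3 x t) @^-1` A) = lam A.
Proof.
have mt := mshift t.
have pre a b : (fun x => add3 x t) @^-1` box a b =
    box (add3 a (scale3 (-1) t)) (add3 b (scale3 (-1) t)).
  apply/seteqP; split=> [[[x y] z]|[[x y] z]];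
    rewrite /preimage /box /= !in_itv /=.
    move=> [[/andP[? ?] /andP[? ?]] /andP[? ?]].
    by split; [split|]; apply/andP; split; lra.
  move=> [[/andP[? ?] /andP[? ?]] /andP[? ?]].
  by split; [split|]; apply/andP; split; lra.
have pos a b : lt3 a b -> lam ((fun x => add3 x t) @^-1` box a b) = lam (box a b).
  move=> ab; rewrite pre !leb_box//; first by congr EFin => /=; ring.
  by move: ab => [? ? ?]; split => /=; lra.
move=> mA; apply: (box_measure_unique (m1 := pushforward lam (fun x => add3 x t))) => //.
by move=> n; have := leb_box_fin (add3 (cst3 (- n%:R)) (scale3 (-1) t))
  (add3 (cst3 n%:R) (scale3 (-1) t)); rewrite -pre.
Qed.

Lemma mule_cancel (c : R) (u v : \bar R) : 0 < c ->
  (c%:E * u = c%:E * v)%E -> u = v.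
Proof.
move=> c0 /(congr1 (mule c^-1%:E)).
by rewrite !muleA -EFinM mulVf ?gt_eqF// !mul1e.
Qed.

Lemma integral_indic_comp d (T : measurableType d) (m : {measure set T -> \bar R})
    d' (T' : measurableType d') (p : T -> T') (A : set T') :
  measurable_fun setT p -> measurable A ->
  (\int[m]_x (\1_A (p x) : R)%:E = m (p @^-1` A))%E.
Proof.
move=> mp mA; have mpA : measurable (p @^-1` A).
  by have := mp measurableT A mA; rewrite setTI.
by rewrite -[X in _ = m X](setIT (p @^-1` A)) -integral_indic.
Qed.

(** Evaluating in two ways the integral of 1_A(phi x) 1_B(phi x + y) over pairs
    (x, y).  It implies that Lebesgue measure is the only translation invariant
    measure, up to a factor. *)
Lemma leb_additive (phi psi : R3 R -> R3 R) A B : measurable_fun setT phi ->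
  (forall x y, phi (add3 x y) = add3 (phi x) (phi y)) -> cancel psi phi ->
  measurable A -> measurable B ->
  (lam (phi @^-1` A) * lam B = lam (phi @^-1` B) * lam (scale3 (-1) @^-1` A))%E.
Proof.
move=> mphi phiD psiK mA mB.
have mi (C : set (R3 R)) : measurable C -> measurable_fun setT (\1_C : R3 R -> R).
  by move=> mC; exact: measurable_indic.
have mphi1 : measurable_fun setT (fun z : R3 R * R3 R => phi z.1).
  exact: (measurableT_comp mphi measurable_fst).
have i01 (C : set (R3 R)) z : (0 <= (\1_C z : R)%:E)%E by rewrite lee_fin.
pose f (z : R3 R * R3 R) := ((\1_A (phi z.1) * \1_B (add3 (phi z.1) z.2) : R)%:E)%E.
pose g (z : R3 R * R3 R) :=
  ((\1_B (phi z.1) * \1_A (add3 (phi z.1) (scale3 (-1) z.2)) : R)%:E)%E.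
have mf : measurable_fun setT f.
  apply/measurable_EFinP; apply: measurable_funM.
    exact: (measurableT_comp (mi _ mA)).
  by apply: (measurableT_comp (mi _ mB)); exact: measurable_add3.
have mg : measurable_fun setT g.
  apply/measurable_EFinP; apply: measurable_funM.
    exact: (measurableT_comp (mi _ mB)).
  apply: (measurableT_comp (mi _ mA)); apply: measurable_add3 => //.
  exact: measurable_scale3.
have f0 z : (0 <= f z)%E by rewrite lee_fin mulr_ge0.
have g0 z : (0 <= g z)%E by rewrite lee_fin mulr_ge0.
have fx x : (\int[lam]_y f (x, y) = (\1_A (phi x) : R)%:E * lam B)%E.
  rewrite (eq_integral (fun y => (\1_A (phi x) : R)%:E * (\1_B (add3 y (phi x)) : R)%:E)%E);
    last first.
    by move=> y _; rewrite /f /= EFinM; congr (_ * (\1_B _)%:E)%E;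
      rewrite /add3; congr ((_, _), _); rewrite addrC.
  rewrite ge0_integralZl//; last first.
    by apply/measurable_EFinP; exact: (measurableT_comp (mi _ mB) (mshift _)).
  by rewrite (integral_indic_comp lam (mshift _))//; congr (_ * _)%E; exact: leb_translate.
have gx x : (\int[lam]_y g (x, y) =
    (\1_B (phi x) : R)%:E * lam (scale3 (-1) @^-1` A))%E.
  rewrite (eq_integral (fun y => (\1_B (phi x) : R)%:E *
      (\1_(scale3 (-1) @^-1` A) (add3 y (scale3 (-1) (phi x))) : R)%:E)%E);
    last first.
    move=> y _; rewrite /g /= EFinM; congr (_ * (_)%:E)%E.
    rewrite !indicE; congr (_%:R); congr nat_of_bool.
    apply/idP/idP => /set_mem h; apply/mem_set; move: h; rewrite /preimage /=;
      congr A; rewrite /add3 /scale3 /=; congr ((_, _), _); ring.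
  have mA' : measurable (scale3 (-1) @^-1` A).
    have m1 : measurable_fun setT (@scale3 R (-1)) by exact: measurable_scale3.
    by have := m1 measurableT A mA; rewrite setTI.
  rewrite ge0_integralZl//; last first.
    apply/measurable_EFinP; exact: (measurableT_comp (mi _ mA') (mshift _)).
  by rewrite (integral_indic_comp lam (mshift _))//; congr (_ * _)%E; exact: leb_translate.
transitivity (\int[lam]_x \int[lam]_y f (x, y))%E.
  under eq_integral do rewrite fx.
  rewrite ge0_integralZr//; last first.
    by apply/measurable_EFinP; exact: (measurableT_comp (mi _ mA)).
  by rewrite integral_indic_comp.
transitivity (\int[lam]_x \int[lam]_y g (x, y))%E; last first.
  under eq_integral do rewrite gx.
  rewrite ge0_integralZr//; last first.
    by apply/measurable_EFinP; exact: (measurableT_comp (mi _ mB)).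
  by rewrite integral_indic_comp.
have Ff := fubini_tonelli (m1 := lam) (m2 := lam) f mf f0.
have Fg := fubini_tonelli (m1 := lam) (m2 := lam) g mg g0.
apply: etrans Ff (etrans _ (esym Fg)).
apply: eq_integral => y _.
have mt := mshift (psi y).
rewrite -(ge0_integral_transfer mt (leb_translate (psi y)) (f := fun x => g (x, y)))//.
  apply: eq_integral => x _; rewrite /f /g /= phiD psiK mulrC.
  congr ((_ * \1_A _)%:E).
  by case: (phi x) (y) => -[a b] c [[a' b'] c']; rewrite /add3 /scale3 /=;
    congr ((_, _), _); ring.
exact: (measurableT_comp mg (measurable_pair2 y)).
Qed.

Lemma leb_opp A : measurable A -> lam (scale3 (-1) @^-1` A) = lam A.
Proof.
move=> mA; pose B : set (R3 R) := @cube R 1.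
have B1 : lam B = 8%:E.
  rewrite leb_box /=; last by split => /=; rewrite gtrN.
  by congr EFin; ring.
have := leb_additive (@measurable_id _ _ setT) (fun x y => erefl) (fun x => erefl)
  mA (measurable_box _ _ : measurable B).
by rewrite B1 muleC => /mule_cancel ->.
Qed.

(** The factor of an additive bijection can be computed on any one set B of finite
    positive measure. *)
Lemma leb_scale_factor (phi psi : R3 R -> R3 R) A B (c : R) : measurable_fun setT phi ->
  (forall x y, phi (add3 x y) = add3 (phi x) (phi y)) -> cancel psi phi ->
  measurable A -> measurable B -> (0 < lam B < +oo)%E ->
  (lam (phi @^-1` B) = c%:E * lam B)%E -> (lam (phi @^-1` A) = c%:E * lam A)%E.
Proof.
move=> mphi phiD psiK mA mB /andP[B0 Bfin] e.
have := leb_additive mphi phiD psiK mA mB; rewrite leb_opp// e.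
have Bn : lam B \is a fin_num by rewrite ge0_fin_numE// ltW.
have b0 : 0 < fine (lam B) by rewrite fine_gt0// B0 Bfin.
rewrite -(fineK Bn) => h; apply: (mule_cancel b0).
by rewrite muleC h muleA [((fine _)%:E * c%:E)%E]muleC.
Qed.

Definition ball3 (r : R) : set (R3 R) := [set x | norm3 x < r].

Lemma measurable_ball3 r : measurable (ball3 r).
Proof.
have -> : ball3 r = norm3 (R := R) @^-1` `]-oo, r[.
  by apply/seteqP; split => x; rewrite /ball3 /preimage /= in_itv.
by have := @measurable_norm3 R measurableT _ (measurable_itv `]-oo, r[); rewrite setTI.
Qed.

Lemma coord_le_norm3 x :
  [/\ `|x.1.1| <= norm3 x, `|x.1.2| <= norm3 x & `|x.2| <= norm3 x].
Proof.
have h (s t : R) : 0 <= t -> `|s| <= Num.sqrt (s * s + t).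
  by move=> t0; rewrite -sqrtr_sqr expr2 ler_wsqrtr// lerDl.
rewrite /norm3 dot3E; split.
- by rewrite -addrA; apply: h; rewrite -!expr2 addr_ge0 ?sqr_ge0.
- by rewrite addrAC addrC addrA -addrA; apply: h; rewrite -!expr2 addr_ge0 ?sqr_ge0.
- by rewrite addrC; apply: h; rewrite -!expr2 addr_ge0 ?sqr_ge0.
Qed.

Lemma ball3_cube n : ball3 n%:R `<=` @cube R n.
Proof.
move=> x; rewrite /ball3 /= => xn; have [h1 h2 h3] := coord_le_norm3 x.
by apply: mem_cube; apply: le_lt_trans xn.
Qed.

Lemma leb_ball3_fin (r : R) : (lam (ball3 r) < +oo)%E.
Proof.
have [n rn] : exists n, r <= n%:R.
  exists (Num.bound `|r|); apply: le_trans (ler_norm r) _; apply: ltW.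
  exact: archi_boundP.
apply: le_lt_trans (leb_box_fin (cst3 (- n%:R)) (cst3 n%:R)).
apply: le_measure; rewrite ?inE; [exact: measurable_ball3|exact: measurable_box|].
apply: subset_trans (@ball3_cube n) => x; rewrite /ball3 /= => /lt_le_trans; exact.
Qed.

Lemma leb_ball3_gt0 : (0 < lam (ball3 1))%E.
Proof.
have h : box (cst3 0) (cst3 (2^-1 : R)) `<=` ball3 1.
  move=> [[x y] z]; rewrite /box /ball3 /= !in_itv /=.
  move=> [[/andP[? ?] /andP[? ?]] /andP[? ?]].
  rewrite /norm3 -sqrtr1 ltr_sqrt// dot3E /= -!expr2.
  have e (u : R) : 0 < u -> u <= 2^-1 -> u ^+ 2 <= 4^-1 by move=> ? ?; nra.
  have := e x; have := e y; have := e z; lra.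
apply: lt_le_trans (_ : (lam (box (cst3 0) (cst3 2^-1)) <= _)%E).
  rewrite leb_box; last by split => /=; lra.
  by rewrite lte_fin /= !subr0 !mulr_gt0 ?invr_gt0.
by apply: le_measure; rewrite ?inE; [exact: measurable_box|exact: measurable_ball3|].
Qed.

(** The unit ball is a set of finite positive measure that k preserves. *)
Lemma leb_act k A : O3 k -> measurable A -> lam (act k @^-1` A) = lam A.
Proof.
move=> kO mA; rewrite -[RHS]mul1e.
apply: (@leb_scale_factor _ (act k^T) _ (ball3 1)) => //.
- exact: measurable_act.
- exact: act_add.
- exact: actKV.
- exact: measurable_ball3.
- by rewrite leb_ball3_gt0 leb_ball3_fin.
- rewrite mul1e; congr (lam _).
  by apply/seteqP; split => x; rewrite /ball3 /preimage /= norm3_act.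
Qed.

(** The factor can be computed on a cube. *)
Lemma leb_dilate (r : R) A : 0 < r -> measurable A ->
  (lam (scale3 r @^-1` A) = (r ^- 3)%:E * lam A)%E.
Proof.
move=> r0 mA; apply: (@leb_scale_factor _ (scale3 r^-1) _ (@cube R 1)) => //.
- exact: measurable_scale3.
- by move=> x y; rewrite /scale3 /add3 /=; congr ((_, _), _); ring.
- by move=> x; rewrite scale3M divff ?gt_eqF// scale31.
- exact: measurable_box.
- rewrite leb_box_fin andbT leb_box; last by split => /=; lra.
  by rewrite lte_fin /=; lra.
- have -> : scale3 r @^-1` @cube R 1 = box (cst3 (- r^-1)) (cst3 r^-1).
    have e (u : R) : (-1 < r * u <= 1) = (- r^-1 < u <= r^-1).
      by rewrite -ler_pdivlMl// -ltr_pdivrMl// mulr1 mulrN1.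
    by apply/seteqP; split => -[[x y] z]; rewrite /preimage /cube /box /= !in_itv /= !e.
  rewrite !leb_box; try by split => /=; rewrite ?gtrN ?invr_gt0//; lra.
  rewrite -EFinM /=; congr EFin; field; by rewrite gt_eqF.
Qed.

Lemma leb_ball3 (r : R) : 0 < r -> lam (ball3 r) = ((r ^+ 3)%:E * lam (ball3 1))%E.
Proof.
move=> r0; have := leb_dilate r0 (measurable_ball3 r).
have -> : scale3 r @^-1` ball3 r = ball3 1.
  apply/seteqP; split => x; rewrite /ball3 /preimage /= norm3_scale gtr0_norm//;
    by rewrite -ltr_pdivlMl// mulVf// gt_eqF.
by move=> ->; rewrite muleA -EFinM mulfV ?mul1e// expf_neq0// gt_eqF.
Qed.

End Invariance.

Section Polar.
Variable R : realType.
Variable sigma : probability (R3 R) R.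
Hypothesis Hsigma : is_sphere_measure sigma.
Implicit Types (x y : R3 R) (k : 'M[R]_3).
Local Notation lam := (leb R).

Lemma measurable_sphere : measurable (@sphere R).
Proof.
have -> : @sphere R = (fun x => dot3 x x) @^-1` [set 1] by apply/seteqP; split.
have m : measurable_fun setT (fun x : R3 R => dot3 x x) by exact: measurable_dot3.
by have := m measurableT _ (measurable_set1 1); rewrite setTI.
Qed.

Lemma sphere_ae : {ae sigma, forall x, sphere x}.
Proof.
exists (~` @sphere R); split.
- exact: measurableC measurable_sphere.
- by rewrite [LHS]probability_setC ?Hsigma.1 ?subee//; exact: measurable_sphere.
- by [].
Qed.

Lemma sigma_act k A : O3 k -> measurable A -> sigma (act k @^-1` A) = sigma A.
Proof. exact: Hsigma.2. Qed.

Lemma cintegrable_sigma (f : R3 R -> R[i]) (M : R) : cmeas f ->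
  (forall x, cabs (f x) <= M) -> cintegrable sigma setT f.
Proof.
have fin : (sigma setT < +oo)%E by rewrite probability_setT ltry.
by move=> mf fM; exact: cintegrable_finite fin mf fM.
Qed.

Lemma cint_sphere (f g : R3 R -> R[i]) : cmeas g -> (forall x, sphere x -> f x = g x) ->
  cint sigma (@sphere R) f = cint sigma setT g.
Proof.
move=> mg fg; rewrite (eq_cint sigma measurable_sphere fg).2.
rewrite (cint_restr _ _ measurable_sphere).2.
apply: ae_eq_cint => //.
  apply: cmeasM => //; apply: cmeas_real; apply: measurable_indic.
  exact: measurable_sphere.
by apply: filterS sphere_ae => x sx; rewrite /crestr indicE mem_set// mul1r.
Qed.

Let cmeas_expidot (z : R3 R) : cmeas (fun x : R3 R => expi (- dot3 z x)).
Proof. by apply: cmeas_expi; apply: measurable_funN; exact: measurable_dot3. Qed.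

(** The Fourier transform of sigma; invariance makes it radial. *)
Definition sigma_hat (z : R3 R) : R[i] := cint sigma setT (fun x => expi (- dot3 z x)).

Lemma sigma_hat_radial x y : dot3 x x = dot3 y y -> sigma_hat x = sigma_hat y.
Proof.
move=> /SO3_transitive[k [kO _] <-]; rewrite /sigma_hat.
have kO' := O3T kO.
rewrite -(cint_transfer (measurable_act k^T)
  (fun A mA => sigma_act kO' mA) (cmeas_expidot x)); last first.
  apply: (@cintegrable_sigma _ 2) => [|z]; last exact: cabs_expi.
  exact: (cmeas_comp (cmeas_expidot x) (measurable_act k^T)).
by congr cint; apply/funext => z /=; rewrite dot3_actr// trmxK.
Qed.

Lemma cmeas_ball3 (r : R) : cmeas (fun x => (\1_(ball3 r) x : R)%:C).
Proof. by apply: cmeas_real; apply: measurable_indic; exact: measurable_ball3. Qed.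

Lemma cintegrable_ball3 (r : R) : cintegrable lam setT (fun x => (\1_(ball3 r) x : R)%:C).
Proof.
by apply: cintegrable_indic; [exact: measurable_ball3|exact: leb_ball3_fin].
Qed.

Lemma cint_one : cint sigma setT (fun=> 1) = 1.
Proof.
apply: complex_ext; rewrite ?Re_cint ?Im_cint /Rintegral /=.
  by rewrite integral_cst//= probability_setT mul1e.
by rewrite integral0_eq.
Qed.

Definition polar (z : R3 R * R3 R) : R3 R := scale3 (norm3 z.1) z.2.

Lemma measurable_polar : measurable_fun setT polar.
Proof.
apply: measurable_scale3 => //.
exact: (measurableT_comp (@measurable_norm3 R) measurable_fst).
Qed.

Let lamsigma : {sigma_finite_measure set (R3 R * R3 R)%type -> \bar R} :=
  prod_sf lam sigma.

Let lamsigma_null N : measurable N -> sigma N = 0%E -> lamsigma (setT `*` N) = 0%E.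
Proof.
move=> mN N0; transitivity (lam setT * sigma N)%E; first exact: prod_sfE.
by rewrite N0 mule0.
Qed.

Let lamsigma_left B : measurable B -> lamsigma (B `*` setT) = lam B.
Proof.
move=> mB; transitivity (lam B * sigma setT)%E; first exact: prod_sfE.
by rewrite probability_setT mule1.
Qed.

Let ball_tensor (r : R) :
  cintegrable lamsigma setT (fun z : R3 R * R3 R => (\1_(ball3 r) z.1 : R)%:C).
Proof.
have one : cintegrable sigma setT (fun=> 1 : R[i]).
  by apply: (@cintegrable_sigma _ 1) => [|x]; [exact: cmeas_cst|rewrite cabs_real normr1].
have [+ _] := cint_tensor (cintegrable_ball3 r) one.
by under eq_fun do rewrite mulr1.
Qed.

(** Both transforms are the average over y of sigma_hat at a point of norm
    |x| |y|: the one of the ball because it is radial, hence equal to its own mean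
    over the sphere of radius |x|. *)
Lemma polar_ftrans (r : R) x :
  ftrans lam id (fun y => (\1_(ball3 r) y : R)%:C) x =
  ftrans lamsigma polar (fun z : R3 R * R3 R => (\1_(ball3 r) z.1 : R)%:C) x.
Proof.
pose h x := ftrans lam id (fun y => (\1_(ball3 r) y : R)%:C) x.
have mE2 : cmeas (fun z : R3 R * R3 R => expi (- dot3 z.1 z.2)).
  by apply: cmeas_expi; apply: measurable_funN; exact: measurable_dot3.
have h_act k y : O3 k -> h (act k y) = h y.
  move=> kO; rewrite /h /ftrans.
  have mf : cmeas (fun t => (\1_(ball3 r) t : R)%:C * expi (- dot3 t (act k y))).
    apply: cmeasM; first exact: cmeas_ball3.
    by apply: cmeas_expi; apply: measurable_funN; exact: measurable_dot3.
  rewrite -(cint_transfer (measurable_act k) (fun A mA => leb_act kO mA) mf); last first.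
    apply/(cintegrable_transfer (measurable_act k) (fun A mA => leb_act kO mA) mf).
    apply: cintegrableM_bounded (cintegrable_ball3 r) _ (fun t => cabs_expi _).
    by apply: cmeas_expi; apply: measurable_funN; exact: measurable_dot3.
  congr cint; apply/funext => t /=; rewrite dot3_act//; congr (_%:C * _).
  by rewrite !indicE; congr (_%:R); congr nat_of_bool; apply/idP/idP => /set_mem H;
    apply/mem_set; move: H; rewrite /ball3 /= norm3_act.
have h_dot y z : dot3 y y = dot3 z z -> h y = h z.
  by move=> /SO3_transitive[k [kO _] <-]; rewrite h_act.
have one : cintegrable sigma setT (fun=> 1 : R[i]).
  by apply: (@cintegrable_sigma _ 1) => [|u]; [exact: cmeas_cst|rewrite cabs_real normr1].
pose e (z : R3 R * R3 R) : R[i] := expi (- dot3 z.1 (scale3 (norm3 x) z.2)).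
have me : cmeas e.
  apply: cmeas_expi; apply: measurable_funN; apply: measurable_dot3 => //.
  exact: measurable_scale3.
have [_ _ e1 e2] := cint_fubini (cintegrable_tensor (cintegrable_ball3 r) one me
  (fun z => cabs_expi _)).
transitivity (cint sigma setT (fun xi => h (scale3 (norm3 x) xi))).
  rewrite -[LHS]mulr1 -cint_one.
  rewrite -cintZ//; apply: ae_eq_cint.
  - exact: cmeas_cst.
  - have mh : cmeas h.
      pose H (z : R3 R * R3 R) : R[i] := (\1_(ball3 r) z.2 : R)%:C * expi (- dot3 z.2 z.1).
      apply: (@cmeas_cint R _ _ _ _ lam H); apply: cmeasM.
        exact: (cmeas_comp (cmeas_ball3 r) measurable_snd).
      by apply: cmeas_expi; apply: measurable_funN; exact: measurable_dot3.
    by apply: (cmeas_comp mh); exact: measurable_scale3.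
  apply: filterS sphere_ae => xi sxi; rewrite mulr1; apply: h_dot.
  by rewrite dot3Zl dot3Zr sxi mulr1 -expr2 norm3_sqr.
transitivity (cint sigma setT (fun xi => cint lam setT (fun y =>
    (\1_(ball3 r) y : R)%:C * 1 * e (y, xi)))).
  congr cint; apply/funext => xi; rewrite /h /ftrans.
  by congr cint; apply/funext => y; rewrite mulr1.
rewrite e2 -e1.
have mp : cmeas (fun z : R3 R * R3 R => expi (- dot3 (polar z) x)).
  apply: cmeas_expi; apply: measurable_funN; apply: measurable_dot3 => //.
  exact: measurable_polar.
have [_ _ f1 _] := cint_fubini (m1 := lam) (m2 := sigma)
  (cintegrableM_bounded (ball_tensor r) mp (fun z => cabs_expi _)).
transitivity (cint lam setT (fun y => cint sigma setT (fun xi =>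
    (\1_(ball3 r) y : R)%:C * expi (- dot3 (polar (y, xi)) x)))); last exact: f1.
congr cint; apply/funext => y /=.
have i z : cintegrable sigma setT (fun xi => expi (- dot3 z xi)).
  by apply: (@cintegrable_sigma _ 2) => [|u]; [exact: cmeas_expidot|exact: cabs_expi].
transitivity ((\1_(ball3 r) y : R)%:C * sigma_hat (scale3 (norm3 x) y)).
  rewrite -cintZ//; congr cint; apply/funext => xi.
  by rewrite mulr1 /e /= dot3Zl dot3Zr.
transitivity ((\1_(ball3 r) y : R)%:C * sigma_hat (scale3 (norm3 y) x)).
  congr (_ * _); apply: sigma_hat_radial.
  by rewrite !dot3Zl !dot3Zr -!norm3_sqr; ring.
rewrite -cintZ//; congr cint; apply/funext => xi.
by rewrite /polar /= !dot3Zl dot3C.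
Qed.

(** Replacing the direction of a vector by an independent one of law sigma preserves
    Lebesgue measure: it preserves balls, and on each ball the two measures are
    finite and have the same Fourier transform. *)
Lemma polar_measure A : measurable A -> lamsigma (polar @^-1` A) = lam A.
Proof.
have pre B : measurable B -> measurable (polar @^-1` B).
  by move=> mB; have := measurable_polar measurableT mB; rewrite setTI.
have eqb a b : lt3 a b -> lamsigma (polar @^-1` box a b) = lam (box a b).
  move=> ab; have [n bn] : exists n, box a b `<=` ball3 n%:R.
    pose s := `|a.1.1| + `|b.1.1| + `|a.1.2| + `|b.1.2| + `|a.2| + `|b.2|.
    have s0 : 0 <= s by rewrite !addr_ge0.
    exists (Num.bound (2 * s)); move=> [[x y] z]; rewrite /box /= !in_itv /=.
    move=> [[/andP[? ?] /andP[? ?]] /andP[? ?]].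
    rewrite /ball3 /=; apply: le_lt_trans (archi_boundP _); last by rewrite mulr_ge0.
    rewrite -[leRHS]ger0_norm ?mulr_ge0// -sqrtr_sqr /norm3 ler_wsqrtr// dot3E /=.
    have hs (u p q : R) : p < u -> u <= q -> `|p| + `|q| <= s -> u ^+ 2 <= s ^+ 2.
      move=> h1 h2 h3; rewrite -[leLHS]real_normK ?num_real// ler_sqr ?nnegrE//.
      rewrite ler_norml; have := ler_norm q; have := ler_norm (- p); rewrite normrN.
      by have := normr_ge0 p; have := normr_ge0 q; move=> *; apply/andP; split; lra.
    rewrite -!expr2; have := normr_ge0 a.1.1; have := normr_ge0 b.1.1.
    have := normr_ge0 a.1.2; have := normr_ge0 b.1.2; have := normr_ge0 a.2.
    have := normr_ge0 b.2; move=> p1 p2 p3 p4 p5 p6.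
    have g1 : x ^+ 2 <= s ^+ 2 by apply: (hs x a.1.1 b.1.1) => //; rewrite /s; lra.
    have g2 : y ^+ 2 <= s ^+ 2 by apply: (hs y a.1.2 b.1.2) => //; rewrite /s; lra.
    have g3 : z ^+ 2 <= s ^+ 2 by apply: (hs z a.2 b.2) => //; rewrite /s; lra.
    by rewrite exprMn; have := sqr_ge0 s; lra.
  have := ftrans_inj (@measurable_id _ _ setT) measurable_polar
    (cintegrable_ball3 n%:R) (ball_tensor n%:R) (polar_ftrans n%:R) ab.
  have mb := measurable_box a b.
  rewrite (_ : (fun t => _) = (fun t => (\1_(box a b) t : R)%:C)); last first.
    apply/funext => t /=; rewrite -rmorphM; congr (_%:C).
    rewrite !indicE; have [/set_mem tb|] := boolP (t \in box a b); last by rewrite mulr0.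
    by rewrite mem_set ?mulr1//; exact: bn.
  have mpb := pre _ mb.
  have -> : cint lamsigma setT (fun t => (\1_(ball3 n%:R) t.1)%:C *
      (\1_(box a b) (polar t))%:C) =
      cint lamsigma setT (fun z => (\1_(polar @^-1` box a b) z : R)%:C).
    apply: ae_eq_cint.
    - apply: cmeasM; first exact: (cmeas_comp (cmeas_ball3 n%:R) measurable_fst).
      have mB : cmeas (fun u => (\1_(box a b) u : R)%:C).
        by apply: cmeas_real; exact: measurable_indic.
      exact: (cmeas_comp mB measurable_polar).
    - by apply: cmeas_real; exact: measurable_indic.
    have [N [mN N0 sN]] := sphere_ae.
    exists (setT `*` N); split.
    - exact: measurableX.
    - exact: lamsigma_null.
    - move=> [y xi] /= H; split=> //; apply: sN => /= sxi; apply: H.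
      rewrite -rmorphM; congr (_%:C); rewrite !indicE /preimage.
      have -> : ((y, xi) \in [set t | box a b (polar t)]) = (polar (y, xi) \in box a b).
        by apply/idP/idP => /set_mem h; exact/mem_set.
      have [/set_mem pb|] := boolP (polar (y, xi) \in box a b); last by rewrite mulr0.
      rewrite mem_set ?mulr1//.
      have := bn _ pb; rewrite /ball3 /= /polar /= norm3_scale.
      by rewrite ger0_norm ?norm3_ge0// (norm3_sphere sxi) mulr1.
  move=> /(congr1 (@complex.Re R)); rewrite !Re_cint /= /Rintegral.
  rewrite !integral_indic ?setIT// => e.
  have fin1 : lam (box a b) \is a fin_num by rewrite ge0_fin_numE ?leb_box_fin.
  have fin2 : lamsigma (polar @^-1` box a b) \is a fin_num.
    rewrite ge0_fin_numE//.
    apply: (@le_lt_trans _ _ (lamsigma (ball3 n%:R `*` setT `|` setT `*` ~` @sphere R))).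
      apply: le_measure; rewrite ?inE//.
        apply: measurableU; apply: measurableX => //; first exact: measurable_ball3.
        exact: measurableC measurable_sphere.
      move=> [y xi] pb; have [sxi|nsxi] := pselect (sphere xi); last by right.
      left; split=> //; have := bn _ pb; rewrite /ball3 /= /polar /= norm3_scale.
      by rewrite ger0_norm ?norm3_ge0// (norm3_sphere sxi) mulr1.
    have mS : measurable (~` @sphere R) by exact: measurableC measurable_sphere.
    have mBn := measurable_ball3 (n%:R : R).
    apply: le_lt_trans (measureU2 _ _ _) _; try exact: measurableX.
    have s0 : sigma (~` @sphere R) = 0%E.
      by rewrite [LHS]probability_setC ?Hsigma.1 ?subee//; exact: measurable_sphere.
    apply: lte_add_pinfty.
      by have := leb_ball3_fin (n%:R : R); rewrite -(lamsigma_left mBn).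
    by rewrite [X in (X < _)%E](lamsigma_null mS s0).
  by rewrite -(fineK fin1) -(fineK fin2); congr EFin.
move=> mA.
apply: (box_measure_unique (m1 := pushforward lamsigma polar)) mA.
- exact: measurable_polar.
- by move=> mp; exact: eqb.
move=> mp n; rewrite /pushforward.
have [ab|/box_degenerate e] := pselect (lt3 (cst3 (- n%:R)) (cst3 (n%:R : R))).
  have h : (lamsigma (polar @^-1` box (cst3 (- n%:R)) (cst3 (n%:R : R))) < +oo)%E.
    by rewrite (eqb _ _ ab); exact: leb_box_fin.
  exact: h.
have h : (lamsigma (polar @^-1` cube n) < +oo)%E.
  by rewrite (_ : polar @^-1` cube n = set0) ?measure0// /cube e.
exact: h.
Qed.

(** The radius still appears as the norm of a vector y, of which only the law of |y|
    matters. *)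
Lemma cint_polar (f : R3 R -> R[i]) : cintegrable lam setT f ->
  [/\ cintegrable lam setT (fun y => cint sigma setT (fun xi => f (polar (y, xi)))) &
    cint lam setT (fun y => cint sigma setT (fun xi => f (polar (y, xi)))) =
    cint lam setT f].
Proof.
move=> fi; have mf := cintegrable_cmeas fi.
have pi : cintegrable lamsigma setT (f \o polar).
  exact/(cintegrable_transfer measurable_polar polar_measure mf).
have [i1 _ e1 _] := cint_fubini (m1 := lam) (m2 := sigma) pi.
split=> //; rewrite e1.
by rewrite -(cint_transfer measurable_polar polar_measure mf pi).
Qed.

End Polar.

Section Density.
Import HBNNSimple.
Context d (T : measurableType d) (R : realType).
Variable mu : {measure set T -> \bar R}.
Variable w : T -> R.
Hypotheses (mw : measurable_fun setT w) (w0 : forall x, 0 <= w x).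

Definition dens (A : set T) : \bar R := (\int[mu]_(x in A) (w x)%:E)%E.

Let dens0 : dens set0 = 0%E.
Proof. by rewrite /dens integral_set0. Qed.

Let dens_ge0 A : (0 <= dens A)%E.
Proof. by apply: integral_ge0 => x _; rewrite lee_fin. Qed.

Let dens_sigma_additive : semi_sigma_additive dens.
Proof.
move=> F mF tF mUF; rewrite /dens ge0_integral_bigcup//.
- apply: is_cvg_ereal_nneg_natsum_cond => n _ _.
  by apply: integral_ge0 => x _; rewrite lee_fin.
- by apply/measurable_EFinP; exact: measurable_funTS.
- by move=> x _; rewrite lee_fin.
Qed.

HB.instance Definition _ :=
  isMeasure.Build _ _ _ dens dens0 dens_ge0 dens_sigma_additive.

Definition densm : {measure set T -> \bar R} := dens.

Lemma ge0_integral_dens (f : T -> \bar R) : measurable_fun setT f ->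
  (forall x, 0 <= f x)%E ->
  (\int[densm]_x f x = \int[mu]_x (f x * (w x)%:E))%E.
Proof.
move=> mf f0.
have wE0 x : (0 <= (w x)%:E)%E by rewrite lee_fin.
have mwE : measurable_fun setT (EFin \o w) by exact/measurable_EFinP.
pose g := nnsfun_approx measurableT mf.
have gf x : (EFin \o g ^~ x) @ \oo --> f x by apply: cvg_nnsfun_approx.
have ndg m n x : (m <= n)%N -> (g m x <= g n x)%R.
  by move=> mn; have /lefP/(_ x) := nd_nnsfun_approx measurableT mf mn.
transitivity (limn (fun n => \int[densm]_x (g n x)%:E)%E).
  apply/esym/cvg_lim => //.
  have -> : (\int[densm]_x f x = \int[densm]_x limn (fun n => (g n x)%:E))%E.
    by apply: eq_integral => x _; apply/esym/cvg_lim => //; exact: gf.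
  apply: cvg_monotone_convergence => //.
  - by move=> n; exact/measurable_EFinP.
  - by move=> n x _; rewrite lee_fin.
  - by move=> x _ m n mn; rewrite lee_fin; exact: ndg.
transitivity (limn (fun n => \int[mu]_x ((g n x)%:E * (w x)%:E))%E); last first.
  apply/cvg_lim => //.
  have -> : (\int[mu]_x (f x * (w x)%:E) =
      \int[mu]_x limn (fun n => (g n x)%:E * (w x)%:E))%E.
    apply: eq_integral => x _; apply/esym/cvg_lim => //.
    by apply: cvgeMr => //; exact: gf.
  apply: cvg_monotone_convergence => //.
  - by move=> n; apply: emeasurable_funM => //; exact/measurable_EFinP.
  - by move=> n x _; apply: mule_ge0 => //; rewrite lee_fin.
  - by move=> x _ m n mn; apply: lee_wpmul2r => //; rewrite lee_fin; exact: ndg.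
congr (limn _); apply/funext => n.
rewrite integralT_nnsfun sintegralE.
under [RHS]eq_integral => x _.
  rewrite (fimfunE (g n)) -fsumEFin// ge0_mule_fsuml; last first.
    by move=> y; rewrite EFinM; exact: nnfun_muleindic_ge0.
  over.
rewrite ge0_integral_fsum//; last 2 first.
- move=> y; apply: emeasurable_funM => //; apply/measurable_EFinP.
  by apply: measurable_funM.
- move=> y x _; apply: mule_ge0 => //; rewrite EFinM; exact: nnfun_muleindic_ge0.
apply: eq_fsbigr => y; rewrite inE => -[x _ yx].
have y0 : 0 <= y by rewrite -yx.
have mA : measurable (g n @^-1` [set y]) by exact: measurable_sfunP.
under [RHS]eq_integral do rewrite EFinM -muleA.
rewrite ge0_integralZl//; last 2 first.
- by apply: emeasurable_funM => //; apply/measurable_EFinP; exact: measurable_indic.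
- by move=> z _; apply: mule_ge0 => //; rewrite lee_fin.
congr (_ * _)%E; rewrite /densm /= /dens [LHS]integral_mkcond.
apply: eq_integral => z _; rewrite patchE indicE.
by case: (_ \in _); rewrite ?mul1e ?mul0e.
Qed.

Lemma cintegrable_dens (f : T -> R[i]) : cmeas f -> cintegrable densm setT f ->
  cintegrable mu setT (fun x => (w x)%:C * f x) /\
  cint mu setT (fun x => (w x)%:C * f x) = cint densm setT f.
Proof.
move=> mf [f1 f2].
have real (h : T -> R) : measurable_fun setT h -> densm.-integrable setT (EFin \o h) ->
    mu.-integrable setT (fun x => (w x * h x)%:E) /\
    (\int[mu]_x (w x * h x)%:E = \int[densm]_x (h x)%:E)%E.
  move=> mh /integrableP[_ hfin]; have mhE := (measurable_EFinP _ _).2 mh.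
  split.
    apply/integrableP; split; first by apply/measurable_EFinP; exact: measurable_funM.
    move: hfin; rewrite ge0_integral_dens//; last exact: measurableT_comp.
    rewrite (eq_integral (fun x => `|(w x * h x)%:E|)%E)// => x _ /=.
    by rewrite normrM (ger0_norm (w0 x)) mulrC EFinM.
  rewrite integralE [RHS]integralE !ge0_integral_dens//;
    try exact: measurable_funepos; try exact: measurable_funeneg.
  have maxM x (t : R) : (maxe (w x * t)%:E 0 = maxe t%:E 0 * (w x)%:E)%E.
    by rewrite -!EFin_max -EFinM [in RHS]mulrC maxr_pMr// mulr0.
  congr (_ - _)%E; apply: eq_integral => x _.
    by rewrite !funeposE maxM.
  by rewrite !funenegE -!EFinN -mulrN maxM.
have [i1 e1] := real _ mf.1 f1; have [i2 e2] := real _ mf.2 f2.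
split.
  split.
    by under eq_fun do rewrite ReM /= mul0r subr0.
  by under eq_fun do rewrite ImM /= mul0r addr0.
apply: complex_ext; rewrite ?Re_cint ?Im_cint.
  by under eq_Rintegral do rewrite ReM /= mul0r subr0; rewrite /Rintegral e1.
by under eq_Rintegral do rewrite ImM /= mul0r addr0; rewrite /Rintegral e2.
Qed.

End Density.

Section GaussMoment.
Variable R : realType.
Local Notation M := (measurableTypeR R).
Local Notation mu := (@lebesgue_measure R).
Local Notation P := (`]0, +oo[%classic : set R).

Let g (s : R) := 2 * s * gauss_fun s.

Let mg : measurable_fun setT g.
Proof.
apply: measurable_funM; last exact: measurable_gauss_fun.
by apply: measurable_funM.
Qed.

Let cg : continuous g.
Proof.
by apply: ctM; [apply: ctZ; exact: ct_id|exact: continuous_gauss_fun].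
Qed.

Let dg (s : R) : is_derive s (1 : R) (fun s => - gauss_fun s) (g s).
Proof.
have d1 : is_derive s 1 (fun s : R => - (s ^+ 2)) (- (2 * s)).
  apply: dvN; have := dvM (is_derive_id s (1 : R)) (is_derive_id s (1 : R)).
  by move=> /is_derive_eq; apply; rewrite mul1r mulr1; ring.
have := dvN (@dv_comp R expR (fun s => - s ^+ 2) s _ _ (is_derive_expR _) d1).
by move=> /is_derive_eq; apply; rewrite /g /gauss_fun; ring.
Qed.

Let tail (r : R) : 0 <= r ->
  (\int[mu]_(s in `[r, +oo[) (g s)%:E = (gauss_fun r)%:E)%E.
Proof.
move=> r0.
have h0 s : r <= s -> 0 <= g s.
  by move=> rs; rewrite /g !mulr_ge0 ?gauss_fun_ge0//; apply: le_trans rs.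
have hl : - gauss_fun s @[s --> +oo%R] --> (0 : R).
  by rewrite -oppr0; apply: cvgN; exact: cvg_gauss_fun.
by rewrite (ftc_half_line h0 cg dg hl) opprK add0r.
Qed.

Let mP : measurable_fun setT (\1_P : M -> R).
Proof. by apply: measurable_indic; exact: measurable_itv. Qed.

(** Tonelli for 2 s e^{-s^2} on the region 0 < r < s; it replaces an integration
    by parts on the half-line. *)
Lemma gauss_second_moment :
  (\int[mu]_s (\1_P s * (2 * (s ^+ 2 * gauss_fun s)))%:E = (Num.sqrt pi / 2)%:E)%E.
Proof.
pose f (z : M * M) := ((\1_P z.1 * \1_P (z.2 - z.1) * g z.2 : R)%:E)%E.
have mf : measurable_fun setT f.
  apply/measurable_EFinP; apply: measurable_funM; last first.
    exact: (measurableT_comp mg measurable_snd).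
  apply: measurable_funM; first exact: (measurableT_comp mP measurable_fst).
  apply: (measurableT_comp mP).
  by apply: measurable_funB.
have f0 z : (0 <= f z)%E.
  rewrite lee_fin !indicE !mem_setE !in_itv /= !andbT subr_gt0.
  case: ltP => [r0|_]; last by rewrite !mul0r.
  case: ltP => [rs|_]; last by rewrite mulr0 mul0r.
  rewrite !mul1r !mulr_ge0 ?gauss_fun_ge0//; apply: ltW; exact: lt_trans rs.
have fr r : (\int[mu]_s f (r, s) = (\1_P r * gauss_fun r)%:E)%E.
  rewrite /f /=; have [r0|r0] := ltP 0 r; last first.
    have -> : \1_P r = 0 :> R by rewrite indicE mem_setE in_itv /= andbT ltNge r0.
    by rewrite mul0r integral0_eq// => s _; rewrite !mul0r.
  have -> : \1_P r = 1 :> R by rewrite indicE mem_setE in_itv /= andbT r0.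
  rewrite mul1r -tail ?ltW// -integral_itv_obnd_cbnd; last first.
    by apply/measurable_EFinP; exact: measurable_funTS.
  rewrite [RHS]integral_mkcond; apply: eq_integral => s _.
  rewrite patchE mem_setE !indicE mem_setE !in_itv /= !andbT subr_gt0 mul1r.
  by case: ifP; rewrite ?mul1r ?mul0r.
have fs s : (\int[mu]_r f (r, s) = (\1_P s * (2 * (s ^+ 2 * gauss_fun s)))%:E)%E.
  have -> : (\int[mu]_r f (r, s) = \int[mu]_r ((g s)%:E * (\1_(`]0%R, s[) r)%:E))%E.
    apply: eq_integral => r _; rewrite -EFinM /f /= mulrC; congr (_ * _)%:E.
    rewrite !indicE !mem_setE !in_itv /= !andbT subr_gt0.
    by case: (0 < r); rewrite ?mul1r ?mul0r.
  rewrite integralZl//; last first.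
    by apply: integrable_indic_itv.
  rewrite integral_indic// setIT.
  have e : (mu `]0%R, s[ = (\1_P s * s)%:E)%E.
    rewrite [LHS]lebesgue_measure_itv /= lte_fin indicE mem_setE in_itv /= andbT.
    by case: ltP; rewrite ?mul0r// => _; rewrite mul1r oppr0 adde0.
  transitivity ((g s)%:E * (\1_P s * s)%:E)%E; first by congr (_ * _)%E; exact: e.
  by rewrite -EFinM; congr EFin; rewrite /g; ring.
transitivity (\int[mu]_s \int[mu]_r f (r, s))%E.
  by apply: eq_integral => s _; rewrite fs.
rewrite -(fubini_tonelli (m1 := mu) (m2 := mu) f)//.
rewrite -integral0y_gauss -integral_itv_obnd_cbnd; last first.
  by apply/measurable_EFinP; apply: measurable_funTS; exact: measurable_gauss_fun.
rewrite [RHS]integral_mkcond; apply: eq_integral => r _.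
by rewrite fr patchE mem_setE indicE mem_setE; case: ifP; rewrite ?mul1r ?mul0r.
Qed.

End GaussMoment.

Section Radial.
Variable R : realType.
Local Notation M := (measurableTypeR R).
Local Notation mu := (@lebesgue_measure R).
Local Notation lam := (leb R).
Local Notation P := (`]0, +oo[%classic : set R).

Let c0 : R := fine (lam (ball3 1)).

Let c0_gt0 : 0 < c0.
Proof. by rewrite fine_gt0// leb_ball3_gt0 leb_ball3_fin. Qed.

Let w (r : R) : R := \1_P r * (3 * c0 * r ^+ 2).

Let w0 r : 0 <= w r.
Proof.
by apply: mulr_ge0 => //; apply: mulr_ge0; [apply: mulr_ge0 => //; exact: ltW|exact: sqr_ge0].
Qed.

Let mw : measurable_fun setT (w : M -> R).
Proof.
apply: measurable_funM; first by apply: measurable_indic; exact: measurable_itv.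
by apply: measurable_funM => //; exact: measurable_funX.
Qed.

Let lam_ray (b : R) : lam (norm3 (R := R) @^-1` `]-oo, b[) = dens mu w `]-oo, b[.
Proof.
have -> : norm3 (R := R) @^-1` `]-oo, b[ = ball3 b.
  by apply/seteqP; split => x; rewrite /ball3 /preimage /= in_itv.
rewrite /dens; have [b0|b0] := ltP 0 b; last first.
  rewrite (_ : ball3 b = set0); last first.
    apply/seteqP; split=> // x; rewrite /ball3 /= => /lt_le_trans/(_ b0).
    by rewrite ltNge norm3_ge0.
  rewrite measure0 integral0_eq// => r; rewrite /= in_itv /= => rb.
  rewrite /w indicE mem_setE in_itv /= andbT.
  by rewrite (negbTE (_ : ~~ (0 < r))) ?mul0r// -leNgt ltW// (lt_le_trans rb).
rewrite leb_ball3//.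
have fin : lam (ball3 1) \is a fin_num by rewrite ge0_fin_numE ?leb_ball3_fin.
rewrite -(fineK fin) -/c0 -EFinM.
transitivity (\int[mu]_(r in `[0%R, b]) (3 * c0 * r ^+ 2)%:E)%E.
  have dF (r : R) : is_derive r (1 : R) (fun r => c0 * (r * r * r)) (3 * c0 * r ^+ 2).
    have i := is_derive_id r (1 : R).
    have := dvZ c0 (dvM (dvM i i) i).
    by move=> /is_derive_eq; apply; ring.
  have cf : continuous (fun r : R => 3 * c0 * r ^+ 2).
    by apply: ctZ => r; exact: exprn_continuous.
  by rewrite (ftc_segment b0 cf dF); congr EFin; ring.
have mf : measurable_fun setT (fun r : R => (3 * c0 * r ^+ 2)%:E).
  by apply/measurable_EFinP; apply: measurable_funM => //; exact: measurable_funX.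
rewrite -integral_itv_obnd_cbnd; last exact: measurable_funTS.
rewrite -integral_itv_bndo_bndc; last exact: measurable_funTS.
rewrite [LHS]integral_mkcond [RHS]integral_mkcond; apply: eq_integral => r _.
rewrite !patchE !mem_setE /w indicE mem_setE !in_itv /= ?andbT.
by case: (0 < r) => /=; case: ifP; rewrite ?mul1r ?mul0r.
Qed.

Let ray_measure_unique (m1 m2 : {measure set M -> \bar R}) :
  (forall b, m1 `]-oo, b[%classic = m2 `]-oo, b[%classic) ->
  (forall b, (m1 `]-oo, b[%classic < +oo)%E) ->
  forall A, measurable A -> m1 A = m2 A.
Proof.
move=> e fin A mA.
apply: (@g_sigma_algebra_measure_unique _ R M (@RGenInftyO.G R) _
  (fun n => `]-oo, n%:R[%classic)).
- by move=> _ [b ->]; exact: measurable_itv.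
- by move=> n; exists n%:R.
- rewrite -subTset => r _; exists (Num.bound `|r|) => //=; rewrite in_itv /=.
  by apply: le_lt_trans (ler_norm r) _; exact: archi_boundP.
- move=> _ _ [a ->] [b ->]; exists (Num.min a b).
  apply/seteqP; split => r /=; rewrite !in_itv /= lt_min.
    by move=> [-> ->].
  by move=> /andP[].
- by move=> _ [b ->]; exact: e.
- by move=> n; exact: fin.
- by have := mA; rewrite RGenInftyO.measurableE.
Qed.

Let radial_measure (A : set M) : measurable A ->
  lam (norm3 (R := R) @^-1` A) = densm mu mw w0 A.
Proof.
move=> mA.
have mn : measurable_fun setT (norm3 (R := R) : R3 R -> M) by exact: measurable_norm3.
have uniq := ray_measure_unique
  (m1 := pushforward lam (norm3 (R := R) : R3 R -> M)) (m2 := densm mu mw w0).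
apply: (uniq mn _ _ _ mA) => b; first exact: lam_ray.
have h : (lam (norm3 (R := R) @^-1` `]-oo, b[) < +oo)%E.
  have -> : norm3 (R := R) @^-1` `]-oo, b[ = ball3 b.
    by apply/seteqP; split => x; rewrite /ball3 /preimage /= in_itv.
  exact: leb_ball3_fin.
exact: h.
Qed.

Let cint_radial (H : M -> R[i]) : cmeas H -> cintegrable lam setT (H \o norm3 (R := R)) ->
  cintegrable mu setT (fun r => (w r)%:C * H r) /\
  cint mu setT (fun r => (w r)%:C * H r) = cint lam setT (H \o norm3 (R := R)).
Proof.
move=> mH Hi.
have mn : measurable_fun setT (norm3 (R := R) : R3 R -> M) by exact: measurable_norm3.
have Hd := (cintegrable_transfer mn radial_measure mH).1 Hi.
have [i e] := cintegrable_dens mH Hd; split=> //.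
by rewrite e (cint_transfer mn radial_measure mH Hi).
Qed.

(** The integral of the Gaussian is computed in Cartesian and in polar
    coordinates. *)
Lemma volume_ball3 : fine (lam (ball3 1)) = 4 * pi / 3.
Proof.
rewrite -/c0; pose G (r : M) : R[i] := (gauss_fun r)%:C.
have Gi : cintegrable mu setT G.
  by split; [exact: integrableT_gauss|exact: integrable0].
have GE : cint mu setT G = (Num.sqrt pi)%:C.
  apply: complex_ext; rewrite ?Re_cint ?Im_cint /Rintegral /=.
    by rewrite integralT_gauss.
  by rewrite integral0_eq.
have [G3i G3] := cint_tensor3 Gi Gi Gi.
have E : (fun x : R3 R => G x.1.1 * G x.1.2 * G x.2) = G \o norm3 (R := R).
  apply/funext => x /=; rewrite /G /gauss_fun -!rmorphM -!expRD norm3_sqr dot3E.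
  by congr ((expR _)%:C); rewrite -!expr2; ring.
rewrite E GE in G3i G3.
have mG : cmeas G by exact: cintegrable_cmeas Gi.
have [_] := cint_radial mG G3i; rewrite G3 => /(congr1 (@complex.Re R)).
rewrite Re_cint -!rmorphM /=.
have -> : \int[mu]_r complex.Re ((w r)%:C * G r) =
    fine ((3 * c0 / 2)%:E *
      \int[mu]_r (\1_P r * (2 * (r ^+ 2 * gauss_fun r)))%:E)%E.
  have q0 : 0 <= 3 * c0 / 2 by rewrite !mulr_ge0 ?invr_ge0// ltW.
  rewrite -ge0_integralZl//; last 2 first.
  - apply/measurable_EFinP; apply: measurable_funM.
      by apply: measurable_indic; exact: measurable_itv.
    apply: measurable_funM => //; apply: measurable_funM; first exact: measurable_funX.
    exact: measurable_gauss_fun.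
  - move=> r _; rewrite lee_fin; apply: mulr_ge0 => //; apply: mulr_ge0 => //.
    by apply: mulr_ge0; [exact: sqr_ge0|exact: gauss_fun_ge0].
  rewrite /Rintegral; congr fine; apply: eq_integral => r _.
  by rewrite ReM /= mul0r subr0 -EFinM /w; congr EFin; field.
rewrite gauss_second_moment /= => e.
have p0 : 0 <= pi :> R by exact: pi_ge0.
have s0 : Num.sqrt pi != 0 :> R by rewrite gt_eqF// sqrtr_gt0 pi_gt0.
have e2 : 3 * c0 = 4 * (Num.sqrt pi * Num.sqrt pi).
  move: (Num.sqrt pi) e s0 => s e s0; apply: (mulIf s0).
  have -> : 4 * (s * s) * s = 4 * (s * s * s) by ring.
  by rewrite -e; field.
rewrite -expr2 sqr_sqrtr// in e2.
apply: (@mulfI _ 3); first by rewrite pnatr_eq0.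
by rewrite e2; move: (pi : R) => p; field.
Qed.

Variable sigma : probability (R3 R) R.
Hypothesis Hsigma : is_sphere_measure sigma.

(** By [cint_polar] the integral only involves the law of |y|.  By dilation a ball
    of radius r has r^3 times the volume of the unit ball, so that this law has
    density 4 pi r^2. *)
Theorem polar_coordinates (f : R3 R -> R[i]) : cintegrable lam setT f ->
  cintegrable mu P (fun r => (4 * pi * r ^+ 2)%:C *
    cint sigma setT (fun xi => f (scale3 r xi))) /\
  cint mu P (fun r => (4 * pi * r ^+ 2)%:C *
    cint sigma setT (fun xi => f (scale3 r xi))) = cint lam setT f.
Proof.
move=> fi; have mf := cintegrable_cmeas fi; have [i1 e1] := cint_polar Hsigma fi.
pose H (r : M) := cint sigma setT (fun xi => f (scale3 r xi)).
have mH : cmeas H.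
  pose h (z : M * R3 R) := f (scale3 z.1 z.2).
  apply: (@cmeas_cint R _ _ _ _ sigma h); apply: (cmeas_comp mf).
  exact: measurable_scale3.
have [i2 e2] := cint_radial mH i1.
have mP : measurable (P : set M) by exact: measurable_itv.
have wE : crestr P (fun r => (4 * pi * r ^+ 2)%:C * H r) = fun r => (w r)%:C * H r.
  apply/funext => r; rewrite /crestr mulrA -rmorphM; congr (_%:C * _).
  rewrite /w /c0 volume_ball3; congr (_ * _).
  by move: (pi : R) => p; field.
pose Q (r : M) := (4 * pi * r ^+ 2)%:C * H r.
have QE : crestr P Q = fun r => (w r)%:C * H r := wE.
have i3 : cintegrable mu setT (crestr P Q) by rewrite QE.
have e3 : cint mu setT (crestr P Q) = cint lam setT f by rewrite QE e2.
split; first exact/(cint_restr mu Q mP).1.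
exact: etrans (cint_restr mu Q mP).2 e3.
Qed.

End Radial.

(** * The derived representation *)

Section OrthogonalProjection.
Variables (R : realType) (m n : nat) (lam : 'I_n -> R[i]).
Hypothesis lam_inj : injective lam.
Variable ip : {dot H R m for @Num.conj R[i]}.
Variable T : 'End(H R m).
Hypothesis Td : eigenspaces_span lam T.
Hypothesis orth : forall i j u v, T u = lam i *: u -> T v = lam j *: v -> i != j ->
  ip u v = 0.

Lemma mem_leigenspace (a : R[i]) (u : H R m) :
  (u \in passmx.leigenspace T a) = (T u == a *: u).
Proof. by rewrite memv_ker add_lfunE opp_lfunE scale_lfunE id_lfunE subr_eq0. Qed.

(** The orthogonal projection onto an eigenspace is a polynomial in T when the
    eigenspaces are orthogonal. *)
Lemma orth_projE j : orth_proj ip (passmx.leigenspace T (lam j)) = lagrange lam T j.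
Proof.
set U := passmx.leigenspace _ _; set W := orthov ip U.
have UW0 : (U :&: W = 0)%VS.
  apply/eqP; rewrite -subv0; apply/subvP => u; rewrite memv_cap => /andP[uU uW].
  rewrite memv0 -(dnorm_eq0 ip); apply/eqP.
  by move: uW => /mem_orthovP; apply.
have WU0 : (W :&: U = 0)%VS by rewrite capvC.
apply/lfunP => v; rewrite /orth_proj -{1}(sum_lagrange lam_inj Td v).
rewrite linear_sum (bigD1 j) //= big1 ?addr0 => [|i ij].
  by rewrite daddv_pi_id// mem_leigenspace (lagrangeT lam_inj Td).
have wW : lagrange lam T i v \in W.
  apply/mem_orthovP => u; rewrite mem_leigenspace => /eqP Tu.
  exact: orth (lagrangeT lam_inj Td i v) Tu ij.
move: (lagrange lam T i v) wW => q qW.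
have qUW : q \in (U + W)%VS by rewrite -[q]add0r memv_add ?mem0v.
have := daddv_pi_add UW0 qUW; rewrite (daddv_pi_id WU0 qW) => e.
by apply: (addIr q); rewrite add0r.
Qed.

End OrthogonalProjection.

Section Exponential.
Variable R : realType.
Implicit Types (t : R) (i : 'I_3).
Local Notation Y := (Y R).

Lemma Y_tr i : (Y i)^T = - Y i.
Proof.
apply/matrixP => a b; rewrite !mxE.
by case: i => -[|[|[|//]]] ?; case: a => -[|[|[|//]]] ?; case: b => -[|[|[|//]]] ? /=;
  rewrite ?oppr0 ?opprK.
Qed.

Lemma Y_cube i : Y i *m (Y i *m Y i) = - Y i.
Proof.
apply/matrixP => a b; rewrite !mxE sum3 !mxE !sum3 !mxE.
by case: i => -[|[|[|//]]] ?; case: a => -[|[|[|//]]] ?; case: b => -[|[|[|//]]] ? /=; ring.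
Qed.

(** Rodrigues' formula. *)
Definition rodrigues i t : 'M[R]_3 :=
  1%:M + sin t *: Y i + (1 - cos t) *: (Y i *m Y i).

Let Ypow i n : Y i ^+ n.*2.+1 = (-1) ^+ n *: Y i /\
  Y i ^+ n.*2.+2 = (-1) ^+ n *: (Y i *m Y i).
Proof.
elim: n => [|n [ih1 ih2]]; first by rewrite expr1 expr0 !scale1r exprS expr1.
have e : Y i ^+ n.+1.*2.+1 = (-1) ^+ n.+1 *: Y i.
  rewrite doubleS exprS ih2 exprS -[LHS]/(Y i *m ((-1) ^+ n *: (Y i *m Y i))).
  by rewrite -scalemxAr Y_cube scalerN mulN1r scaleNr.
split=> //; rewrite exprS e -[LHS]/(Y i *m ((-1) ^+ n.+1 *: Y i)).
by rewrite -scalemxAr.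
Qed.

Lemma expmx_Y i t : expmx (t *: Y i) = rodrigues i t.
Proof.
apply/matrixP => a b; rewrite /expmx mxE.
pose one (n : nat) : R := (n == 0)%:R.
have term l : l`!%:R^-1 * ((t *: Y i) ^+ l) a b =
    one l * (1%:M : 'M[R]_3) a b + sin_coeff t l * Y i a b +
    (one l - cos_coeff t l) * (Y i *m Y i) a b.
  rewrite /sin_coeff /cos_coeff /one exprZn mxE.
  case: l => [|l].
    have -> : (Y i ^+ 0) a b = (1%:M : 'M[R]_3) a b by [].
    rewrite /= !fact0 expr0z !expr0.
    by move: (1%:M a b) (Y i a b) ((Y i *m Y i) a b) => p q r; field.
  have f0 : (l.+1)`!%:R != 0 :> R by rewrite pnatr_eq0 -lt0n fact_gt0.
  move: f0; rewrite /= -[l]odd_double_half; case: (odd l) => /= f0.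
    rewrite !add1n (Ypow i l./2).2 mxE /= odd_double /= doubleK -exprnP !exprS.
    by move: f0; rewrite !add1n => f0; field.
  rewrite !add0n (Ypow i l./2).1 mxE /= odd_double /= doubleK.
  by move: f0; rewrite !add0n => f0; field.
have one_cvg : series one @ \oo --> (1 : R).
  apply: (@cvg_trans _ ((fun=> 1 : R) @ \oo)); last exact: cvg_cst.
  apply: near_eq_cvg; near=> n.
  rewrite /series /= -(@prednK n); last by near: n; exact: nbhs_infty_gt.
  by rewrite big_nat_recl //= big1 ?addr0.
have sc : series (sin_coeff t) @ \oo --> sin t.
  by rewrite sin.unlock; exact: is_cvg_series_sin_coeff.
have cc : series (cos_coeff t) @ \oo --> cos t.
  by rewrite cos.unlock; exact: is_cvg_series_cos_coeff.
apply: cvg_lim => //.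
have -> : series (fun l => l`!%:R^-1 * ((t *: Y i) ^+ l) a b) = fun n =>
    series one n * (1%:M : 'M[R]_3) a b + series (sin_coeff t) n * Y i a b +
    (series one n - series (cos_coeff t) n) * (Y i *m Y i) a b.
  apply/funext => n; rewrite /series /= -sumrB !mulr_suml -!big_split /=.
  by apply: eq_bigr => l _; exact: term.
rewrite /rodrigues !mxE -[X in _ --> X + _ + _]mul1r.
apply: cvgD; first apply: cvgD; apply: cvgM; try exact: cvg_cst.
- exact: one_cvg.
- exact: sc.
- by apply: cvgB; [exact: one_cvg|exact: cc].
Unshelve. all: by end_near. Qed.

Lemma rodrigues_O3 i t : O3 (rodrigues i t).
Proof.
rewrite /O3 /rodrigues; set y := Y i; set s := sin t; set c := cos t.
have sc : s ^+ 2 = 1 - c ^+ 2 by rewrite -(cos2Dsin2 t) addrAC subrr add0r.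
pose y2 := y *m y.
have yy2 : y *m y2 = - y by exact: Y_cube.
have y2y : y2 *m y = - y by rewrite /y2 -mulmxA yy2.
have y22 : y2 *m y2 = - y2 by rewrite {1}/y2 -mulmxA yy2 mulmxN.
have -> : (1%:M + s *: y + (1 - c) *: y2)^T = 1%:M - s *: y + (1 - c) *: y2.
  rewrite !linearD /= !linearZ /= trmx1 /y2 trmx_mul Y_tr mulNmx mulmxN opprK.
  by rewrite scalerN.
rewrite -/y2 !mulmxDl !mulmxDr !mul1mx !mulmx1 !mulmxN -!scalemxAl -!scalemxAr.
rewrite -/y2 yy2 y2y y22 !scalerA !scalerN.
move: sc; move: (y2) (y) (s) (c) => q p s' c' sc'; apply/matrixP => a b; rewrite !mxE.
by move: (q a b) (p a b) => q' p'; rewrite -expr2 sc'; ring.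
Qed.

End Exponential.

Section DerivedRepresentation.
Variables (R : realType) (m : nat).
Local Notation V := (H R m).
Local Notation C := R[i].
Implicit Types (x y : R3 R) (k : 'M[R]_3) (i : 'I_3).

Let D (f : R -> C) (a : C) :=
  is_derive (0 : R) (1 : R) (fun t => complex.Re (f t)) (complex.Re a) /\
  is_derive (0 : R) (1 : R) (fun t => complex.Im (f t)) (complex.Im a).

Let D_ext f g a : f =1 g -> D f a -> D g a.
Proof. by move=> /funext ->. Qed.

Let D_cst c : D (fun=> c) 0.
Proof. by split; exact: dv_cst. Qed.

Let D_add f g a b : D f a -> D g b -> D (fun t => f t + g t) (a + b).
Proof.
move=> [f1 f2] [g1 g2]; split.
  by rewrite ReD (_ : (fun t => _) = fun t => complex.Re (f t) + complex.Re (g t));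
    [exact: dvD|apply/funext => t; rewrite ReD].
by rewrite ImD (_ : (fun t => _) = fun t => complex.Im (f t) + complex.Im (g t));
  [exact: dvD|apply/funext => t; rewrite ImD].
Qed.

Let D_mul f g a b : D f a -> D g b -> D (fun t => f t * g t) (a * g 0 + f 0 * b).
Proof.
move=> [f1 f2] [g1 g2]; split.
  rewrite (_ : (fun t => _) = fun t => complex.Re (f t) * complex.Re (g t) +
    - (complex.Im (f t) * complex.Im (g t))); last by apply/funext => t; rewrite ReM.
  have h := dvD (dvM f1 g1) (dvN (dvM f2 g2)); apply: is_derive_eq h _.
  by rewrite ReD !ReM; ring.
rewrite (_ : (fun t => _) = fun t => complex.Re (f t) * complex.Im (g t) +
  complex.Im (f t) * complex.Re (g t)); last by apply/funext => t; rewrite ImM.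
have h := dvD (dvM f1 g2) (dvM f2 g1); apply: is_derive_eq h _.
by rewrite ImD !ImM; ring.
Qed.

Let D_uniq f a b : D f a -> D f b -> a = b.
Proof.
move=> [a1 a2] [b1 b2]; apply: complex_ext.
  by rewrite -(@derive_val _ _ _ _ _ _ _ a1) -(@derive_val _ _ _ _ _ _ _ b1).
by rewrite -(@derive_val _ _ _ _ _ _ _ a2) -(@derive_val _ _ _ _ _ _ _ b2).
Qed.

Let D_cderive f a : D f a -> cderive f 0 = a.
Proof.
move=> [a1 a2]; apply: complex_ext; rewrite /cderive /= derive1E.
  exact: (@derive_val _ _ _ _ _ _ _ a1).
exact: (@derive_val _ _ _ _ _ _ _ a2).
Qed.

(** (tau (exp (t Y)) p) (x) = p (exp (- t Y) x), and - Y is the transpose of Y. *)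
Lemma derived_tau_generates i : generates (derived_tau m (Y R i)) (cmx (Y R i))^T.
Proof.
pose K t := expmx (t *: Y R i).
have KE t : K t = rodrigues i t by exact: expmx_Y.
have [] := @generates_curve R m R 0 D D_ext D_cst D_add D_mul D_uniq K (cmx (Y R i))^T.
- by move=> t; rewrite KE; exact: rodrigues_O3.
- by rewrite KE /rodrigues sin0 cos0 subrr !scale0r !addr0.
- move=> a b; have -> : (cmx (Y R i))^T a b = (Y R i b a)%:C by rewrite mxE [LHS]mxE.
  split; last exact: dv_cst.
  rewrite (_ : (fun t => _) = fun t => ((1%:M : 'M[R]_3) b a + Y R i b a * sin t) +
      (Y R i *m Y R i) b a * (1 + - cos t)); last first.
    by apply/funext => t; rewrite KE /rodrigues !mxE /=; ring.
  have h := dvD (dvD (dv_cst ((1%:M : 'M[R]_3) b a) 0) (dvZ (Y R i b a) (is_derive_sin 0)))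
    (dvZ ((Y R i *m Y R i) b a) (dvD (dv_cst 1 0) (dvN (is_derive_cos 0)))).
  apply: is_derive_eq h _.
  by rewrite sin0 cos0 /=; ring.
move=> T TZ DT; suff -> : derived_tau m (Y R i) = T by [].
rewrite /derived_tau /vderive [RHS]coord_e; apply: eq_bigr => l _.
by rewrite (D_cderive (DT l)).
Qed.

(** The matrix of v |-> x * v, the cross product. *)
Definition cross_mx x : 'M[R]_3 := \sum_(i < 3) col3 x i 0 *: (Y R i)^T.

Lemma dtau_generates x : generates (dtau m x) (cmx (cross_mx x)).
Proof.
have g0 : generates (0 : 'End(V)) 0.
  move=> p; rewrite zero_lfunE mpoly_of_H0.
  rewrite /HarmonicWeights.vfield big1// => j _; rewrite big1// => l _.
  by rewrite mxE scale0r.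
rewrite /dtau /cross_mx /cmx raddf_sum /=.
have e i : map_mx (real_complex R) (col3 x i 0 *: (Y R i)^T) =
    (col3 x i 0)%:C *: (cmx (Y R i))^T.
  by apply/matrixP => a b; rewrite !mxE rmorphM.
elim/big_ind2: _ => [//|T Z T' Z' TZ TZ'|i _].
  by have := generates_linear 1 TZ TZ'; rewrite !scale1r.
by rewrite e -[X in generates X _]addr0 -[X in generates _ X]addr0;
  apply: generates_linear => //; exact: derived_tau_generates.
Qed.

Let cols (u : 'cV[R]_3) x (w : 'cV[R]_3) : 'M[R]_3 :=
  \matrix_(i, j) nth 0 [:: u i 0; col3 x i 0; w i 0] j.

Let cross_det u x w : (u^T *m cross_mx x *m w) 0 0 = \det (cols u x w).
Proof.
rewrite det3 !mxE sum3 !mxE !sum3 /cross_mx !sum3 !mxE /=; ring.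
Qed.

Let cols_mul k u x w : k *m cols u x w = cols (k *m u) (act k x) (k *m w).
Proof.
apply/matrixP => a b; rewrite [RHS]mxE col3_act !mxE.
case: b => -[|[|[|//]]] ? /=; apply: eq_bigr => j _; by rewrite mxE.
Qed.

(** Rotations preserve the triple product det (u, x, w) = u . (x * w), hence the
    cross product. *)
Lemma cross_mx_act k x : SO3 k -> cross_mx x *m k^T = k^T *m cross_mx (act k x).
Proof.
move=> [kO kd].
suff e : k^T *m cross_mx (act k x) *m k = cross_mx x.
  by rewrite -e -!mulmxA kO mulmx1.
apply/matrixP => a b.
pose u : 'cV[R]_3 := delta_mx a 0; pose w : 'cV[R]_3 := delta_mx b 0.
have ent (M : 'M[R]_3) : M a b = (u^T *m M *m w) 0 0.
  by rewrite /u /w trmx_delta -rowE -colE !mxE.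
rewrite !ent cross_det -[RHS]mul1r -kd -det_mulmx cols_mul -cross_det.
by rewrite trmx_mul !mulmxA.
Qed.

Lemma dtau_act k x : SO3 k -> (tau m k \o dtau m x = dtau m (act k x) \o tau m k)%VF.
Proof.
move=> kS; apply: (generates_conj kS.1 (dtau_generates x) (dtau_generates _)).
have e : (cmx k)^T = cmx k^T by rewrite /cmx matrix.map_trmx.
by rewrite e /cmx -!map_mxM cross_mx_act.
Qed.

Lemma dtau_opp x : dtau m (opp3 x) = - dtau m x.
Proof.
rewrite /dtau -sumrN; apply: eq_bigr => i _.
by rewrite /opp3 col3K !mxE rmorphN scaleNr.
Qed.

Definition e3 : R3 R := ((0, 0), 1).

Lemma dtau_e3 : generates (dtau m e3) (rot3_gen C).
Proof.
suff <- : cmx (cross_mx e3) = rot3_gen C by exact: dtau_generates.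
apply/matrixP => a b; rewrite /cross_mx sum3 !mxE.
by case: a => -[|[|[|//]]] ?; case: b => -[|[|[|//]]] ? /=;
  apply/eqP; rewrite eq_complex /=; apply/andP; split; apply/eqP; ring.
Qed.

Lemma sphere_e3 x : sphere x -> exists2 k, SO3 k & act k e3 = x.
Proof.
by move=> sx; apply: SO3_transitive; rewrite sx dot3E /=; ring.
Qed.

Lemma tauKV k : O3 k -> (tau m k \o tau m k^T = \1)%VF.
Proof. by move=> kO; rewrite -tauM ?kO ?tau1//; exact: O3T. Qed.

Lemma tauK k : O3 k -> (tau m k^T \o tau m k = \1)%VF.
Proof. by move=> /O3T/tauKV; rewrite trmxK. Qed.

Lemma dtau_eigenspaces_span x : sphere x -> eigenspaces_span (@ev R m) (dtau m x).
Proof.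
move=> /sphere_e3[k kS <-].
apply: (eigenspaces_span_conj (esym (dtau_act e3 kS)) (tauKV kS.1)).
exact: generates_eigenspaces_span dtau_e3.
Qed.

(** By conjugation with a rotation, the third axis suffices. *)
Lemma dtau_simple x : sphere x -> simple_spectrum (@ev R m) (dtau m x).
Proof.
move=> /sphere_e3[k kS <-].
have e := dtau_act (act k e3) (SO3T kS); rewrite (actK kS.1) in e.
exact: (simple_spectrum_conj e (tauKV kS.1) (generates_simple dtau_e3)).
Qed.

Let angle : R := pi / (2 * m).+1%:R.

(** The eigenvalue of the rotation by pi / (2m+1) on the vectors of weight j - m. *)
Definition chi (j : 'I_(2 * m).+1) : C :=
  (cos angle +i* - sin angle) ^+ j * (cos angle +i* sin angle) ^+ m.

Let zy : (cos angle +i* - sin angle : C) * (cos angle +i* sin angle) = 1.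
Proof.
apply/eqP; rewrite eq_complex /= mulNr opprK -!expr2 cos2Dsin2 eqxx /=.
by rewrite mulNr mulrC subrr.
Qed.

Let powz n : (cos angle +i* - sin angle : C) ^+ n =
  cos (n%:R * angle) +i* - sin (n%:R * angle).
Proof.
elim: n => [|n ih]; first by rewrite expr0 mul0r cos0 sin0 oppr0.
rewrite exprS ih; apply: complex_ext; rewrite ?ReM ?ImM /=.
  by rewrite -natr1 mulrDl mul1r cosD; ring.
by rewrite -natr1 mulrDl mul1r sinD; ring.
Qed.

Lemma chi_conj j : chi j * (chi j)^* = 1.
Proof.
have cz : Num.conj (cos angle +i* - sin angle : C) = cos angle +i* sin angle.
  by apply/eqP; rewrite eq_complex /= opprK !eqxx.
have cy : Num.conj (cos angle +i* sin angle : C) = cos angle +i* - sin angle.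
  by apply/eqP; rewrite eq_complex /= !eqxx.
rewrite /chi rmorphM !rmorphXn /= cz cy mulrACA -!exprMn.
by rewrite zy [X in _ * X ^+ m]mulrC zy !expr1n mulr1.
Qed.

(** The angles j pi / (2m+1), 0 <= j <= 2m, lie between 0 and pi, where the cosine is
    injective. *)
Lemma chi_inj : injective chi.
Proof.
move=> i j; rewrite /chi => /mulIf h.
have ym0 : (cos angle +i* sin angle : C) ^+ m != 0.
  rewrite expf_neq0//; apply/eqP => y0; have := zy; rewrite y0 mulr0 => /eqP.
  by rewrite eq_sym oner_eq0.
have := h ym0; rewrite !powz => -[/cos_inj c _].
have rng (l : 'I_(2 * m).+1) : l%:R * angle \in `[0, pi].
  rewrite in_itv /= mulr_ge0 ?divr_ge0 ?pi_ge0//= /angle mulrCA ger_pMr ?pi_gt0//.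
  by rewrite ler_pdivrMr ?ltr0n// mul1r ler_nat ltnW.
have a0 : angle != 0 by rewrite mulf_neq0 ?invr_eq0 ?pnatr_eq0// gt_eqF ?pi_gt0.
apply/val_inj/eqP; rewrite -(eqr_nat R); apply/eqP.
exact: (mulIf a0 (c (rng _) (rng _))).
Qed.

(** The rotation by the angle pi / (2m+1) about the third axis is transported to x
    by conjugation. *)
Lemma axis_rotation x : sphere x -> exists k, [/\ SO3 k, act k x = x &
  forall (j : 'I_(2 * m).+1) (v : V), dtau m x v = @ev R m j *: v -> tau m k v = chi j *: v].
Proof.
move=> /sphere_e3[k kS <-].
pose r := rot3 (cos angle) (sin angle).
have rO : O3 r.
  rewrite /O3; apply/matrixP => a b; rewrite !mxE sum3 !mxE.
  have sc := cos2Dsin2 angle.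
  case: a => -[|[|[|//]]] ?; case: b => -[|[|[|//]]] ? /=;
    rewrite ?(mulr0, mul0r, addr0, add0r, mulr1, mul1r) //.
  - by rewrite mulrNN -!expr2.
  - by ring.
  - by ring.
  - by rewrite -!expr2 addrC.
have rS : SO3 r.
  split=> //; rewrite det3 !mxE /=; have := cos2Dsin2 angle.
  by move: (cos angle) (sin angle) => c s e; rewrite -[RHS]e; ring.
have re : act r e3 = e3.
  by rewrite act_coords !mxE /=; congr ((_, _), _); ring.
have kO := kS.1; have kTO := O3T kO.
exists (k *m r *m k^T); split.
- split; first by apply: O3M => //; exact: O3M.
  by rewrite !det_mulmx det_tr kS.2 rS.2 !mulr1.
- by rewrite !actM actK// re.
move=> j v ev_v; rewrite (tauM m (O3M kO rO) kTO) (tauM m kO rO) !comp_lfunE.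
have w_ev : dtau m e3 (tau m k^T v) = @ev R m j *: tau m k^T v.
  have := dtau_act (act k e3) (SO3T kS); rewrite (actK kO) => e.
  have ev_k := comp_lfun_apply e v; rewrite comp_lfunE in ev_k.
  by rewrite -ev_k ev_v linearZ.
rewrite (tau_rot3 dtau_e3 rO _ w_ev) ?cos2Dsin2// linearZ /=.
by rewrite (comp_lfun_apply (tauKV kO)) id_lfunE.
Qed.

End DerivedRepresentation.

(** * Integrals of vector-valued functions *)

Section ScaledMeasure.
Context {R : realType} d {T : measurableType d}.
Variables (mu : {measure set T -> \bar R}) (k : {nonneg R}).
Hypothesis k0 : 0 < k%:num.
Variable D : set T.
Hypothesis mD : measurable D.

Let ge0_int (f : T -> \bar R) : measurable_fun D f -> (forall x, 0 <= f x)%E ->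
  (\int[mscale k mu]_(x in D) f x = k%:num%:E * \int[mu]_(x in D) f x)%E.
Proof. by move=> mf f0; apply: ge0_integral_mscale. Qed.

Let integrable_mscale (f : T -> R) :
  (mscale k mu).-integrable D (EFin \o f) <-> mu.-integrable D (EFin \o f).
Proof.
have e (g : T -> \bar R) : measurable_fun D g -> (forall x, 0 <= g x)%E ->
    (\int[mscale k mu]_(x in D) g x < +oo)%E = (\int[mu]_(x in D) g x < +oo)%E.
  move=> mg g0; rewrite ge0_int//; have := integral_ge0 mu (fun x (_ : D x) => g0 x).
  case: (\int[mu]_(x in D) g x)%E => [r| |] //= _; first by rewrite -EFinM !ltry.
  by rewrite gt0_muley ?lte_fin// ltxx.
split=> /integrableP[mf fi]; apply/integrableP; split=> //.
  by rewrite -e//; exact: measurableT_comp.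
by rewrite e//; exact: measurableT_comp.
Qed.

Let Rintegral_mscale (f : T -> R) : mu.-integrable D (EFin \o f) ->
  \int[mscale k mu]_(x in D) f x = k%:num * \int[mu]_(x in D) f x.
Proof.
move=> fi; have mf := measurable_int mu fi.
rewrite /Rintegral [in LHS]integralE [in RHS]integralE.
rewrite !ge0_int//; [|exact: measurable_funeneg|exact: measurable_funepos].
have p := integrable_pos_fin_num mD fi; have n := integrable_neg_fin_num mD fi.
rewrite -(fineK p) -(fineK n) -!EFinM -!EFinB /=.
by rewrite mulrBr.
Qed.

Lemma cintegrable_mscale (f : T -> R[i]) :
  cintegrable (mscale k mu) D f <-> cintegrable mu D f.
Proof.
by split=> -[f1 f2]; split; apply/integrable_mscale.
Qed.

Lemma cint_mscale (f : T -> R[i]) : cintegrable mu D f ->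
  cint (mscale k mu) D f = (k%:num)%:C * cint mu D f.
Proof.
move=> [f1 f2]; apply: complex_ext; rewrite ?ReM ?ImM !Re_cint !Im_cint /= !mul0r.
  by rewrite subr0 Rintegral_mscale.
by rewrite addr0 Rintegral_mscale.
Qed.

Lemma ae_mscale (P : T -> Prop) :
  {ae mscale k mu, forall x, P x} <-> {ae mu, forall x, P x}.
Proof.
split=> -[N [mN N0 sN]]; exists N; split=> //.
  move: N0; rewrite [X in X = _](_ : _ = (k%:num%:E * mu N)%E)// => /eqP.
  by rewrite mule_eq0 eqe gt_eqF//= => /eqP.
by rewrite [LHS](_ : _ = (k%:num%:E * mu N)%E)// N0 mule0.
Qed.

End ScaledMeasure.

Section BoundedMeasurable.
Context {R : realType} d {T : measurableType d}.
Local Notation C := R[i].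

Definition bmeas (h : T -> C) := cmeas h /\ exists M, forall x, cabs (h x) <= M.

Lemma bmeas_cst z : bmeas (fun=> z).
Proof. by split; [exact: cmeas_cst|exists (cabs z)]. Qed.

Lemma bmeasD g h : bmeas g -> bmeas h -> bmeas (fun x => g x + h x).
Proof.
move=> [mg [M gM]] [mh [N hN]]; split; first exact: cmeasD.
by exists (M + N) => x; apply: le_trans (cabsD _ _) _; exact: lerD.
Qed.

Lemma bmeasM g h : bmeas g -> bmeas h -> bmeas (fun x => g x * h x).
Proof.
move=> [mg [M gM]] [mh [N hN]]; split; first exact: cmeasM.
by exists (M * N) => x; apply: le_trans (cabsM _ _) _; apply: ler_pM => //; exact: cabs_ge0.
Qed.

Lemma bmeas_sum (I : Type) (s : seq I) (h : I -> T -> C) :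
  (forall i, bmeas (h i)) -> bmeas (fun x => \sum_(i <- s) h i x).
Proof.
move=> bh; elim: s => [|i s ih].
  by rewrite (_ : (fun x => _) = fun=> 0); [exact: bmeas_cst|apply/funext => x; rewrite big_nil].
rewrite (_ : (fun x => _) = fun x => h i x + \sum_(j <- s) h j x); first exact: bmeasD.
by apply/funext => x; rewrite big_cons.
Qed.

Lemma lin_coordE (V : vectType C) (phi : V -> C) v : linear (phi : V -> C^o) ->
  phi v = \sum_i coord (vbasis {:V}) i v * phi (vbasis {:V})`_i.
Proof.
move=> lin; have l0 : phi 0 = 0.
  by have := lin (-1) 0 0; rewrite scaler0 addr0 scaleN1r addNr.
rewrite {1}(coord_e v); elim/big_rec2: _ => [|i y x _ <-]; first exact: l0.
exact: lin.
Qed.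

Section Vector.
Variable V : vectType C.
Local Notation e := (vbasis {:V}).

Lemma coord_vint (mu : {measure set T -> \bar R}) D (f : T -> V) i :
  coord e i (vint mu D f) = cint mu D (fun x => coord e i (f x)).
Proof. by rewrite /vint coord_sum_free//; exact: (basis_free (vbasisP _)). Qed.

Lemma lin_vint (mu : {measure set T -> \bar R}) (f : T -> V) (phi : V -> C) :
  linear (phi : V -> C^o) -> vintegrable mu setT f ->
  cintegrable mu setT (fun x => phi (f x)) /\
  phi (vint mu setT f) = cint mu setT (fun x => phi (f x)).
Proof.
move=> lin fi.
have E : (fun x => phi (f x)) = fun x => \sum_(i < \dim {:V}) phi e`_i * coord e i (f x).
  by apply/funext => x; rewrite (lin_coordE _ lin); apply: eq_bigr => i _; rewrite mulrC.
have ti (i : 'I_(\dim {:V})) : cintegrable mu setT (fun x => phi e`_i * coord e i (f x)).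
  by apply: cintegrableZ; exact: fi.
split; first by rewrite E; exact: cintegrable_sum.
rewrite E cint_sum// (lin_coordE _ lin); apply: eq_bigr => i _.
by rewrite coord_vint mulrC cintZ//; exact: fi.
Qed.

Definition vbmeas (f : T -> V) := forall i, bmeas (fun x => coord e i (f x)).

Lemma vbmeas_cst v : vbmeas (fun=> v).
Proof. by move=> i; exact: bmeas_cst. Qed.

Lemma vbmeasD f g : vbmeas f -> vbmeas g -> vbmeas (fun x => f x + g x).
Proof.
move=> bf bg i; rewrite (_ : (fun x => _) = fun x => coord e i (f x) + coord e i (g x)).
  exact: bmeasD.
by apply/funext => x; rewrite linearD.
Qed.

Lemma vbmeasZ h f : bmeas h -> vbmeas f -> vbmeas (fun x => h x *: f x).
Proof.
move=> bh bf i; rewrite (_ : (fun x => _) = fun x => h x * coord e i (f x)).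
  exact: bmeasM.
by apply/funext => x; rewrite linearZ.
Qed.

End Vector.

Section Endomorphisms.
Variable V : vectType C.
Local Notation e := (vbasis {:'End(V)}).

(** Linear functionals of a product, bilinearly in the coordinates. *)
Lemma lin_comp_coord (phi : 'End(V) -> C) (f g : 'End(V)) :
  linear (phi : 'End(V) -> C^o) -> phi (f \o g)%VF =
  \sum_p (coord e p.1 f * coord e p.2 g) * phi (e`_p.1 \o e`_p.2)%VF.
Proof.
move=> lin; rewrite -(pair_bigA _ (fun a b => (coord e a f * coord e b g) *
  phi (e`_a \o e`_b)%VF)) /=.
have l1 : linear ((fun h : 'End(V) => phi (h \o g)%VF) : 'End(V) -> C^o).
  by move=> c h1 h2; rewrite comp_lfunDl -comp_lfunZl lin.
rewrite (lin_coordE _ l1); apply: eq_bigr => a _.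
have l2 : linear ((fun h : 'End(V) => phi (e`_a \o h)%VF) : 'End(V) -> C^o).
  by move=> c h1 h2; rewrite comp_lfunDr -comp_lfunZr lin.
by rewrite (lin_coordE _ l2) mulr_sumr; apply: eq_bigr => b _; rewrite mulrA.
Qed.

Lemma coord_lin i : linear ((fun h : 'End(V) => coord e i h) : 'End(V) -> C^o).
Proof. by move=> c h1 h2; rewrite linearP. Qed.

Lemma vbmeas_comp (f g : T -> 'End(V)) : vbmeas f -> vbmeas g -> vbmeas (fun x => (f x \o g x)%VF).
Proof.
move=> bf bg i; rewrite (_ : (fun x => _) = fun x =>
  \sum_p (coord e p.1 (f x) * coord e p.2 (g x)) * coord e i (e`_p.1 \o e`_p.2)%VF).
  by apply: bmeas_sum => p; apply: bmeasM; [exact: bmeasM|exact: bmeas_cst].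
by apply/funext => x; rewrite (lin_comp_coord _ _ (coord_lin i)).
Qed.

Lemma vbmeas_lagrange n (lam : 'I_n -> C) (f : T -> 'End(V)) j : vbmeas f ->
  vbmeas (fun x => lagrange lam (f x) j).
Proof.
move=> bf; rewrite /lagrange; elim: (index_enum _) => [|i s ih].
  rewrite (_ : (fun x => _) = fun=> \1%VF); first exact: vbmeas_cst.
  by apply/funext => x; rewrite big_nil.
have [ij|ij] := boolP (i != j); last first.
  rewrite (_ : (fun x => _) = fun x => \big[@comp_lfun _ _ _ _ / \1%VF]_(i <- s | i != j)
    ((lam j - lam i)^-1 *: (f x - lam i *: \1%VF))) //.
  by apply/funext => x; rewrite big_cons (negPf ij).
rewrite (_ : (fun x => _) = fun x => (((lam j - lam i)^-1 *: (f x - lam i *: \1)) \o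
  \big[@comp_lfun _ _ _ _ / \1%VF]_(i <- s | i != j)
    ((lam j - lam i)^-1 *: (f x - lam i *: \1%VF)))%VF); last first.
  by apply/funext => x; rewrite big_cons ij.
apply: vbmeas_comp => //; apply: vbmeasZ; first exact: bmeas_cst.
by apply: vbmeasD => //; exact: vbmeas_cst.
Qed.

Lemma cintegrable_lin_comp (mu : {measure set T -> \bar R}) (f g : T -> 'End(V))
    (phi : 'End(V) -> C) : linear (phi : 'End(V) -> C^o) ->
  (forall i, cintegrable mu setT (fun x => coord e i (f x))) -> vbmeas g ->
  cintegrable mu setT (fun x => phi (f x \o g x)%VF).
Proof.
move=> lin fi bg; rewrite (_ : (fun x => _) = fun x =>
  \sum_p (coord e p.1 (f x) * coord e p.2 (g x)) * phi (e`_p.1 \o e`_p.2)%VF); last first.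
  by apply/funext => x; rewrite (lin_comp_coord _ _ lin).
apply: cintegrable_sum => p.
rewrite (_ : (fun x => _) = fun x => phi (e`_p.1 \o e`_p.2)%VF *
  (coord e p.1 (f x) * coord e p.2 (g x))); last by apply/funext => x; rewrite mulrC.
apply: cintegrableZ; have [mg [M gM]] := bg p.2.
exact: (cintegrableM_bounded (fi p.1) mg gM).
Qed.

End Endomorphisms.
End BoundedMeasurable.

Lemma endtr_mulC (K : fieldType) (V : vectType K) (f g : 'End(V)) :
  endtr (f \o g)%VF = endtr (g \o f)%VF.
Proof.
by rewrite /endtr !(passmx.mxof_comp _ _ (vbasisP {:V})) mxtrace_mulC.
Qed.

Section SpectralProjections.
Variables (R : realType) (m : nat).
Local Notation V := (H R m).
Local Notation C := R[i].
Implicit Types (x y xi : R3 R) (k : 'M[R]_3) (j l : 'I_(2 * m).+1).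

(** The projection onto the eigenspace of dtau (x / |x|) of index j. *)
Definition Q x j : 'End(V) := lagrange (@ev R m) (dtau m (dir x)) j.

Lemma Q_bmeas j : vbmeas (Q ^~ j).
Proof.
apply: vbmeas_lagrange.
rewrite (_ : (fun x => _) = fun x => (col3 (dir x) 0 0)%:C *: derived_tau m (Y R 0) +
  (col3 (dir x) 1 0)%:C *: derived_tau m (Y R 1) +
  (col3 (dir x) 2 0)%:C *: derived_tau m (Y R 2)); last first.
  by apply/funext => x; rewrite /dtau sum3.
have b (i : 'I_3) : bmeas (fun x => (col3 (dir x) i 0)%:C).
  split.
    apply: cmeas_real; rewrite (_ : (fun x => _) = (fun y => col3 y i 0) \o dir (R := R))//.
    apply: measurableT_comp; last exact: measurable_dir.
    case: i => -[|[|[|//]]] ?.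
    - rewrite (_ : (fun y => _) = fun y : R3 R => y.1.1); first exact: (@measurable_x1 R).
      by apply/funext => y; rewrite mxE.
    - rewrite (_ : (fun y => _) = fun y : R3 R => y.1.2); first exact: (@measurable_x2 R).
      by apply/funext => y; rewrite mxE.
    - rewrite (_ : (fun y => _) = fun y : R3 R => y.2); first exact: (@measurable_x3 R).
      by apply/funext => y; rewrite mxE.
  exists 1 => x; rewrite cabs_real; apply: le_trans (norm3_dir x).
  have [h1 h2 h3] := coord_le_norm3 (dir x); rewrite mxE.
  by case: i => -[|[|[|//]]] ?.
by apply: vbmeasD; [apply: vbmeasD|]; apply: vbmeasZ => //; exact: vbmeas_cst.
Qed.

Lemma Q_sphere xi j : sphere xi -> Q xi j = lagrange (@ev R m) (dtau m xi) j.
Proof. by move=> s; rewrite /Q dir_sphere. Qed.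

Lemma Q_scale r xi j : 0 < r -> Q (scale3 r xi) j = Q xi j.
Proof. by move=> r0; rewrite /Q dir_scale. Qed.

Lemma sphere_opp xi : sphere xi -> sphere (opp3 xi).
Proof. by rewrite /sphere /= opp3E !dot3E /= => <-; ring. Qed.

Lemma Q_opp xi j : sphere xi -> Q (opp3 xi) j = Q xi (rev_ord j).
Proof.
move=> s; rewrite !Q_sphere//; last exact: sphere_opp.
rewrite dtau_opp; apply: (lagrange_opp (@ev_inj R m) _ (dtau_eigenspaces_span s)).
  by move=> i; exact: ev_rev.
exact: rev_ordK.
Qed.

Lemma Q_act k x j : SO3 k ->
  Q (act k x) j = (tau m k \o Q x j \o tau m k^T)%VF.
Proof.
move=> kS; rewrite /Q (dir_act _ kS.1).
by rewrite (lagrange_comp _ j (dtau_act m (dir x) kS)) -comp_lfunA (tauKV m kS.1) comp_lfun1r.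
Qed.

(** One rotation around xi already separates the eigenlines of dtau xi, so that A is
    diagonal in its eigenbasis. *)
Lemma axis_expansion xi (A : 'End(V)) : sphere xi ->
  (forall k, SO3 k -> act k xi = xi -> (A \o tau m k = tau m k \o A)%VF) ->
  A = \sum_j endtr (A \o Q xi j)%VF *: Q xi j.
Proof.
move=> s comm; have [k [kS kx chiE]] := axis_rotation m s.
have cQ := commute_lagrange (@ev_inj R m) (dtau_eigenspaces_span s) (@chi_inj R m) chiE (comm k kS kx).
rewrite {1}(commute_expansion (@ev_inj R m) (dtau_eigenspaces_span s) (dtau_simple s) cQ).
by apply: eq_bigr => j _; rewrite (Q_sphere j s).
Qed.

Variable ip : {dot V for @Num.conj C}.
Hypothesis Hip : unitary ip.

(** Let k be the rotation around xi that acts by the unitary scalars chi on the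
    eigenspaces.  As k preserves the inner product, eigenspaces with different chi
    are orthogonal. *)
Lemma P_Q xi j : sphere xi -> P ip (j%:Z - m%:Z) xi = Q xi j.
Proof.
move=> s; rewrite (Q_sphere j s) /P.
apply: (orth_projE (@ev_inj R m) (dtau_eigenspaces_span s)) => i l u v ui vl il.
have [k [kS _ chiE]] := axis_rotation m s.
have := Hip kS u v; rewrite (chiE _ _ ui) (chiE _ _ vl) linearZl_LR linearZr_LR /=.
move=> e; apply/eqP; have /eqP : (chi R i * Num.conj (chi R l) - 1) * ip u v = 0.
  by rewrite mulrBl mul1r -[X in _ - X]e mulrA subrr.
rewrite mulf_eq0 => /orP[|//]; rewrite subr_eq0 -(chi_conj R l) => /eqP/mulIf h.
have c0 : Num.conj (chi R l) != 0.
  by apply/eqP => c0; have := chi_conj R l; rewrite c0 mulr0 => /eqP; rewrite eq_sym oner_eq0.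
by move: (h c0) => /(@chi_inj R m) e2; rewrite e2 eqxx in il.
Qed.

Lemma tau_inv k : SO3 k -> (tau m k)^-1%VF = tau m k^T.
Proof.
move=> [kO _]; have kk := tauK m kO.
have l0 : lker (tau m k) == 0%VS.
  apply/lker0P => u v e; have := congr1 (tau m k^T) e.
  by rewrite !(comp_lfun_apply kk) !id_lfunE.
by rewrite -[LHS]comp_lfun1r -(tauKV m kO) comp_lfunA (lker0_compVf l0) comp_lfun1l.
Qed.

End SpectralProjections.

(** * The inversion formula *)

Section Inversion.
Variables (R : realType) (m : nat) (a b c : {nonneg R}).
Hypothesis Habc : normalized_measures m a b c.
Variable sigma : probability (R3 R) R.
Hypothesis Hsigma : is_sphere_measure sigma.
Variable ip : {dot H R m for @Num.conj R[i]}.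
Hypothesis Hip : unitary ip.
Variable F : R3 R -> 'End(H R m).
Hypothesis HF : L1tau a F.
Hypothesis HFhat : vintegrable (leb3 b) setT (fourier a F).
Local Notation V := (H R m).
Local Notation C := R[i].
Local Notation lam := (leb R).
Local Notation e := (vbasis {:'End(V)}).
Local Notation G := (fourier a F).
Local Notation mu := (@lebesgue_measure R).
Local Notation Pos := (`]0, +oo[%classic : set R).
Implicit Types (x y xi : R3 R) (k : 'M[R]_3) (j l : 'I_(2 * m).+1).
Implicit Types (phi : 'End(V) -> C).

Let pos_of_eq (u v : R) : 0 <= u -> 0 < u * v -> 0 < u.
Proof.
move=> u0 uv; rewrite lt0r u0 andbT; apply: contraTneq uv => ->.
by rewrite mul0r ltxx.
Qed.

Let pi0 : 0 < pi :> R := pi_gt0 R.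

Let a0 : 0 < a%:num.
Proof.
apply: (@pos_of_eq _ (b%:num * (2 * pi) ^+ 3)) => //.
by rewrite mulrA Habc.1.
Qed.

Let b0 : 0 < b%:num.
Proof.
apply: (@pos_of_eq _ (a%:num * (2 * pi) ^+ 3)) => //.
by rewrite mulrA [b%:num * _]mulrC Habc.1.
Qed.

Let c0 : 0 < c%:num.
Proof.
apply: (@pos_of_eq _ (2 * m).+1%:R) => //.
by rewrite mulrC -Habc.2 !mulr_gt0.
Qed.

Let Fi i : cintegrable lam setT (fun x => coord e i (F x)).
Proof. by have := HF.1 i => /(cintegrable_mscale lam a0 measurableT). Qed.

Let Gi i : cintegrable lam setT (fun y => coord e i (G y)).
Proof. by have := HFhat i => /(cintegrable_mscale lam b0 measurableT). Qed.

Let cint_leb3 (f : R3 R -> C) : cintegrable lam setT f ->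
  cint (leb3 a) setT f = (a%:num)%:C * cint lam setT f.
Proof. by move=> fi; have h := cint_mscale (mu := lam) a measurableT fi; exact: h. Qed.

Let cmeas_char y : cmeas (fun x => expi (- dot3 x y)).
Proof.
by apply: cmeas_expi; apply: measurable_funN; apply: measurable_dot3.
Qed.

Let phiF phi : linear (phi : 'End(V) -> C^o) -> cintegrable lam setT (fun x => phi (F x)).
Proof. by move=> lin; exact: (lin_vint (mu := lam) lin Fi).1. Qed.

Let phiF_char phi y : linear (phi : 'End(V) -> C^o) ->
  cintegrable lam setT (fun x => phi (F x) * expi (- dot3 x y)).
Proof.
move=> lin; apply: (@cintegrableM_bounded _ _ _ _ _ _ 2); first exact: phiF.
  exact: cmeas_char.
by move=> x; exact: cabs_expi.
Qed.

(** A linear functional of an integral is the integral of the functional. *)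
Let phiG phi y : linear (phi : 'End(V) -> C^o) ->
  phi (G y) = (a%:num)%:C * cint lam setT (fun x => phi (F x) * expi (- dot3 x y)).
Proof.
move=> lin.
have vi : vintegrable (leb3 a) setT (fun x => expi (- dot3 x y) *: F x).
  move=> i; apply/(cintegrable_mscale lam a0 measurableT).
  rewrite (_ : (fun x => _) = fun x => coord e i (F x) * expi (- dot3 x y)).
    exact: phiF_char (coord_lin i).
  by apply/funext => x; rewrite linearZ /= mulrC.
rewrite /fourier (lin_vint lin vi).2 -cint_leb3; last exact: phiF_char.
congr cint; apply/funext => x.
have l0 : phi 0 = 0 by have := lin (-1) 0 0; rewrite scaler0 addr0 scaleN1r addNr.
by have := lin (expi (- dot3 x y)) (F x) 0; rewrite !addr0 l0 addr0 => ->; rewrite mulrC.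
Qed.

Let ae_lam (P : R3 R -> Prop) :
  {ae leb3 a, forall x, P x} <-> {ae lam, forall x, P x}.
Proof. exact: (ae_mscale lam a0). Qed.

(** The Fourier transform inherits the equivariance of F, for every rotation and
    at every point. *)
Let G_act k y : SO3 k -> G (act k y) = (tau m k \o G y \o tau m k^T)%VF.
Proof.
move=> kS; have kO := kS.1; apply: eq_coord => i.
pose phi (f : 'End(V)) := coord e i (tau m k \o f \o tau m k^T)%VF.
have lin : linear (phi : 'End(V) -> C^o).
  move=> z f g; rewrite /phi comp_lfunDr comp_lfunDl linearD; congr (_ + _).
  by rewrite -comp_lfunZr -comp_lfunZl linearZ.
rewrite -/(phi (G y)) (phiG y lin) (phiG _ (coord_lin i)); congr (_ * _).
pose f x := coord e i (F x) * expi (- dot3 x (act k y)).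
have fi : cintegrable lam setT f by exact: phiF_char (coord_lin i).
have mf := cintegrable_cmeas fi.
have mk := measurable_act k; have lk B (mB : measurable B) := leb_act kO mB.
have fk := (cintegrable_transfer mk lk mf).2 fi.
rewrite -[LHS](cint_transfer mk lk mf fk); apply: ae_eq_cint.
- exact: cintegrable_cmeas fk.
- exact: cintegrable_cmeas (phiF_char y lin).
have /ae_lam := HF.2 k kS; apply: filterS => x eF.
by rewrite /f /= eF (tau_inv m kS) dot3_act.
Qed.

Let coef l y : C := endtr (G y \o Q y l)%VF.

Let coef_lin l x : linear ((fun f : 'End(V) => endtr (f \o Q x l)%VF) : 'End(V) -> C^o).
Proof. by move=> z f g; rewrite comp_lfunDl -comp_lfunZl linearP. Qed.

Let endtr_lin : linear ((fun f : 'End(V) => endtr f) : 'End(V) -> C^o).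
Proof. exact: endtr_linear. Qed.

Let coef_act k y l : SO3 k -> coef l (act k y) = coef l y.
Proof.
move=> kS; rewrite /coef (G_act y kS) (Q_act y l kS).
set g := G y; set q := Q y l; set t := tau m k; set t' := tau m k^T.
have -> : ((t \o g \o t') \o (t \o q \o t') = t \o ((g \o q) \o t'))%VF.
  rewrite -!comp_lfunA; congr (_ \o (_ \o _))%VF.
  by rewrite !comp_lfunA (tauK m kS.1) comp_lfun1l.
have tK : (t' \o t = \1)%VF := tauK m kS.1.
have e1 : endtr (t \o ((g \o q) \o t'))%VF = endtr (((g \o q) \o t') \o t)%VF := endtr_mulC _ _.
by rewrite e1 -(comp_lfunA (g \o q)%VF t' t) tK comp_lfun1r.
Qed.

(** G and the projections are equivariant, and the trace is invariant under
    conjugation. *)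
Let coef_radial (r : R) xi l : sphere xi -> coef l (scale3 r xi) = coef l (scale3 r (e3 R)).
Proof.
by move=> /sphere_e3[k kS <-]; rewrite -act_scale coef_act.
Qed.

Let G_expand (r : R) xi : 0 < r -> sphere xi ->
  G (scale3 r xi) = \sum_l coef l (scale3 r xi) *: Q xi l.
Proof.
move=> r0 s; rewrite {1}(axis_expansion (A := G (scale3 r xi)) s).
  by apply: eq_bigr => l _; rewrite /coef Q_scale.
move=> k kS kx; have := G_act (scale3 r xi) kS; rewrite act_scale kx => eG.
by rewrite {1}eG -comp_lfunA (tauK m kS.1) comp_lfun1r.
Qed.

Let sphere_scaled (r : R) : measurable_fun setT (fun xi : R3 R => scale3 r xi).
Proof. by apply: measurable_scale3 => //; exact: measurable_cst. Qed.

Let char_b (r : R) x : bmeas (fun xi => expi (dot3 x (scale3 r xi))).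
Proof.
split; last by exists 2 => xi; exact: cabs_expi.
apply: cmeas_expi; apply: measurable_dot3; last exact: sphere_scaled.
exact: measurable_cst.
Qed.

Let sigma_opp (f : R3 R -> C) : bmeas f ->
  cint sigma setT (fun xi => f (opp3 xi)) = cint sigma setT f.
Proof.
move=> [mf [M fM]].
have O1 : O3 (- 1%:M : 'M[R]_3) by rewrite /O3 linearN /= trmx1 mulNmx mulmxN opprK mulmx1.
have e1 : act (- 1%:M) = @opp3 R.
  by apply/funext => x; rewrite /act mulNmx mul1mx.
have mo := measurable_act (- 1%:M : 'M[R]_3).
have lo A (mA : measurable A) := sigma_act Hsigma O1 mA.
have fo : cintegrable sigma setT (f \o act (- 1%:M)).
  by apply: (cintegrable_sigma sigma (cmeas_comp mf mo)) => x; exact: fM.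
by rewrite -(cint_transfer mo lo mf fo) e1.
Qed.

(** In the spherical function the sign of the exponent is absorbed by the
    substitution xi -> - xi, which exchanges the eigenvalues i j and - i j. *)
Let coord_Phi (r : R) x j i :
  coord e i (Phi sigma ip r (j%:Z - m%:Z) x) = (2 * m).+1%:R *
    cint sigma setT (fun xi => expi (dot3 x (scale3 r xi)) * coord e i (Q xi (rev_ord j))).
Proof.
rewrite /Phi linearZ /= coord_vint; congr (_ * _).
have Qb l : bmeas (fun xi => coord e i (Q xi l)) by exact: Q_bmeas.
pose g xi := expi (dot3 x (scale3 (- r) xi)) * coord e i (Q xi j).
have gb : bmeas g by apply: bmeasM; [exact: char_b|exact: Qb].
rewrite (@cint_sphere _ _ Hsigma _ g gb.1); last first.
  move=> xi s; rewrite linearZ /= (P_Q Hip j s) /g; congr (expi _ * _).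
  by rewrite dot3Zr mulNr.
rewrite -[LHS](sigma_opp gb); apply: ae_eq_cint.
- have mo : measurable_fun setT (@opp3 R).
    have := measurable_act (- 1%:M : 'M[R]_3); congr (measurable_fun setT _).
    by apply/funext => y; rewrite /act mulNmx mul1mx.
  exact: (cmeas_comp gb.1 mo).
- exact: (bmeasM (char_b r x) (Qb _)).1.
apply: filterS (sphere_ae Hsigma) => xi s; rewrite /g (Q_opp j s); congr (expi _ * _).
by rewrite opp3_scale !dot3Zr; ring.
Qed.

Let cint_sigma_cst (z : C) : cint sigma setT (fun=> z) = z.
Proof.
rewrite -[RHS]mulr1 -(cint_one sigma) -cintZ; first by congr cint; apply/funext => x; rewrite mulr1.
exact: (cintegrable_sigma sigma (cmeas_cst 1) (fun=> lexx _)).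
Qed.

Let N0 : (2 * m).+1%:R != 0 :> C. Proof. by rewrite pnatr_eq0. Qed.

Let coef_integrable l : cintegrable lam setT (coef l).
Proof. exact: (cintegrable_lin_comp endtr_lin Gi (Q_bmeas l)). Qed.

(** By Fubini, the spherical transform at radius r is the coefficient of the
    Fourier transform on the sphere of radius r. *)
Let spherical_fourierE (r : R) j : 0 < r ->
  spherical_fourier a sigma ip F r (j%:Z - m%:Z) = coef (rev_ord j) (scale3 r (e3 R)).
Proof.
move=> r0; set l := rev_ord j; rewrite /spherical_fourier.
pose f (z : R3 R * R3 R) := endtr (F z.1 \o Q z.2 l)%VF * expi (- dot3 z.1 (scale3 r z.2)).
have Phi_tr x : endtr (F x \o Phi sigma ip r (j%:Z - m%:Z) (opp3 x))%VF =
    (2 * m).+1%:R * cint sigma setT (fun xi => f (x, xi)).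
  have lin : linear ((fun g : 'End(V) => endtr (F x \o g)%VF) : 'End(V) -> C^o).
    by move=> z g h; rewrite comp_lfunDr -comp_lfunZr linearP.
  rewrite (lin_coordE _ lin).
  under eq_bigr => i _ do rewrite coord_Phi -mulrA.
  rewrite -mulr_sumr; congr (_ * _).
  have hi (i : 'I_(\dim {:'End(V)})) : cintegrable sigma setT (fun xi => endtr (F x \o e`_i)%VF *
      (expi (dot3 (opp3 x) (scale3 r xi)) * coord e i (Q xi l))).
    apply: cintegrableZ; have [mf [M fM]] := bmeasM (char_b r (opp3 x)) (Q_bmeas l i).
    exact: (cintegrable_sigma sigma mf fM).
  transitivity (\sum_(i < \dim {:'End(V)}) cint sigma setT (fun xi => endtr (F x \o e`_i)%VF *
      (expi (dot3 (opp3 x) (scale3 r xi)) * coord e i (Q xi l)))).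
    apply: eq_bigr => i _; rewrite [LHS]mulrC [RHS]cintZ//.
    by have [mf [M fM]] := bmeasM (char_b r (opp3 x)) (Q_bmeas l i); exact: (cintegrable_sigma sigma mf fM).
  rewrite -cint_sum//; congr cint; apply/funext => xi; rewrite /f /=.
  rewrite (lin_coordE (Q xi l) lin) mulr_suml; apply: eq_bigr => i _.
  by rewrite opp3_scale dot3Zl mulN1r; ring.
have fi : cintegrable (lam \x sigma)%E setT f.
  rewrite (_ : f = fun z => \sum_p coord e p.1 (F z.1) * coord e p.2 (Q z.2 l) *
    (endtr (e`_p.1 \o e`_p.2)%VF * expi (- dot3 z.1 (scale3 r z.2)))); last first.
    apply/funext => z; rewrite /f (lin_comp_coord _ _ endtr_lin) mulr_suml.
    by apply: eq_bigr => p _; rewrite mulrA.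
  apply: cintegrable_sum => p.
  have [mQ [M QM]] := Q_bmeas l p.2.
  have Qi : cintegrable sigma setT (fun xi => coord e p.2 (Q xi l)).
    exact: (cintegrable_sigma sigma mQ QM).
  apply: (cintegrable_tensor (m1 := lam) (m2 := sigma) (M := cabs (endtr (e`_p.1 \o e`_p.2)%VF) * 2)
    (h := fun z => endtr (e`_p.1 \o e`_p.2)%VF * expi (- dot3 z.1 (scale3 r z.2))) (Fi p.1) Qi).
    apply: cmeasM; first exact: cmeas_cst.
    apply: cmeas_expi; apply: measurable_funN; apply: measurable_dot3 => //.
    by apply: measurable_scale3 => //; exact: measurable_cst.
  move=> z; apply: le_trans (cabsM _ _) _; apply: ler_wpM2l; first exact: cabs_ge0.
  exact: cabs_expi.
have [i1 i2 e1 e2] := cint_fubini (m1 := lam) (m2 := sigma) fi.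
have -> : (fun x => endtr (F x \o Phi sigma ip r (j%:Z - m%:Z) (opp3 x))%VF) =
    fun x => (2 * m).+1%:R * cint sigma setT (fun xi => f (x, xi)).
  by apply/funext => x; exact: Phi_tr.
rewrite cint_leb3; last exact: cintegrableZ.
rewrite cintZ// mulrCA mulKf// e1 -e2 -cintZ//.
rewrite -[RHS]cint_sigma_cst; apply: ae_eq_cint.
- exact: cintegrable_cmeas (cintegrableZ _ i2).
- exact: cmeas_cst.
apply: filterS (sphere_ae Hsigma) => xi s.
rewrite -(coef_radial r l s) /coef (Q_scale xi l r0).
by rewrite (phiG (scale3 r xi) (coef_lin l xi)).
Qed.

Let kappa : R := (2 * m).+1%:R / (4 * pi).

Let kappaE : c%:num * kappa = b%:num.
Proof.
rewrite /kappa mulrA [c%:num * _]mulrC -Habc.2 mulrAC divff ?mul1r//.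
by rewrite gt_eqF// mulr_gt0.
Qed.

Let inv2pi3E : inv2pi3 R = b%:num * a%:num.
Proof.
have p3 : (2 * pi) ^+ 3 != 0 :> R by rewrite expf_neq0// mulf_neq0// gt_eqF.
apply: (mulIf p3); rewrite [b%:num * _]mulrC Habc.1 /inv2pi3.
have p1 : 2 * pi != 0 :> R by rewrite mulf_neq0// gt_eqF.
by move: (2 * pi) p1 => q q0; field.
Qed.

Section Point.
Variable x : R3 R.

(** Its integral over R^3 in polar coordinates is the contribution of Phi_{r, j}
    to the inversion formula, for l the index of - j. *)
Let h l i y : C := kappa%:C * (expi (dot3 x y) * (coef l y * coord e i (Q y l))).

Let cmeas_charx : cmeas (fun y => expi (dot3 x y)).
Proof. by apply: cmeas_expi; apply: measurable_dot3 => //; exact: measurable_cst. Qed.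

Let h_integrable l i : cintegrable lam setT (h l i).
Proof.
apply: cintegrableZ.
rewrite (_ : (fun y => _) = fun y => coef l y * (expi (dot3 x y) * coord e i (Q y l))); last first.
  by apply/funext => y; rewrite mulrCA.
have [mq [M qM]] : bmeas (fun y => expi (dot3 x y) * coord e i (Q y l)).
  apply: bmeasM; last exact: Q_bmeas.
  by split; [exact: cmeas_charx|exists 2 => y; exact: cabs_expi].
exact: (cintegrableM_bounded (coef_integrable l) mq qM).
Qed.

Let integrandE (r : R) j i : 0 < r ->
  coord e i (inversion_integrand a sigma ip F (j%:Z - m%:Z) x r) =
  (4 * pi * r ^+ 2)%:C * cint sigma setT (fun xi => h (rev_ord j) i (scale3 r xi)).
Proof.
move=> r0; rewrite /inversion_integrand linearZ /= coord_Phi (spherical_fourierE _ r0).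
set l := rev_ord j; set t := coef l _.
pose q xi := expi (dot3 x (scale3 r xi)) * coord e i (Q xi l).
have [mq [M qM]] : bmeas q by apply: bmeasM; [exact: char_b|exact: Q_bmeas].
have qi : cintegrable sigma setT q := cintegrable_sigma sigma mq qM.
have -> : cint sigma setT (fun xi => h l i (scale3 r xi)) = (kappa%:C * t) * cint sigma setT q.
  rewrite -cintZ//; apply: ae_eq_cint.
  - apply: (cmeas_comp (cintegrable_cmeas (h_integrable l i))).
    exact: sphere_scaled.
  - exact: cintegrable_cmeas (cintegrableZ _ qi).
  apply: filterS (sphere_ae Hsigma) => xi s.
  by rewrite /h /q (coef_radial r l s) (Q_scale xi l r0) -/t; ring.
have -> : (2 * m).+1%:R = (4 * pi * kappa)%:C :> C.
  rewrite /kappa; move: pi0 => p0.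
  rewrite (_ : 4 * pi * _ = (2 * m).+1%:R) ?rmorph_nat//.
  by rewrite mulrC divfK// gt_eqF// mulr_gt0.
by rewrite !rmorphM /=; ring.
Qed.

Let mPos : measurable Pos. Proof. exact: measurable_itv. Qed.

Let polar_h l i := polar_coordinates Hsigma (h_integrable l i).

Let integrand_polar j i :
  cintegrable mu Pos (fun r => coord e i (inversion_integrand a sigma ip F (j%:Z - m%:Z) x r)) /\
  cint mu Pos (fun r => coord e i (inversion_integrand a sigma ip F (j%:Z - m%:Z) x r)) =
  cint lam setT (h (rev_ord j) i).
Proof.
have [ip1 ip2] := polar_h (rev_ord j) i.
have [E1 E2] := @eq_cint _ _ _ mu Pos
  (fun r => coord e i (inversion_integrand a sigma ip F (j%:Z - m%:Z) x r)) _ mPos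
  (fun r (r0 : Pos r) => integrandE j i (let: conj p _ := andP r0 in p)).
by split; [apply/E1|rewrite E2].
Qed.

Lemma integrand_integrable j :
  vintegrable (leb1 c) Pos (inversion_integrand a sigma ip F (j%:Z - m%:Z) x).
Proof.
move=> i; apply/(cintegrable_mscale mu c0 mPos).
exact: (integrand_polar j i).1.
Qed.

Let v i y : C := kappa%:C * (expi (dot3 x y) * coord e i (G y)).

Let v_integrable i : cintegrable lam setT (v i).
Proof.
apply: cintegrableZ.
rewrite (_ : (fun y => _) = fun y => coord e i (G y) * expi (dot3 x y)); last first.
  by apply/funext => y; rewrite mulrC.
exact: (cintegrableM_bounded (Gi i) cmeas_charx (fun y => cabs_expi _)).
Qed.

(** Both sides are computed in polar coordinates, where [G_expand] applies on each
    sphere of positive radius. *)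
Let sum_h i : \sum_l cint lam setT (h l i) = cint lam setT (v i).
Proof.
rewrite -cint_sum//.
have ui : cintegrable lam setT (fun y => \sum_l h l i y) by exact: cintegrable_sum.
rewrite -(polar_coordinates Hsigma ui).2 -(polar_coordinates Hsigma (v_integrable i)).2.
apply: (eq_cint mu mPos _).2 => r; rewrite /= in_itv /= andbT => r0; congr (_ * _).
apply: ae_eq_cint.
- exact: (cmeas_comp (cintegrable_cmeas ui) (sphere_scaled r)).
- exact: (cmeas_comp (cintegrable_cmeas (v_integrable i)) (sphere_scaled r)).
apply: filterS (sphere_ae Hsigma) => xi s.
rewrite /h /v (G_expand r0 s) linear_sum !mulr_sumr; apply: eq_bigr => l _.
by rewrite linearZ /= (Q_scale xi l r0).
Qed.

Let cint_charG i : cint lam setT (fun y => expi (dot3 x y) * coord e i (G y)) =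
  (a%:num)%:C * cint lam setT
    (fun y => ftrans lam id (fun z => coord e i (F z)) y * expi (dot3 x y)).
Proof.
have a1 : (a%:num)%:C != 0 :> C by rewrite eq_complex /= gt_eqF.
have E y : expi (dot3 x y) * coord e i (G y) = (a%:num)%:C *
    (ftrans lam id (fun z => coord e i (F z)) y * expi (dot3 x y)).
  by rewrite (phiG y (coord_lin i)) [LHS]mulrC -mulrA.
have E' y : ftrans lam id (fun z => coord e i (F z)) y * expi (dot3 x y) =
    (a%:num)%:C^-1 * (coord e i (G y) * expi (dot3 x y)).
  by rewrite [coord e i _ * _]mulrC E mulKf.
have Ti : cintegrable lam setT (fun y =>
    ftrans lam id (fun z => coord e i (F z)) y * expi (dot3 x y)).
  rewrite (funext E'); apply: cintegrableZ.
  exact: (cintegrableM_bounded (Gi i) cmeas_charx (fun y => cabs_expi _)).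
by rewrite -(cintZ _ Ti) (funext E).
Qed.

Lemma sum_vint : (forall i, coord e i (F x) = (inv2pi3 R)%:C * cint lam setT
    (fun y => ftrans lam id (fun z => coord e i (F z)) y * expi (dot3 x y))) ->
  F x = \sum_(j < (2 * m).+1)
    vint (leb1 c) Pos (inversion_integrand a sigma ip F (j%:Z - m%:Z) x).
Proof.
move=> inv; apply: eq_coord => i; rewrite linear_sum /=.
under eq_bigr => j _ do rewrite coord_vint.
transitivity (\sum_(j < (2 * m).+1) (c%:num)%:C * cint lam setT (h (rev_ord j) i)); last first.
  apply: eq_bigr => j _; have [i1 e1] := integrand_polar j i.
  have h2 := cint_mscale (mu := mu) c mPos i1.
  by rewrite -e1; exact: esym h2.
have rev_sum : \sum_j cint lam setT (h (rev_ord j) i) = \sum_l cint lam setT (h l i).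
  by rewrite [RHS](reindex_inj rev_ord_inj).
rewrite -mulr_sumr rev_sum sum_h /v cintZ; last first.
  rewrite (_ : (fun y => _) = fun y => coord e i (G y) * expi (dot3 x y)); last first.
    by apply/funext => y; rewrite mulrC.
  exact: (cintegrableM_bounded (Gi i) cmeas_charx (fun y => cabs_expi _)).
rewrite mulrA -rmorphM kappaE inv cint_charG mulrA -rmorphM.
by rewrite -inv2pi3E.
Qed.

End Point.

Lemma ftrans_integrable i :
  cintegrable lam setT (ftrans lam id (fun z => coord e i (F z))).
Proof.
have a1 : (a%:num)%:C != 0 :> C by rewrite eq_complex /= gt_eqF.
rewrite (_ : ftrans _ _ _ = fun y => (a%:num)%:C^-1 * coord e i (G y)).
  exact: cintegrableZ.
by apply/funext => y; rewrite (phiG y (coord_lin i)) mulKf.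
Qed.

(** The Fourier inversion formula holds outside a null set for each of the finitely
    many coordinates of F. *)
Lemma spherical_inversion : {ae leb3 a, forall x,
  (forall j : 'I_(2 * m).+1, vintegrable (leb1 c) Pos
     (inversion_integrand a sigma ip F (j%:Z - m%:Z) x)) /\
  F x = \sum_(j < (2 * m).+1)
          vint (leb1 c) Pos (inversion_integrand a sigma ip F (j%:Z - m%:Z) x)}.
Proof.
apply/ae_lam.
have inv : {ae lam, forall x, forall i, coord e i (F x) = (inv2pi3 R)%:C * cint lam setT
    (fun y => ftrans lam id (fun z => coord e i (F z)) y * expi (dot3 x y))}.
  apply: filter_forall => i; exact: (fourier_inversion (Fi i) (ftrans_integrable i)).
apply: filterS inv => x inv; split; last exact: sum_vint.
by move=> j; exact: integrand_integrable.
Qed.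

End Inversion.

Theorem theorem5 (R : realType) (m : nat)
    (a b c : {nonneg R}) (Habc : normalized_measures m a b c)
    (sigma : probability (R3 R) R) (Hsigma : is_sphere_measure sigma)
    (ip : {dot H R m for @Num.conj R[i]}) (Hip : unitary ip)
    (F : R3 R -> 'End(H R m)) (HF : L1tau a F)
    (HFhat : vintegrable (leb3 b) setT (fourier a F)) :
  {ae leb3 a, forall x,
    (forall j : 'I_(2 * m).+1,
       vintegrable (leb1 c) `]0, +oo[
         (inversion_integrand a sigma ip F (j%:Z - m%:Z) x)) /\
    F x = \sum_(j < (2 * m).+1)
            vint (leb1 c) `]0, +oo[
              (inversion_integrand a sigma ip F (j%:Z - m%:Z) x)}.
Proof. exact: (spherical_inversion Habc Hsigma Hip HF HFhat). Qed.
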